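(* Let $(G,1,o)$ be the rooted graph with unit conductances constructed in the context. The rooted network $(G,1,o)$ is recurrent and has a unique potential $h$. Furthermore, two independent $h$-processes have infinite intersection almost surely, and the uniform spanning tree (UST) on $(G,1)$ has infinitely many ends almost surely.
   Context: Construction of $G$. Start with an infinite ternary tree $T$ (every vertex has three children) rooted at $o$, and enumerate the vertices of $T$ as $\{v_1,v_2,\ldots\}$ in breadth-first order, that is, so that the level (distance to $o$ in $T$) of $v_n$ is a non-decreasing function of $n$ (so $v_1=o$). For each integer $\ell\ge1$, replace every edge of $T$ between a vertex of level $\ell$ and its parent at level $\ell-1$ by a path of length $3^{3^\ell}$. Denote the resulting tree by $\widetilde T$. Attach to $\widetilde T$ at $o$ an infinite path $\mathbb{N}=(1,2,3,\ldots)$ (with $o$ joined to $1$ by an edge), and for every $n\ge 1$ connect $n$ to $v_n$ by a path of length $3^{3^\ell}$, where $\ell$ (which satisfies $\ell\ge\log_3n-1$) is the level of $v_n$. The resulting graph is $G$, rooted at $o$, with all conductances equal to $1$. For an infinite, connected, locally finite graph $G=(V,E)$ with unit conductances, the Laplacian of $f:V\to\mathbb{R}$ is $\Delta f(v)=\sum_{x\sim v}(f(x)-f(v))$, and $p(x,y)$ are the transition probabilities of simple random walk; the graph is recurrent if this walk is recurrent. A potential on $(G,1,o)$ is a function $h:V\to[0,\infty)$ with $h(o)=0$, $\Delta h(o)=1$ and $\Delta h(v)=0$ for every $v\ne o$. The $h$-process is the Markov chain on $S_h=\{v:h(v)>0\}$ with transition probabilities $p^h(x,y)=p(x,y)h(y)/h(x)$,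 started from the initial distribution $\mu_h(v)=h(v)$, $v\sim o$. The intersection of two processes is the set of vertices visited by both. On a recurrent infinite graph, the UST is the weak limit of the uniform random spanning trees along an exhaustion by finite connected subgraphs; it is almost surely a spanning tree. The ends of a tree correspond to the infinite simple paths from a fixed vertex. *)

(* Defs.v *)
From HB Require Import structures.
From mathcomp Require Import all_boot all_order all_algebra.
From mathcomp Require Import finmap.
From mathcomp Require Import all_classical all_reals all_analysis.

Set Implicit Arguments.
Unset Strict Implicit.
Unset Printing Implicit Defensive.

Import Order.TTheory GRing.Theory Num.Theory.
Import numFieldNormedType.Exports.

Local Open Scope classical_set_scope.
Local Open Scope ring_scope.

Definition linked (V : eqType) (e : rel V) (x y : V) : Prop :=
  exists2 p : seq V, path e x p & last x p = y.

(* For symmetric irreflexive [e]: a cycle visits at least three vertices. *)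
Definition acyclic (V : eqType) (e : rel V) : Prop :=
  forall c : seq V, cycle e c -> uniq c -> (size c <= 2)%N.

Record graph := Graph {
  vertex :> countType;
  adj : rel vertex;
  adj_sym : symmetric adj;
  adj_irr : irreflexive adj;
  adj_locally_finite : forall x, finite_set [set y | adj x y];
  adj_connected : forall x y, linked adj x y;
  vertex_infinite : infinite_set [set: vertex] }.

Section UnitNetwork.
Context {R : realType} {G : graph}.

Definition neighbours (x : G) : set G := [set y | adj x y].

Definition degree (x : G) : nat := #|` fset_set (neighbours x)|.

Definition laplacian (f : G -> R) (x : G) : R :=
  \sum_(y \in neighbours x) (f y - f x).

Definition srw (x y : G) : R :=
  if adj x y then (degree x)%:R^-1 else 0.

Definition potential (o : G) (h : G -> R) : Prop :=
  [/\ forall x, 0 <= h x, h o = 0, laplacian h o = 1 &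
      forall x, x != o -> laplacian h x = 0].

End UnitNetwork.

Section MarkovChain.
Context {R : realType} {d : measure_display} {Omega : measurableType d}.
Variable P : probability Omega R.

(* Countable state spaces carry the discrete sigma-algebra; the law of the
   chain is given by its finite-dimensional distributions. *)
Definition markov_chain (S : Type) (mu0 : S -> R) (p : S -> S -> R)
    (X : nat -> Omega -> S) : Prop :=
  (forall n (D : set S), measurable (X n @^-1` D)) /\
  (forall n (s : nat -> S),
     P [set w | forall i, (i <= n)%N -> X i w = s i] =
     (mu0 (s 0%N) * \prod_(i < n) p (s i) (s i.+1))%:E).

Definition generated_by (S : Type) (X : nat -> Omega -> S) : set (set Omega) :=
  <<s [set A | exists n (D : set S), A = X n @^-1` D] >>.

Definition independent_processes (S1 S2 : Type)
    (X : nat -> Omega -> S1) (Y : nat -> Omega -> S2) : Prop :=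
  forall A B, generated_by X A -> generated_by Y B ->
    P (A `&` B) = (P A * P B)%E.

Definition visited (S : Type) (X : nat -> Omega -> S) (w : Omega) : set S :=
  [set x | exists n, X n w = x].

End MarkovChain.

Definition recurrent (R : realType) (G : graph) : Prop :=
  forall (d : measure_display) (Omega : measurableType d)
    (P : probability Omega R) (x : G) (X : nat -> Omega -> G),
    markov_chain P (fun y => (y == x)%:R) srw X ->
    {ae P, forall w, exists2 n, (0 < n)%N & X n w = x}.

Section HProcess.
Context {R : realType} {G : graph}.
Variables (o : G) (h : G -> R).

Definition h_state := {x : G | 0 < h x}.

Definition h_init (x : h_state) : R := if adj o (val x) then h (val x) else 0.

Definition h_transition (x y : h_state) : R :=
  srw (val x) (val y) * h (val y) / h (val x).

Definition h_process (d : measure_display) (Omega : measurableType d)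
    (P : probability Omega R) (X : nat -> Omega -> h_state) : Prop :=
  markov_chain P h_init h_transition X.

End HProcess.

(* A set of edges is encoded by a set of ordered pairs of vertices, an edge
   {x, y} being represented by both (x, y) and (y, x). *)
Record finite_subgraph (G : graph) := FiniteSubgraph {
  sub_vertices : {fset G};
  sub_edges : {fset G * G};
  sub_edges_sym : forall x y, (x, y) \in sub_edges -> (y, x) \in sub_edges;
  sub_edges_adj : forall x y, (x, y) \in sub_edges -> adj x y;
  sub_edges_vertices :
    forall x y, (x, y) \in sub_edges -> x \in sub_vertices }.

Section UniformSpanningTree.
Context {R : realType} {G : graph}.

Definition edge_rel (T : G * G -> bool) : rel G := fun x y => T (x, y).

Definition connects (T : G * G -> bool) (A : {fset G}) : Prop :=
  forall x y, x \in A -> y \in A -> linked (edge_rel T) x y.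

Definition sub_connected (H : finite_subgraph G) : Prop :=
  connects (fun e => e \in sub_edges H) (sub_vertices H).

Definition spanning_trees (H : finite_subgraph G) : set {fset G * G} :=
  [set T | [/\ (T `<=` sub_edges H)%fset,
               forall x y, (x, y) \in T -> (y, x) \in T,
               connects (fun e => e \in T) (sub_vertices H) &
               acyclic (edge_rel (fun e => e \in T))]].

Definition exhaustion (H : nat -> finite_subgraph G) : Prop :=
  [/\ forall n, sub_connected (H n),
      forall n, (sub_vertices (H n) `<=` sub_vertices (H n.+1))%fset /\
                (sub_edges (H n) `<=` sub_edges (H n.+1))%fset,
      forall x : G, exists n, x \in sub_vertices (H n) &
      forall x y : G, adj x y -> exists n, (x, y) \in sub_edges (H n)].

End UniformSpanningTree.

Definition configuration (G : graph) := {ptws G * G -> bool}.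

Definition configuration_borel (G : graph) :=
  g_sigma_algebraType (@open (configuration G)).

Section WeakLimit.
Context {R : realType} {G : graph}.

Definition ust_mean (H : finite_subgraph G) (f : configuration G -> R) : R :=
  (\sum_(T \in spanning_trees H) f (fun e => e \in T)) /
  #|` fset_set (spanning_trees H)|%:R.

(* [mu] is the weak limit, along some exhaustion, of the uniform laws on the
   spanning trees; [ust_mean H f] is the expectation of [f] under the uniform
   law on the spanning trees of [H]. *)
Definition is_ust (mu : probability (configuration_borel G) R) : Prop :=
  exists2 H : nat -> finite_subgraph G, exhaustion H &
    forall f : configuration G -> R^o,
      continuous f -> (exists M : R, forall T, `|f T| <= M) ->
      (ust_mean (H n) f)%:E @[n --> \oo] --> (\int[mu]_T (f T)%:E)%E.

End WeakLimit.

Definition simple_rays (G : graph) (T : configuration G) (x : G) :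
    set (nat -> G) :=
  [set g | [/\ g 0%N = x, injective g & forall n, T (g n, g n.+1)]].

(* The ends of a tree are its infinite simple paths from a fixed vertex. *)
Definition infinitely_many_ends (G : graph) (o : G) (T : configuration G) :
    Prop :=
  infinite_set (simple_rays T o).

Section Subdivision.
Variables (S E : countType) (src tgt : E -> S) (len : E -> nat).

Definition subdivided : countType := (S + {e : E & 'I_(len e).-1})%type.

Definition interior_vertex (e : E) (j : 'I_(len e).-1) : subdivided :=
  inr (existT (fun e => 'I_(len e).-1) e j).

(* The [k]-th vertex of the path of length [len e] that replaces [e]: [src e]
   for [k = 0], [tgt e] for [k = len e], and the interior vertex of index
   [k.-1] in between. *)
Definition path_vertex (e : E) (k : nat) : subdivided :=
  if k == 0%N then inl (src e)
  else if insub k.-1 is Some j then @interior_vertex e j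
  else inl (tgt e).

Definition subdivided_adj : rel subdivided := fun x y =>
  `[< exists e k, (k < len e)%N /\
        (x = path_vertex e k /\ y = path_vertex e k.+1 \/
         y = path_vertex e k /\ x = path_vertex e k.+1) >].

Hypothesis len_gt0 : forall e, (0 < len e)%N.
Hypothesis src_tgt : forall e, src e <> tgt e.
Hypothesis incident_finite :
  forall s, finite_set [set e | src e = s \/ tgt e = s].

Lemma path_vertex0 e : path_vertex e 0 = inl (src e).
Proof. by []. Qed.

Lemma path_vertex_len e : path_vertex e (len e) = inl (tgt e).
Proof.
by rewrite /path_vertex gtn_eqF ?len_gt0 // insubF // ltnn.
Qed.

Lemma path_vertex_in e (j : 'I_(len e).-1) :
  path_vertex e j.+1 = interior_vertex j.
Proof. by rewrite /path_vertex /= valK. Qed.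

Lemma path_vertex_inE e k : (0 < k < len e)%N ->
  exists2 j : 'I_(len e).-1, k = j.+1 &
    path_vertex e k = interior_vertex j.
Proof.
case: k => // k /= kl.
have kl' : (k < (len e).-1)%N by rewrite -ltnS prednK.
by exists (Ordinal kl') => //; rewrite -path_vertex_in.
Qed.

Variant path_vertex_spec e k : subdivided -> Prop :=
| PathSrc of k = 0%N : path_vertex_spec e k (inl (src e))
| PathTgt of k = len e : path_vertex_spec e k (inl (tgt e))
| PathIn (j : 'I_(len e).-1) of k = j.+1 :
    path_vertex_spec e k (interior_vertex j).

Lemma path_vertexP e k : (k <= len e)%N ->
  path_vertex_spec e k (path_vertex e k).
Proof.
rewrite leq_eqVlt => /orP[/eqP ->|kl].
  by rewrite path_vertex_len; constructor.
have [->|k0] := posnP k; first by rewrite path_vertex0; constructor.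
have [|j kj ->] := @path_vertex_inE e k; first by rewrite k0.
by constructor.
Qed.

Lemma subdivided_adj_sym : symmetric subdivided_adj.
Proof.
by move=> x y; apply/asboolP/asboolP => -[e [k [kl H]]]; exists e, k; tauto.
Qed.

Lemma subdivided_adj_irr : irreflexive subdivided_adj.
Proof.
move=> x; apply/asboolP => -[e [k [kl H]]].
have {H} : path_vertex e k = path_vertex e k.+1 by case: H => -[<- <-].
have := src_tgt (e := e).
have j1 := kl.
case: (path_vertexP (ltnW kl)) => [k0|kE|j kj];
  case: (path_vertexP kl) => [//|kE'|j' kj'] // st.
- by case.
- by move: j1; rewrite kE ltnn.
- move=> /(congr1 (fun x : subdivided =>
    if x is inr u then nat_of_ord (tagged u) else 0%N)) /= jj.
  by move: kj'; rewrite kj jj => -[] /esym/n_Sn.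
Qed.

Lemma subdivided_adj_finite x : finite_set [set y | subdivided_adj x y].
Proof.
pose E0 : set E := match x with
  | inl s => [set e | src e = s \/ tgt e = s]
  | inr u => [set tag u] end.
have fE : finite_set E0.
  by rewrite /E0; case: (x) => [s|u] //; exact: incident_finite.
apply: (@sub_finite_set _ _
  (\bigcup_(e in E0) (path_vertex e @` `I_(len e).+1))); last first.
  by apply: bigcup_finite => // e _; exact/finite_image/finite_II.
have inE0 e k : (k <= len e)%N -> x = path_vertex e k -> E0 e.
  move=> kl xE; rewrite /E0 xE.
  by case: path_vertexP => //= _; [left|right].
move=> y /= /asboolP[e [k [kl [[xE ->]|[-> xE]]]]].
- by exists e; [exact: (inE0 e k (ltnW kl))|exists k.+1].
- by exists e; [exact: (inE0 e k.+1 kl)|exists k => //=; exact: ltnW].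
Qed.

Lemma linked_refl (V : eqType) (r : rel V) x : linked r x x.
Proof. by exists [::]. Qed.

Lemma linked_trans (V : eqType) (r : rel V) x y z :
  linked r x y -> linked r y z -> linked r x z.
Proof.
move=> [p pp py] [q qq qz]; exists (p ++ q); last by rewrite last_cat py.
by rewrite cat_path pp py.
Qed.

Lemma linked_edge (V : eqType) (r : rel V) x y : r x y -> linked r x y.
Proof. by move=> rxy; exists [:: y] => //=; rewrite rxy. Qed.

Lemma linked_sym (V : eqType) (r : rel V) x y :
  symmetric r -> linked r x y -> linked r y x.
Proof.
move=> rs [p]; elim: p x => [|z p IH] x /=.
  by move=> _ ->; exact: linked_refl.
move=> /andP[xz pp] lp; apply: linked_trans (IH _ pp lp) _.
by apply: linked_edge; rewrite rs.
Qed.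

Lemma linked_path e k : (k <= len e)%N ->
  linked subdivided_adj (inl (src e)) (path_vertex e k).
Proof.
elim: k => [|k IH] kl; first exact: linked_refl.
apply: linked_trans (IH (ltnW kl)) _; apply: linked_edge.
by apply/asboolP; exists e, k; split => //; left.
Qed.

Lemma linked_src_tgt e :
  linked subdivided_adj (inl (src e)) (inl (tgt e)).
Proof. by rewrite -path_vertex_len; exact: linked_path. Qed.

Lemma subdivided_connected (o : S) :
  (forall s, linked subdivided_adj (inl o) (inl s)) ->
  forall x y, linked subdivided_adj x y.
Proof.
move=> oS.
have ox x : linked subdivided_adj (inl o) x.
  case: x => [//|[e j]].
  apply: linked_trans (oS (src e)) _; rewrite -[inr _]path_vertex_in.
  by apply: linked_path; rewrite -[X in (_ <= X)%N]prednK ?len_gt0 //; exact: leqW.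
move=> x y; apply: linked_trans (ox y).
by apply: linked_sym; first exact: subdivided_adj_sym.
Qed.

End Subdivision.

(* Vertices of the infinite ternary tree are words over a three-letter
   alphabet: the root is the empty word, the children of [s] are the [i :: s],
   and the level is the length. *)
Definition ternary := seq 'I_3.

(* Indices are shifted by one: [bfs n] is v_(n+1). *)
Record bfs_enumeration := BfsEnumeration {
  bfs :> nat -> ternary;
  bfs_bij : bijective bfs;
  bfs_level : forall m n, (m <= n)%N -> (size (bfs m) <= size (bfs n))%N }.

(* Branch vertices: those of the ternary tree and the integers n >= 1, the
   integer n + 1 being [inr n]. *)
Definition branch_vertex : countType := (ternary + nat)%type.

(* [ray_vertex n] is the integer n, with the root o in the role of 0. *)
Definition ray_vertex (n : nat) : branch_vertex :=
  if n is m.+1 then inr m else inl [::].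

(* Edges before subdivision: the tree edge from [s] to its child [i :: s], the
   edge of the attached path from n to n + 1, and the link between the integer
   n + 1 and v_(n+1). *)
Inductive branch_edge :=
| TreeEdge (s : ternary) (i : 'I_3)
| RayEdge (n : nat)
| LinkEdge (n : nat).

Definition branch_edge_code (e : branch_edge) : ternary * 'I_3 + (nat + nat) :=
  match e with
  | TreeEdge s i => inl (s, i)
  | RayEdge n => inr (inl n)
  | LinkEdge n => inr (inr n)
  end.

Definition branch_edge_decode (c : ternary * 'I_3 + (nat + nat)) :=
  match c with
  | inl (s, i) => TreeEdge s i
  | inr (inl n) => RayEdge n
  | inr (inr n) => LinkEdge n
  end.

Lemma branch_edge_codeK : cancel branch_edge_code branch_edge_decode.
Proof. by case. Qed.

HB.instance Definition _ :=
  Countable.copy branch_edge (can_type branch_edge_codeK).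

Section Construction.
Variable v : bfs_enumeration.

Definition branch_src (e : branch_edge) : branch_vertex :=
  match e with
  | TreeEdge s _ => inl s
  | RayEdge n => ray_vertex n
  | LinkEdge n => ray_vertex n.+1
  end.

Definition branch_tgt (e : branch_edge) : branch_vertex :=
  match e with
  | TreeEdge s i => inl (i :: s)
  | RayEdge n => ray_vertex n.+1
  | LinkEdge n => inl (v n)
  end.

Definition branch_len (e : branch_edge) : nat :=
  match e with
  | TreeEdge s _ => 3 ^ 3 ^ (size s).+1
  | RayEdge _ => 1
  | LinkEdge n => 3 ^ 3 ^ size (v n)
  end.

Lemma branch_len_gt0 e : (0 < branch_len e)%N.
Proof. by case: e => [s i|n|n] //=; rewrite expn_gt0. Qed.

Lemma branch_src_tgt e : branch_src e <> branch_tgt e.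
Proof.
case: e => [s i|[|n]|n] //=.
- by move=> [] /(congr1 size)/n_Sn.
- by move=> [] /n_Sn.
Qed.

Lemma branch_incident_finite s :
  finite_set [set e | branch_src e = s \/ branch_tgt e = s].
Proof.
have [w vK wK] := bfs_bij v.
pose L : seq branch_edge := match s with
 | inl t => RayEdge 0 :: LinkEdge (w t) ::
     [seq TreeEdge t i | i <- enum 'I_3] ++
     [seq TreeEdge (behead t) i | i <- enum 'I_3]
 | inr n => [:: RayEdge n; RayEdge n.+1; LinkEdge n] end.
apply: (@sub_finite_set _ _ [set` L]); last exact: finite_seq.
move=> e /=; rewrite /L; case: s {L} => [t|m]; case: e => [s i|[|n]|n] /=;
  try by case.
- case=> -[<-]; rewrite !inE !mem_cat; apply/orP; right; apply/orP; right;
    apply/orP; [left|right]; by apply: map_f; rewrite mem_enum.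
- by case=> // -[<-]; rewrite vK !inE eqxx orbT.
- by case=> // -[<-]; rewrite !inE eqxx.
- by case=> -[<-]; rewrite !inE eqxx ?orbT.
- by case=> // -[<-]; rewrite !inE eqxx ?orbT.
Qed.

Definition G_vertex : countType := subdivided branch_vertex branch_len.

Definition G_adj : rel G_vertex :=
  @subdivided_adj _ _ branch_src branch_tgt branch_len.

Lemma G_connected x y : linked G_adj x y.
Proof.
have st := linked_src_tgt branch_src branch_tgt branch_len_gt0.
apply: (@subdivided_connected _ _ branch_src branch_tgt _ branch_len_gt0
  (inl [::] : branch_vertex)) => -[t|n].
- elim: t => [|i t IH]; first exact: linked_refl.
  exact: linked_trans IH (st (TreeEdge t i)).
- elim: n => [|n IH]; first exact: (st (RayEdge 0)).
  exact: linked_trans IH (st (RayEdge n.+1)).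
Qed.

Lemma G_infinite : infinite_set [set: G_vertex].
Proof.
pose f (n : nat) : G_vertex := inl (inr n).
move=> fin; apply: infinite_nat; rewrite -(preimage_setT f).
by apply: finite_preimage fin => m n _ _ [].
Qed.

Definition G : graph :=
  @Graph G_vertex G_adj
    (@subdivided_adj_sym _ _ _ _ _)
    (subdivided_adj_irr branch_len_gt0 branch_src_tgt)
    (subdivided_adj_finite branch_len_gt0 branch_incident_finite)
    G_connected G_infinite.

Definition G_root : G := inl (inl [::]).

End Construction.

(* Main.v *)
(** Cutting at level l separates a ball from the rest of the graph along one edge
    of the ray and the 3^(l+1) paths to level l+1, whose length 3^3^(l+1) is the
    cube of that of the longest path in the ball.

    Linear cutoff functions along these paths have vanishing energy, hence
    recurrence, and potentials are 1-Lipschitz. The current of a potential that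
    a word receives from its children splits evenly between its parent and the
    ray, up to an error controlled by the Lipschitz bound; iterating, the current
    through the tree at level l is negligible. So the difference of two
    potentials has vanishing energy, and an h-process meets the ray vertex at the
    exit of the ball with probability close to 1.

    For spanning trees, exchanging a missing edge with any edge of a long path
    that separates its ends gives many trees from one, so up to small probability
    the tree contains the ray, is connected in the ball, and attaches each further
    word by exactly one of its two equally long paths, to its parent or to the
    ray. Exchanging the states of these two paths shows that the choices are
    independent fair coins: the words attached to their parents form
    supercritical branching processes, three children with probability 1/2 each,
    and every word of level M almost surely has a descendant starting an infinite
    branch. *)
From mathcomp Require Import all_boot all_order all_algebra.
From mathcomp Require Import finmap.
From mathcomp Require Import all_classical all_reals all_analysis.
From mathcomp Require Import zify ring lra.
Require Import Defs.

Set Implicit Arguments.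
Unset Strict Implicit.
Unset Printing Implicit Defensive.

Import Order.TTheory GRing.Theory Num.Theory.
Import numFieldNormedType.Exports.

Local Open Scope classical_set_scope.
Local Open Scope ring_scope.

(** Only events decided by finitely many edges pass to the weak limit, which is a law on arbitrary
    sets of ordered pairs. The exceptional events are therefore defined on configurations with a
    finite horizon [K]; their bounds do not depend on [K], and they increase with [K], which is sent
    to infinity before [L]. The rays are then read off the configuration itself.

    The cube in [D l.+1 = D l ^ 3] leaves room twice. A union bound over the unit edges of a path of
    length [D l], each against a path of length [D l.+1], still leaves a factor of order [D l ^- 2].
    And values of a potential, of order [D l], produce slopes of order [D l ^- 2] on the paths to
    the next level, so that even the product of a value and the current through the level, a
    boundary term of Green's formula, tends to 0.

    Separation in a tree is established by an invariant: if no path of a family separates two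
    vertices, one unit edge can be cut from every path of the family at once, and a function
    constant along what remains but different at the two vertices gives a contradiction. *)

Ltac feed H := let T := type of H in match T with ?A -> _ =>
  let h := fresh in assert (h : A); [|specialize (H h); clear h] end.

(** * Discrete calculus on a locally finite graph *)

Section Network.
Context {R : realType} {G : graph}.
Implicit Types (x y : G) (f phi w : G -> R) (A : {fset G}).

Definition nbrs x : {fset G} := fset_set (neighbours x).

Lemma mem_nbrs x y : (y \in nbrs x) = adj x y.
Proof.
rewrite in_fset_set; last exact: adj_locally_finite.
by apply/idP/idP; rewrite inE.
Qed.

Lemma laplacianE f x : laplacian f x = \sum_(y <- nbrs x) (f y - f x).
Proof. by rewrite /laplacian fsbig_finite //; exact: adj_locally_finite. Qed.

Lemma sum_nbrs A x (F : G -> R) : {subset nbrs x <= A} ->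
  \sum_(y <- nbrs x) F y = \sum_(y <- A | adj x y) F y.
Proof.
move=> sub; rewrite -[RHS]big_filter; apply: perm_big; apply: uniq_perm => //.
  exact: filter_uniq.
move=> y; rewrite mem_filter -mem_nbrs.
by apply/idP/andP => [yx|[]//]; split => //; exact: sub.
Qed.

(** Every edge inside [A] is counted in both orientations, whence the factor 1/2 in [green]. *)
Definition pair_sum A (F : G -> G -> R) : R :=
  \sum_(x <- A) \sum_(y <- A | adj x y) F x y.

Lemma pair_sum_swap A F : pair_sum A F = pair_sum A (fun x y => F y x).
Proof.
rewrite /pair_sum (exchange_big_dep xpredT) //=; apply: eq_bigr => x _.
by apply: eq_bigl => y; rewrite adj_sym.
Qed.

Lemma pair_sumD A F F' :
  pair_sum A (fun x y => F x y + F' x y) = pair_sum A F + pair_sum A F'.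
Proof.
by rewrite /pair_sum -big_split; apply: eq_bigr => x _; rewrite -big_split.
Qed.

Lemma pair_sumZ A (c : R) F :
  pair_sum A (fun x y => c * F x y) = c * pair_sum A F.
Proof.
by rewrite /pair_sum mulr_sumr; apply: eq_bigr => x _; rewrite mulr_sumr.
Qed.

Lemma ler_pair_sum A F F' :
  (forall x y, adj x y -> F x y <= F' x y) -> pair_sum A F <= pair_sum A F'.
Proof. by move=> FF'; apply: ler_sum => x _; apply: ler_sum => y; exact: FF'. Qed.

Lemma pair_sum_ge A F x y : (forall x y, 0 <= F x y) ->
  x \in A -> y \in A -> adj x y -> F x y <= pair_sum A F.
Proof.
move=> F0 xA yA xy; rewrite /pair_sum (big_fsetD1 x) //=.
rewrite [X in _ <= X + _]big_mkcond (big_fsetD1 y) //= xy -addrA.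
rewrite ler_wpDr // addr_ge0 //; first by apply: sumr_ge0 => z _; case: ifP.
by apply: sumr_ge0 => z _; exact: sumr_ge0.
Qed.

(** No edge meeting the support of [phi] leaves [A], so that summation by parts has no boundary
    term. *)
Definition supported A phi : Prop :=
  forall x, phi x != 0 -> x \in A /\ {subset nbrs x <= A}.

Lemma supported_ex phi (F : seq G) : finite_set [set x | phi x != 0] ->
  exists A, supported A phi /\ {subset F <= A}.
Proof.
move=> fin.
have fB : finite_set ([set x | phi x != 0] `|` [set` F] `|`
    \bigcup_(x in [set x | phi x != 0]) neighbours x).
  have fF : finite_set [set` F] by exact: finite_seq.
  rewrite !finite_setU; split; first by split.
  by apply: bigcup_finite => // x _; exact: adj_locally_finite.
exists (fset_set ([set x | phi x != 0] `|` [set` F] `|`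
    \bigcup_(x in [set x | phi x != 0]) neighbours x)); split => x.
  move=> px; split; first by rewrite in_fset_set //; apply/mem_set; left; left.
  move=> y; rewrite mem_nbrs in_fset_set // => xy; apply/mem_set; right.
  by exists x.
by move=> xF; rewrite in_fset_set //; apply/mem_set; left; right.
Qed.

Lemma green A phi f : supported A phi ->
  \sum_(x <- A) phi x * laplacian f x =
  - 2^-1 * pair_sum A (fun x y => (phi y - phi x) * (f y - f x)).
Proof.
move=> supp.
pose S := pair_sum A (fun x y => phi x * (f y - f x)).
have -> : \sum_(x <- A) phi x * laplacian f x = S.
  apply: eq_bigr => x _; have [->|px] := eqVneq (phi x) 0.
    by rewrite mul0r big1 // => y _; rewrite mul0r.
  by rewrite laplacianE (sum_nbrs _ (supp x px).2) mulr_sumr.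
have : S + S = - pair_sum A (fun x y => (phi y - phi x) * (f y - f x)).
  rewrite {2}/S pair_sum_swap -pair_sumD -mulN1r -pair_sumZ.
  by apply: eq_bigr => x _; apply: eq_bigr => y _; ring.
lra.
Qed.

Definition dirichlet A phi : R := pair_sum A (fun x y => (phi y - phi x) ^+ 2).

(** Caccioppoli inequality: the Laplacian of [w] is tested with [phi ^+ 2 * w], and the cross term
    is absorbed into the weighted energy. *)
Lemma caccioppoli A phi w (t c : R) : supported A phi ->
  (forall x, `|w x| <= t) ->
  - c <= \sum_(x <- A) phi x ^+ 2 * w x * laplacian w x ->
  pair_sum A (fun x y => (phi x ^+ 2 + phi y ^+ 2) * (w y - w x) ^+ 2) <=
  8 * c + 8 * t ^+ 2 * dirichlet A phi.
Proof.
move=> supp wt; rewrite (@green A (fun x => phi x ^+ 2 * w x)); last first.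
  move=> x px; apply: supp; apply: contra_neq px => ->.
  by rewrite expr0n /= mul0r.
set S := pair_sum A _ => cS.
set L := pair_sum A _.
have : 4^-1 * L + - (2 * t ^+ 2) * dirichlet A phi <= S; last by lra.
rewrite -!pair_sumZ -pair_sumD; apply: ler_pair_sum => x y _.
have := wt x; have := wt y; rewrite !ler_norml => /andP[y1 y2] /andP[x1 x2].
(* Discrete product rule: the increment of [phi ^+ 2 * w] is the mean of [phi ^+ 2] times the
   increment of [w] plus the mean [W] of [w] times the increment of [phi ^+ 2]. *)
set W := (w x + w y) / 2.
have Wt : 0 <= t ^+ 2 - W ^+ 2.
  by rewrite subr_sqr mulr_ge0 // /W; lra.
have : 0 <= (phi x - phi y) ^+ 2 * (t ^+ 2 - W ^+ 2) by rewrite mulr_ge0 ?sqr_ge0.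
have := sqr_ge0 ((phi x + phi y) / 2 * (w y - w x) + 2 * W * (phi y - phi x)).
have := sqr_ge0 ((phi x - phi y) * (w y - w x)).
rewrite /W; nra.
Qed.

End Network.

(** Zero capacity of finite sets, the energy criterion for recurrence; the bound for every finite
    [A] stands for the energy on the whole graph. *)
Definition null_cutoffs (R : realType) (G : graph) : Prop :=
  forall (F : seq G) (eps : R), 0 < eps -> exists phi : G -> R,
    [/\ forall x, 0 <= phi x <= 1, forall x, x \in F -> phi x = 1,
        finite_set [set x | phi x != 0] & forall A, dirichlet A phi <= eps].

Lemma young (R : realFieldType) (s d p eta : R) : 0 < eta ->
  s * d * p <= eta / 4 * (s ^+ 2 * d ^+ 2) + eta^-1 * p ^+ 2.
Proof.
move=> eta0; have : 0 <= eta^-1 * (eta * s / 2 * d - p) ^+ 2.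
  by rewrite mulr_ge0 ?sqr_ge0 // invr_ge0 ltW.
have -> : eta^-1 * (eta * s / 2 * d - p) ^+ 2 =
    eta / 4 * (s ^+ 2 * d ^+ 2) - s * d * p + eta^-1 * p ^+ 2.
  by field; rewrite gt_eqF.
lra.
Qed.

(** * Liouville property and Lipschitz bound for potentials *)

Section Recurrence.
Context {R : realType} {G : graph}.
Hypothesis cutoffs : null_cutoffs R G.

(** The Caccioppoli inequality with [c = 0] bounds the energy of [w] at one edge by a multiple of
    the cutoff energy. The sign condition, weaker than harmonicity, admits functions that are
    harmonic except at a zero. *)
Lemma liouville (w : G -> R) (t : R) :
  (forall x, `|w x| <= t) -> (forall x, 0 <= w x * laplacian w x) ->
  forall x y, adj x y -> w x = w y.
Proof.
move=> wt wlap x y xy; apply/eqP; rewrite -subr_eq0 -sqrf_eq0; apply/eqP.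
apply/eqP; rewrite eq_le sqr_ge0 andbT; apply/ler_addgt0Pr => e e0.
have t0 : 0 <= t by exact: le_trans (wt x).
pose c := e / (4 * t ^+ 2 + 1).
have t2 : 0 < 4 * t ^+ 2 + 1 by rewrite ltr_wpDl // mulr_ge0 // sqr_ge0.
have c0 : 0 < c by rewrite divr_gt0.
have [phi [phi01 phi1 fin E]] := cutoffs [:: x; y] c0.
have [A [supp sub]] := supported_ex [:: x; y] fin.
have H2 := @caccioppoli R G A phi w t 0 supp wt; feed H2.
  rewrite oppr0; apply: sumr_ge0 => z _.
  by rewrite -mulrA mulr_ge0 // sqr_ge0.
have H1 : (phi x ^+ 2 + phi y ^+ 2) * (w y - w x) ^+ 2 <= pair_sum A
    (fun x y => (phi x ^+ 2 + phi y ^+ 2) * (w y - w x) ^+ 2).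
  apply: (@pair_sum_ge R G A
    (fun x y => (phi x ^+ 2 + phi y ^+ 2) * (w y - w x) ^+ 2)) => //.
  - by move=> a b; rewrite mulr_ge0 ?addr_ge0 // sqr_ge0.
  - by apply: sub; rewrite !inE eqxx.
  - by apply: sub; rewrite !inE eqxx orbT.
move: H1; rewrite !phi1 ?inE ?eqxx ?orbT // => H1; rewrite add0r.
have H3 : 8 * t ^+ 2 * dirichlet A phi <= 8 * t ^+ 2 * c.
  by rewrite ler_wpM2l // mulr_ge0 // sqr_ge0.
have H4 : (4 * t ^+ 2 + 1) * c = e by rewrite /c mulrC divfK // gt_eqF.
have : 0 <= t ^+ 2 by exact: sqr_ge0.
have -> : (w x - w y) ^+ 2 = (w y - w x) ^+ 2 by ring.
rewrite expr1n in H1; lra.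
Qed.

(* The function [u := min h (h y)] is superharmonic off [o]; by recurrence its
   loss at [y] is at most the flux that it sends into [o], which is at most 1. *)
Lemma potential_lipschitz (o : G) (h : G -> R) : potential o h ->
  forall x y, adj x y -> h y - h x <= 1.
Proof.
move=> [h0 ho lap_o lap0] x y xy.
have [yx|//] : 1 < h y - h x \/ h y - h x <= 1.
  by case: leP; [right|left].
have yo : y != o.
  by apply: contraTneq yx => ->; rewrite ho -leNgt sub0r (le_trans _ ler01) // oppr_le0.
set t := h y; pose u z := Num.min (h z) t.
have t0 : 0 < t by have := h0 x; rewrite /t; lra.
have uh z : u z <= h z by rewrite /u ge_min lexx.
have ut z : u z <= t by rewrite /u ge_min lexx orbT.
have u0 z : 0 <= u z by rewrite /u le_min h0 /= ltW.
have lap_u z : z != o -> laplacian u z <= 0.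
  move=> zo; have [zt|tz] := ltP (h z) t.
    rewrite -(lap0 z zo) !laplacianE; apply: ler_sum => a _.
    by have := uh a; rewrite {3}/u minElt zt; lra.
  rewrite laplacianE; apply: sumr_le0 => a _.
  by rewrite {2}/u minEge tz subr_le0.
have lap_uo : laplacian u o <= 1.
  rewrite -lap_o !laplacianE; apply: ler_sum => a _.
  have := uh a; have := u0 o; have := uh o; rewrite ho; lra.
have lap_uy : laplacian u y <= h x - h y.
  rewrite laplacianE (big_fsetD1 x) /=; last by rewrite mem_nbrs adj_sym.
  have -> : u y = t by rewrite /u minxx.
  have xh : u x = h x by rewrite /u minElt; case: ltP => //; rewrite /t; lra.
  rewrite xh -[leRHS]addr0 lerD //; apply: sumr_le0 => a _.
  by rewrite subr_le0.
apply/ler_addgt0Pr => e e0.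
have [eta eta0 h4] : exists2 eta, 0 < eta & eta * (8 * t + 8) = e.
  have t8 : 0 < 8 * t + 8 by lra.
  by exists (e / (8 * t + 8)); [rewrite divr_gt0|rewrite divfK // gt_eqF].
(* [c <= t^-1] keeps [t ^+ 2] times the cutoff energy below [t]; [c <= e * eta / 4] absorbs the
   remainder in Young's inequality. *)
have [c [c0 ct ce]] : exists c, [/\ 0 < c, c <= t^-1 & c <= e * eta / 4].
  exists (Num.min (e * eta / 4) (t^-1)).
  rewrite lt_min invr_gt0 t0 andbT !ge_min !lexx orbT; split => //.
  by rewrite divr_gt0 // mulr_gt0.
have [phi [phi01 phi1 fin E]] := cutoffs [:: x; y; o] c0.
have [A [supp sub]] := supported_ex [:: x; y; o] fin.
have lap_w z : laplacian (fun a => t - u a) z = - laplacian u z.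
  by rewrite !laplacianE -sumrN; apply: eq_bigr => a _; ring.
have oA : o \in A by apply: sub; rewrite !inE eqxx !orbT.
have yA : y \in A by apply: sub; rewrite !inE eqxx !orbT.
have [py po] : phi y = 1 /\ phi o = 1 by split; apply: phi1; rewrite !inE eqxx !orbT.
have D0 : 0 <= dirichlet A phi.
  by apply: sumr_ge0 => a _; apply: sumr_ge0 => b _; exact: sqr_ge0.
have Dc := E A.
have uo : u o = 0 by rewrite /u ho minElt t0.
(* [t - u] is non-negative and subharmonic off [o]; at [o] its value is [t] and its Laplacian at
   least -1, so the defect is at most [t]. *)
have HL := @caccioppoli R G A phi (fun a => t - u a) t t supp.
feed HL; [|feed HL].
- by move=> a; rewrite ger0_norm ?subr_ge0 //; have := u0 a; lra.
- rewrite (big_fsetD1 o) //= lap_w po uo.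
  apply: (@le_trans _ _ (- t + 0)); first by rewrite addr0.
  apply: lerD; first by nra.
  rewrite big_seq; apply: sumr_ge0 => a; rewrite !inE => /andP[ao _].
  rewrite lap_w mulr_ge0 //; last by rewrite oppr_ge0 lap_u.
  by rewrite mulr_ge0 ?sqr_ge0 // subr_ge0.
move: HL; set L := pair_sum A _ => HL.
(* Tested with [phi ^+ 2], the Laplacian of [u] contributes at most 1 at [o], at most [h x - h y] at
   [y] and nothing positive elsewhere; the energy side [S] will be at most a small multiple of
   [e]. *)
have := @green R G A (fun z => phi z ^+ 2) u.
move=> H; feed H; last move: H.
  by move=> z; rewrite sqrf_eq0; exact: supp.
set S := pair_sum A _.
rewrite (big_fsetD1 o) //= po (big_fsetD1 y) /=; last by rewrite !inE yo.
rewrite py expr1n !mul1r.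
set Z := \sum_(i <- _) _ => ZE.
have Z0 : Z <= 0.
  rewrite /Z big_seq; apply: sumr_le0 => a; rewrite !inE => /and3P[_ ao _].
  by rewrite mulr_ge0_le0 ?sqr_ge0 // lap_u.
have SL : S <= eta / 2 * L + eta^-1 * dirichlet A phi.
  rewrite -!pair_sumZ -pair_sumD; apply: ler_pair_sum => a b _.
  have -> : (t - u b - (t - u a)) ^+ 2 = (u b - u a) ^+ 2 by ring.
  set d := u b - u a; set p := phi b - phi a.
  have := young (phi b + phi a) d p eta0.
  have : 0 <= eta * ((phi b - phi a) ^+ 2 * d ^+ 2).
    by apply: mulr_ge0; [exact: ltW|rewrite mulr_ge0 ?sqr_ge0].
  by rewrite /p; lra.
have tD : t ^+ 2 * dirichlet A phi <= t.
  have h1 : t * dirichlet A phi <= 1.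
    by rewrite mulrC -ler_pdivlMr // mul1r (le_trans Dc).
  by rewrite expr2 -mulrA -[leRHS]mulr1 ler_wpM2l // ltW.
have HL' : L <= 16 * t by move: HL; lra.
have h2 : eta * L <= eta * (16 * t) by rewrite ler_wpM2l // ltW.
have h3 : eta^-1 * dirichlet A phi <= e / 4.
  rewrite mulrC ler_pdivrMr //; lra.
have h5 : eta * (16 * t) <= 2 * e by rewrite -h4; nra.
have SE : - 2^-1 * S <= 1 + (h x - h y) by rewrite -ZE; lra.
rewrite /t; lra.
Qed.

End Recurrence.

(** * Markov chains confined to a set of states *)

Lemma cvg_sum_seq (R : realType) (I T : Type) (F : set_system T) (r : seq I)
    (P : pred I) (f : I -> T -> R) (l : I -> R) : Filter F ->
  (forall i, P i -> f i @ F --> l i) ->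
  \sum_(i <- r | P i) f i x @[x --> F] --> \sum_(i <- r | P i) l i.
Proof.
move=> FF fl; elim: r => [|i r IH].
  by under eq_cvg do rewrite big_nil; rewrite big_nil; exact: cvg_cst.
under eq_cvg do rewrite big_cons; rewrite big_cons.
by case: ifP => [/fl fi|//]; exact: cvgD.
Qed.

Section Confined.
Context {R : realType} {S : eqType}.
Variables (p : S -> S -> R) (succ : S -> seq S) (A : pred S).
Hypothesis p_ge0 : forall s t, 0 <= p s t.
Hypothesis succ_sum : forall s, \sum_(t <- succ s) p s t = 1.

(** The starting state is not tested, so that [A] may exclude it, as it does for first returns. *)
Fixpoint stay n s : R :=
  if n is n'.+1 then \sum_(t <- succ s | A t) p s t * stay n' t else 1.

Lemma stay_ge0 n s : 0 <= stay n s.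
Proof.
by elim: n s => //= n IH s; apply: sumr_ge0 => t _; exact: mulr_ge0.
Qed.

Lemma stay_decr n s : stay n.+1 s <= stay n s.
Proof.
elim: n s => [|n IH] s.
  rewrite /= -[leRHS](succ_sum s) big_mkcond; apply: ler_sum => t _.
  by case: ifP => // _; rewrite mulr1.
rewrite [leLHS]/= [leRHS]/=; apply: ler_sum => t _.
by apply: ler_wpM2l => //; exact: IH.
Qed.

(** [stay n s] decreases in [n], and its limit commutes with the finite sum over successors. *)
Lemma stay_limit : exists K : S -> R,
  [/\ forall s, 0 <= K s <= 1,
      forall s, K s = \sum_(t <- succ s | A t) p s t * K t &
      forall s (e : R), 0 < e -> exists n, stay n s <= K s + e].
Proof.
have noninc s : nonincreasing_seq (stay^~ s).
  by apply/nonincreasing_seqP => n; exact: stay_decr.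
have lb s : has_lbound (range (stay^~ s)).
  by exists 0 => _ [n _ <-]; exact: stay_ge0.
have cv s : stay ^~ s @ \oo --> inf (range (stay^~ s)).
  exact: nonincreasing_cvgn.
exists (fun s => inf (range (stay^~ s))); split.
- move=> s; apply/andP; split.
    apply: lb_le_inf; first by exists (stay 0 s); exists 0%N.
    by move=> _ [n _ <-]; exact: stay_ge0.
  by apply: ge_inf => //; exists 0%N.
- move=> s.
  have c1 : (stay n.+1 s @[n --> \oo] --> inf (range (stay^~ s))).
    by rewrite (cvg_shiftS (stay^~ s)); exact: cv.
  have c2 : (stay n.+1 s @[n --> \oo] -->
      \sum_(t <- succ s | A t) p s t * inf (range (stay^~ t))).
    apply: cvg_sum_seq => t _; apply: cvgM; [exact: cvg_cst|exact: cv].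
  exact: cvg_unique c1 c2.
- move=> s e e0.
  have [|_ [n _ <-] /ltW ?] := @inf_adherent R (range (stay^~ s)) e e0.
    by split; [exists (stay 0 s); exists 0%N|exact: lb].
  by exists n.
Qed.

Context {d : measure_display} {Omega : measurableType d}.
Variables (P : probability Omega R) (mu0 : S -> R) (X : nat -> Omega -> S).
Hypothesis chain : markov_chain P mu0 p X.
Hypothesis succ_uniq : forall s, uniq (succ s).

Let Pr (E : set Omega) : R := fine (P E).

Lemma path_event_measurable (D : nat -> set S) :
  measurable [set w | forall i, D i (X i w)].
Proof.
have -> : [set w | forall i, D i (X i w)] = \bigcap_i (X i @^-1` D i).
  by apply/seteqP; split => w /= H i; [move=> _; exact: H|exact: H].
by apply: bigcapT_measurable => i; exact: chain.1.
Qed.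

Lemma prE E : measurable E -> P E = (Pr E)%:E.
Proof. by move=> mE; rewrite /Pr fineK // fin_num_measure. Qed.

Lemma pr_split E F : measurable E -> measurable F ->
  Pr E = Pr (E `&` F) + Pr (E `&` ~` F).
Proof.
move=> mE mF; have mI := measurableI _ _ mE mF.
have mC := measurableI _ _ mE (measurableC mF).
apply: EFin_inj; rewrite EFinD -!prE // -measureU //.
  by congr (P _); rewrite -setIUr setUv setIT.
by rewrite setIACA setICr setI0.
Qed.

Lemma pr_states E m (l : seq S) : measurable E -> uniq l ->
  Pr (E `&` [set w | X m w \in l]) =
  \sum_(t <- l) Pr (E `&` [set w | X m w = t]).
Proof.
move=> mE; elim: l => [|t l IH] /=.
  move=> _; rewrite big_nil.
  have -> : [set w | X m w \in [::]] = set0 by apply/seteqP; split.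
  by rewrite setI0 /Pr measure0.
move=> /andP[tl ul]; rewrite big_cons -IH //.
have mt : measurable [set w | X m w = t] by exact: (chain.1 m [set t]).
have ml : measurable [set w | X m w \in t :: l].
  exact: (chain.1 m [set s | s \in t :: l]).
rewrite (pr_split (measurableI _ _ mE ml) mt); congr (Pr _ + Pr _).
  rewrite -setIA; congr (_ `&` _); apply/seteqP; split => w /=; first by case.
  by move=> ->; rewrite inE eqxx.
rewrite -setIA; congr (_ `&` _); apply/seteqP; split => w /=.
  by rewrite inE => -[/orP[/eqP//|]].
move=> wl; rewrite inE wl orbT; split=> // wt.
by rewrite wt (negbTE tl) in wl.
Qed.

(** The split into prescribed and constrained times serves the induction on [n]: fixing the next
    state turns one constrained time into a prescribed one. *)
Definition confined m (s : nat -> S) n : set Omega :=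
  [set w | forall i, ((i <= m)%N -> X i w = s i) /\
                     ((m < i <= m + n)%N -> A (X i w))].

Lemma confined_measurable m s n : measurable (confined m s n).
Proof.
exact: (path_event_measurable (fun i => [set x |
  ((i <= m)%N -> x = s i) /\ ((m < i <= m + n)%N -> A x)])).
Qed.

Lemma pr_prefix m s :
  Pr (confined m s 0) = mu0 (s 0%N) * \prod_(i < m) p (s i) (s i.+1).
Proof.
rewrite -[RHS]/(fine (_)%:E) -(chain.2 m s); congr (fine (P _)).
apply/seteqP; split => w /= H i; first by case: (H i).
by split; [exact: H|rewrite addn0; case: ltngtP].
Qed.

Definition extend (s : nat -> S) m t := fun i => if i == m then t else s i.

Lemma confined_next m s n t :
  confined m s n.+1 `&` [set w | X m.+1 w = t] =
  if A t then confined m.+1 (extend s m.+1 t) n else set0.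
Proof.
rewrite /extend; case: ifP => At; apply/seteqP; split => w /=.
- move=> [H wt] i; split.
    rewrite leq_eqVlt => /orP[/eqP ->|im]; first by rewrite eqxx.
    by rewrite ltn_eqF //; apply: (H i).1.
  by move=> /andP[mi im]; apply: (H i).2; rewrite (ltnW mi) addnS -addSn.
- move=> H; have wt : X m.+1 w = t by rewrite (H m.+1).1 // eqxx.
  split => // i; split => [im|/andP[]].
    by rewrite (H i).1 ?(leqW im) // ltn_eqF.
  rewrite leq_eqVlt => /orP[/eqP <-|mi im]; first by rewrite wt.
  by apply: (H i).2; rewrite mi addSn -addnS.
- move=> [H wt]; have := (H m.+1).2; rewrite ltnSn addnS ltnS leq_addr wt At.
  by move=> /(_ isT).
- by [].
Qed.

Lemma pr_prefix_extend m s t : Pr (confined m.+1 (extend s m.+1 t) 0) =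
  Pr (confined m s 0) * p (s m) t.
Proof.
rewrite !pr_prefix big_ord_recr /= -mulrA /extend eqxx (ltn_eqF (ltnSn m)).
congr (_ * (_ * _)); apply: eq_bigr => i _.
by rewrite eqSS (ltn_eqF (ltn_ord i)) (ltn_eqF (leqW (ltn_ord i))).
Qed.

Lemma confined_sub m s n : confined m s n `<=` confined m s 0.
Proof.
by move=> w H i; split; [exact: (H i).1|rewrite addn0; case: ltngtP].
Qed.

Lemma pr_null E F : measurable E -> measurable F -> E `<=` F ->
  Pr F = 0 -> Pr E = 0.
Proof.
move=> mE mF EF F0; apply/eqP; rewrite eq_le fine_ge0 ?measure_ge0 // andbT.
by rewrite -F0 -lee_fin -!prE // le_measure // inE.
Qed.

Lemma pr_confined n m s :
  Pr (confined m s n) = Pr (confined m s 0) * stay n (s m).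
Proof.
elim: n m s => [|n IH] m s; first by rewrite mulr1.
have mC := confined_measurable m s.
pose V := [set w | X m.+1 w \in succ (s m)].
have mV : measurable V by exact: (chain.1 m.+1 [set x | x \in succ (s m)]).
(* The law is known on cylinders only: those through the listed successors already exhaust the
   probability of the prefix, hence any other next state has probability 0. *)
have null : Pr (confined m s 0 `&` ~` V) = 0.
  have := pr_split (mC 0%N) mV; rewrite pr_states //.
  rewrite (_ : \sum_(t <- _) _ = Pr (confined m s 0)); first by lra.
  under eq_bigr => t _.
    rewrite (_ : confined m s 0 `&` _ = confined m.+1 (extend s m.+1 t) 0).
      rewrite pr_prefix_extend; over.
    rewrite /extend; apply/seteqP; split => w /=.
      move=> [H wt] i; split; last by rewrite addn0; case: ltngtP.
      rewrite leq_eqVlt => /orP[/eqP ->|im]; first by rewrite eqxx.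
      by rewrite ltn_eqF //; apply: (H i).1.
    move=> H; split; last by rewrite (H m.+1).1 // eqxx.
    move=> i; split; last by rewrite addn0; case: ltngtP.
    by move=> im; rewrite (H i).1 ?(leqW im) // ltn_eqF.
  by rewrite -mulr_sumr succ_sum mulr1.
rewrite (pr_split (mC n.+1) mV).
rewrite [X in _ + X](pr_null _ _ _ null) ?addr0; last first.
- by apply: setSI; exact: confined_sub.
- by apply: measurableI => //; exact: measurableC.
- by apply: measurableI => //; exact: measurableC.
rewrite pr_states // [RHS]/= mulr_sumr big_mkcond /=.
rewrite [RHS]big_mkcond; apply: eq_bigr => t _.
rewrite confined_next; case: ifP => _; last by rewrite /Pr measure0.
by rewrite IH pr_prefix_extend /extend eqxx mulrA.
Qed.

Lemma pr_start s n : Pr (confined 0 (fun=> s) n) = mu0 s * stay n s.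
Proof. by rewrite pr_confined pr_prefix big_ord0 mulr1. Qed.

Lemma forever_measurable s :
  measurable [set w | X 0 w = s /\ forall i, (0 < i)%N -> A (X i w)].
Proof.
have -> : [set w | X 0 w = s /\ forall i, (0 < i)%N -> A (X i w)] =
    (X 0 @^-1` [set s]) `&`
    \bigcap_(i in [set i | (0 < i)%N]) (X i @^-1` [set t | A t]).
  by [].
apply: measurableI; first exact: chain.1.
by apply: bigcap_measurable => [|i _]; [exists 1%N|exact: chain.1].
Qed.

Lemma pr_confined_forever s (k : R) : 0 <= mu0 s ->
  (forall e : R, 0 < e -> exists n, stay n s <= k + e) ->
  Pr [set w | X 0 w = s /\ forall i, (0 < i)%N -> A (X i w)] <= mu0 s * k.
Proof.
move=> m0 lim; apply/ler_addgt0Pr => e e0.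
have m1 : 0 < mu0 s + 1 by rewrite ltr_wpDl.
(* The added 1 covers the case [mu0 s = 0]. *)
have [n sn] := lim (e / (mu0 s + 1)) (divr_gt0 e0 m1).
have mE := forever_measurable s.
apply: (@le_trans _ _ (mu0 s * (k + e / (mu0 s + 1)))).
  apply: le_trans (ler_wpM2l m0 sn); rewrite -pr_start -lee_fin -!prE //.
    apply: le_measure; rewrite ?inE //; first exact: confined_measurable.
    move=> w [w0 wA] i; split; first by rewrite leqn0 => /eqP ->.
    by move=> /andP[i0 _]; exact: wA.
  exact: confined_measurable.
rewrite mulrDr lerD2l mulrA ler_pdivrMr // mulrC ler_wpM2l ?(ltW e0) //.
by rewrite lerDl.
Qed.

End Confined.

(** * Recurrence of the simple random walk *)

Section WalkRecurrence.
Context {R : realType} {G : graph}.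
Implicit Types (x y : G).

Lemma degreeE x : degree x = size (nbrs x).
Proof. by []. Qed.

Lemma sum_nbrs_const x (c : R) : \sum_(y <- nbrs x) c = (degree x)%:R * c.
Proof. by rewrite big_const_seq count_predT iter_addr_0 degreeE mulr_natl. Qed.

Lemma laplacianD (f : G -> R) x :
  laplacian f x = \sum_(y <- nbrs x) f y - (degree x)%:R * f x.
Proof. by rewrite laplacianE sumrB sum_nbrs_const. Qed.

Lemma degree_gt0 x : (0 < degree x)%N.
Proof.
have [y yx] : exists y : G, y != x.
  apply: contrapT => H; apply: (@vertex_infinite G).
  apply: (sub_finite_set _ (finite_set1 x)) => y _ /=.
  by apply: contrapT => /eqP yx; apply: H; exists y.
have [[|z p] /= pp ly] := adj_connected x y; first by rewrite ly eqxx in yx.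
case/andP: pp => xz _; rewrite lt0n cardfs_eq0; apply/eqP => E.
by have := mem_nbrs x z; rewrite xz /nbrs E inE.
Qed.

Lemma degree_neq0 x : (degree x)%:R != 0 :> R.
Proof. by rewrite pnatr_eq0 -lt0n degree_gt0. Qed.

Lemma srw_ge0 x y : 0 <= srw x y :> R.
Proof. by rewrite /srw; case: ifP => // _; rewrite invr_ge0. Qed.

Lemma sum_srw x (f : G -> R) :
  \sum_(y <- nbrs x) srw x y * f y = (degree x)%:R^-1 * \sum_(y <- nbrs x) f y.
Proof.
rewrite mulr_sumr !big_seq; apply: eq_bigr => y.
by rewrite mem_nbrs /srw => ->.
Qed.

Lemma sum_srw1 x : \sum_(y <- nbrs x) srw x y = 1 :> R.
Proof.
under eq_bigr do rewrite -[srw _ _]mulr1.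
by rewrite sum_srw sum_nbrs_const mulr1 mulVf // degree_neq0.
Qed.

(** The probability [K] of never returning to [x], reset to 0 at [x], is harmonic elsewhere; by the
    Liouville property it equals 0 at the neighbours of [x], and [K x] is the mean of these
    values. *)
Theorem cutoffs_recurrent : null_cutoffs R G -> recurrent R G.
Proof.
move=> cut d Omega P x X chain.
have [K [K01 KE Klim]] := @stay_limit R G srw nbrs (predC1 x) srw_ge0 sum_srw1.
pose w y := if y == x then 0 else K y.
have w0 y : 0 <= w y by rewrite /w; case: eqP => // _; case/andP: (K01 y).
have KS y : K y = (degree y)%:R^-1 * \sum_(z <- nbrs y) w z.
  rewrite KE big_mkcond -sum_srw; apply: eq_bigr => z _ /=.
  by rewrite /w; case: eqP; rewrite ?mulr0.
have lap y : 0 <= w y * laplacian w y.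
  rewrite laplacianD; have [->|yx] := eqVneq y x.
    by rewrite {1}/w eqxx mul0r.
  rewrite (_ : (degree y)%:R * w y = \sum_(z <- nbrs y) w z) ?subrr ?mulr0 //.
  have -> : w y = K y by rewrite /w (negbTE yx).
  by rewrite KS mulrA mulfV ?degree_neq0 // mul1r.
have wc := liouville cut (t := 1) (w := w).
have {}wc y z : adj y z -> w y = w z.
  apply: wc lap _ _ => a; rewrite ger0_norm // /w.
  by case: eqP => // _; case/andP: (K01 a).
have Kx : K x = 0.
  rewrite KS big_seq big1 ?mulr0 // => y; rewrite mem_nbrs => /wc <-.
  by rewrite /w eqxx.
pose E := [set w | X 0 w = x /\ forall i, (0 < i)%N -> predC1 x (X i w)].
have mX := chain.1.
have mE : measurable E := forever_measurable (predC1 x) chain x.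
have E0 : P E = 0%E.
  rewrite -[LHS]fineK ?fin_num_measure //; congr (_%:E).
  apply/eqP; rewrite eq_le fine_ge0 ?measure_ge0 // andbT.
  have := @pr_confined_forever R G srw nbrs (predC1 x) sum_srw1 _ _ P _ X chain
    (fun y => fset_uniq (nbrs y)) x (K x).
  by rewrite eqxx Kx mulr0; apply => // e e0; rewrite -Kx; exact: Klim.
have X0 : P (~` (X 0 @^-1` [set x])) = 0%E.
  rewrite probability_setC //.
  have -> : P (X 0 @^-1` [set x]) = 1%E.
    have := chain.2 0%N (fun=> x); rewrite big_ord0 eqxx mulr1 => <-.
    congr (P _); apply/seteqP; split => u /= H; last exact: (H 0%N).
    by move=> i; rewrite leqn0 => /eqP ->.
  by rewrite subee.
exists (E `|` ~` (X 0 @^-1` [set x])); split.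
- by apply: measurableU => //; exact: measurableC.
- apply: null_set_setU => //; exact: measurableC.
- move=> u /= H; apply: contrapT => /not_orP[H1 H2]; apply: H1; split.
    by apply: contrapT.
  move=> i i0 /=; apply/eqP => ui; apply: H.
  by exists i.
Qed.

End WalkRecurrence.

(** * Processes conditioned to avoid the root *)

Section Avoidance.
Context {R : realType} {G : graph}.
Variables (o : G) (h : G -> R).
Hypothesis pot : potential o h.

Let succ (s : h_state h) : seq (h_state h) := pmap insub (nbrs (val s)).

Lemma sum_pmap_insub (l : seq G) (P : pred G) (F : G -> R) :
  \sum_(t <- pmap insub l : seq (h_state h) | P (val t)) F (val t) =
  \sum_(y <- l | P y && (0 < h y)) F y.
Proof.
rewrite -(big_map val P) (pmap_filter (@insubK _ _ _)) big_filter_cond.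
by apply: eq_bigl => y; rewrite andbC isSome_insub.
Qed.

Lemma h_state_neq_root (s : h_state h) : val s != o.
Proof.
by case: pot => _ ho _ _; apply: contraTneq (valP s) => ->; rewrite ho ltxx.
Qed.

Lemma potential_sum (x : G) : x != o ->
  \sum_(y <- nbrs x) h y = (degree x)%:R * h x.
Proof.
by case: pot => _ _ _ /(_ x) lap /lap/eqP; rewrite laplacianD subr_eq0 => /eqP.
Qed.

Lemma potential_sum_root : \sum_(y <- nbrs o) h y = 1.
Proof. by case: pot => _ ho <- _; rewrite laplacianD ho mulr0 subr0. Qed.

Lemma sum_gt0 (l : seq G) (P : pred G) (F : G -> R) :
  (forall y, h y = 0 -> F y = 0) ->
  \sum_(y <- l | P y && (0 < h y)) F y = \sum_(y <- l | P y) F y.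
Proof.
case: pot => h0 _ _ _ F0; rewrite big_mkcondr; apply: eq_bigr => y _.
by rewrite lt_neqAle h0 andbT eq_sym; case: eqP => //= /F0.
Qed.

Lemma h_transition_sum (s : h_state h) :
  \sum_(t <- succ s) h_transition s t = 1.
Proof.
rewrite (@sum_pmap_insub _ xpredT (fun y => srw (val s) y * h y / h (val s))).
rewrite sum_gt0 => [|y ->]; last by rewrite mulr0 mul0r.
rewrite -mulr_suml sum_srw potential_sum ?h_state_neq_root //.
by rewrite mulKf ?degree_neq0 // mulfV // gt_eqF // (valP s).
Qed.

Lemma h_transition_ge0 (s t : h_state h) : 0 <= h_transition s t.
Proof.
case: pot => h0 _ _ _.
by rewrite /h_transition divr_ge0 ?mulr_ge0 ?srw_ge0.
Qed.

Lemma succ_uniq (l : {fset G}) : uniq (pmap insub l : seq (h_state h)).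
Proof. exact: pmap_sub_uniq (fset_uniq l). Qed.

(** Undoing the Doob transform: [w] is [h] times the probability that the process started there
    avoids [r], hence harmonic off [o] and [r]. Since [w o = 0] and the initial law is [h] on the
    neighbours of [o], averaging over it gives the Laplacian of [w] at [o]. *)
Lemma h_process_avoid (r : G) : exists w : G -> R,
  [/\ forall x, 0 <= w x <= h x, w r = 0,
      forall x, x != o -> x != r -> laplacian w x = 0 &
      forall (d : measure_display) (Omega : measurableType d)
        (P : probability Omega R) (X : nat -> Omega -> h_state h),
        h_process o P X ->
        (P [set a | forall i, val (X i a) != r] <= (laplacian w o)%:E)%E].
Proof.
pose A (s : h_state h) := val s != r.
have [K [K01 KE Klim]] :=
  @stay_limit R (h_state h) (@h_transition R G h) succ A
   h_transition_ge0 h_transition_sum.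
pose w y := if (y != r) then
  (if insub y is Some s then h y * K s else 0) else 0.
have wE (s : h_state h) : w (val s) = if A s then h (val s) * K s else 0.
  by rewrite /w /A valK.
have [h0 ho _ _] := pot.
have w0 y : h y = 0 -> w y = 0.
  by rewrite /w => ->; case: ifP => // _; case: insubP => // *; rewrite mul0r.
have w_le x : 0 <= w x <= h x.
  rewrite /w; case: ifP => _; last by rewrite lexx h0.
  case: insubP => [s _ _|_]; last by rewrite lexx h0.
  have /andP[k0 k1] := K01 s; rewrite mulr_ge0 //=.
  by rewrite -[leRHS]mulr1 ler_wpM2l.
have sum_w (l : seq G) : \sum_(s <- pmap insub l | A s) h (val s) * K s =
    \sum_(y <- l) w y.
  rewrite -[RHS](@sum_gt0 l xpredT) // -(@sum_pmap_insub _ xpredT) /=.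
  by rewrite big_mkcond; apply: eq_bigr => s _; rewrite wE.
exists w; split => //; first by rewrite /w eqxx.
- move=> x xo xr; rewrite laplacianD; apply/eqP; rewrite subr_eq0; apply/eqP.
  (* Outside the state space, harmonicity and [0 <= h] make [h] vanish at all neighbours, so [w]
     vanishes there too. *)
  have [hx|hx] := eqVneq (h x) 0.
    rewrite (w0 x hx) mulr0; apply: big1_seq => y /andP[_ xy]; apply: w0.
    have := potential_sum xo; rewrite hx mulr0 => /eqP.
    rewrite psumr_eq0; last by move=> *; exact: h0.
    by move=> /allP/(_ y xy)/eqP.
  have hx0 : 0 < h x by rewrite lt_neqAle h0 eq_sym hx.
  pose s : h_state h := exist _ x hx0.
  rewrite -[x]/(val s) wE /A /= xr KE -sum_w mulr_sumr mulr_sumr.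
  rewrite big_seq_cond [RHS]big_seq_cond; apply: eq_bigr => t /andP[ts _].
  have /= xt : adj x (val t) by rewrite -mem_nbrs; move: ts; rewrite mem_pmap_sub.
  rewrite /h_transition /srw /= xt; field.
  by rewrite hx degree_neq0.
move=> d Omega P X chain.
pose init : seq (h_state h) := pmap insub (nbrs o).
pose E := [set a | forall i, A (X i a)].
have mE : measurable E by exact: (path_event_measurable chain (fun=> A)).
have init0 (s : h_state h) : 0 <= h_init o s by rewrite /h_init; case: ifP.
have pX0 s : fine (P [set a | X 0 a = s]) = h_init o s.
  rewrite (_ : [set a | _] = [set a | forall i, (i <= 0)%N -> X i a = s]).
    by rewrite (chain.2 0%N (fun=> s)) big_ord0 mulr1.
  apply/seteqP; split => u /= H; last exact: (H 0%N).
  by move=> i; rewrite leqn0 => /eqP ->.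
have mI : measurable [set a | X 0 a \in init].
  exact: (chain.1 0%N [set s | s \in init]).
(* The initial masses on the neighbours of [o] sum to [laplacian h o = 1]. *)
have PI : fine (P [set a | X 0 a \in init]) = 1.
  have := pr_states chain 0 measurableT (succ_uniq (nbrs o)).
  rewrite setTI => ->; under eq_bigr do rewrite setTI pX0.
  rewrite big_seq (eq_bigr (fun s : h_state h => h (val s))).
    rewrite -big_seq (@sum_pmap_insub _ xpredT).
    by rewrite (@sum_gt0 _ xpredT) // potential_sum_root.
  by move=> s; rewrite mem_pmap_sub mem_nbrs /h_init => ->.
have PN : fine (P (~` [set a | X 0 a \in init])) = 0.
  by rewrite probability_setC // fineB ?fin_num_measure // PI subrr.
rewrite -[X in (X <= _)%E]fineK ?fin_num_measure // lee_fin -/E.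
rewrite (pr_split P mE mI) [X in _ + X](pr_null _ _ _ PN) ?addr0; last first.
- by move=> u [].
- exact: measurableC.
- by apply: measurableI => //; exact: measurableC.
rewrite (pr_states chain 0 mE (succ_uniq _)).
rewrite laplacianD (w0 o ho) mulr0 subr0 -sum_w big_mkcond [leRHS]big_mkcond.
rewrite big_seq [leRHS]big_seq; apply: ler_sum => s; rewrite mem_pmap_sub => so.
case: ifP => As; last first.
  rewrite (_ : _ `&` _ = set0) ?measure0 //; apply/seteqP; split => u //= [].
  by move=> /(_ 0%N) /[swap] ->; rewrite As.
have -> : h (val s) = h_init o s by rewrite /h_init -mem_nbrs so.
have := pr_confined_forever h_transition_sum chain (fun t => succ_uniq _)
  (init0 s) (fun e => Klim s e).
apply: le_trans.
have mF := forever_measurable A chain s.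
have mG : measurable (E `&` [set a | X 0 a = s]).
  by apply: measurableI => //; exact: (chain.1 0%N [set s]).
rewrite -lee_fin !fineK ?fin_num_measure //; apply: le_measure; rewrite ?inE //.
by move=> u [uE u0]; split.
Qed.

End Avoidance.

(** * Existence of a potential *)

Lemma ultra_fmap (T U : Type) (f : T -> U) (F : set_system T) :
  UltraFilter F -> UltraFilter (f @ F).
Proof.
move=> UF; split; first exact: fmap_proper_filter.
move=> H HF sub; apply/seteqP; split=> // A HA.
have [//|FC] := in_ultra_setVsetC (f @^-1` A) UF.
have : H (A `&` ~` A) by apply: filterI => //; exact: sub.
by rewrite setICr => /filter_not_empty.
Qed.

Section Existence.
Context {R : realType} {G : graph}.
Variable o : G.

(* Probability of leaving [B] before hitting [o], as the limit over the number
   of steps allowed. *)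
Fixpoint leave_in (B : {fset G}) n (x : G) : R :=
  if x \notin B then 1 else if x == o then 0 else
  if n is n'.+1 then (degree x)%:R^-1 * \sum_(y <- nbrs x) leave_in B n' y
  else 0.

Lemma leave_in01 B n x : 0 <= leave_in B n x <= 1.
Proof.
elim: n x => [|n IH] x /=; first by
  case: ifP => _; rewrite ?lexx ?ler01 //; case: ifP => _; rewrite lexx ler01.
case: ifP => _; first by rewrite lexx ler01.
case: ifP => _; first by rewrite lexx ler01.
apply/andP; split.
  rewrite mulr_ge0 ?invr_ge0 //; apply: sumr_ge0 => y _.
  by case/andP: (IH y).
rewrite ler_pdivrMl ?ltr0n ?degree_gt0 // -sum_nbrs_const.
by apply: ler_sum => y _; case/andP: (IH y).
Qed.

Lemma leave_in_incr B n x : leave_in B n x <= leave_in B n.+1 x.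
Proof.
elim: n x => [|n IH] x.
  rewrite /=; case: ifP => // _; case: ifP => // _.
  rewrite mulr_ge0 ?invr_ge0 //; apply: sumr_ge0 => y _.
  by case/andP: (leave_in01 B 0 y).
rewrite [leLHS]/= [leRHS]/=; case: ifP => // _; case: ifP => // _.
by rewrite ler_wpM2l ?invr_ge0 //; apply: ler_sum => y _; exact: IH.
Qed.

Lemma leave_limit (B : {fset G}) : exists q : G -> R,
  [/\ forall x, 0 <= q x <= 1, o \in B -> q o = 0,
      forall x, x \notin B -> q x = 1 &
      forall x, x \in B -> x != o -> laplacian q x = 0].
Proof.
pose q x := sup (range (fun n => leave_in B n x)).
have ub x : has_ubound (range (fun n => leave_in B n x)).
  by exists 1 => _ [n _ <-]; case/andP: (leave_in01 B n x).
have cv x : (leave_in B n x @[n --> \oo] --> q x).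
  apply: nondecreasing_cvgn => //.
  by apply/nondecreasing_seqP => n; exact: leave_in_incr.
have cvS x : (leave_in B n.+1 x @[n --> \oo] --> q x).
  by rewrite (cvg_shiftS (fun n => leave_in B n x)).
exists q; split.
- move=> x; apply/andP; split.
    apply: le_trans (_ : leave_in B 0 x <= _); first by case/andP: (leave_in01 B 0 x).
    by apply: ub_le_sup => //; exists 0%N.
  apply: ge_sup; first by exists (leave_in B 0 x); exists 0%N.
  by move=> _ [n _ <-]; case/andP: (leave_in01 B n x).
- move=> oB; apply: cvg_unique (cvS o) _ => //=; rewrite oB eqxx /=.
  exact: cvg_cst.
- move=> x xB; apply: cvg_unique (cvS x) _ => //=; rewrite xB /=.
  exact: cvg_cst.
- move=> x xB xo; rewrite laplacianD; apply/eqP; rewrite subr_eq0; apply/eqP.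
  have c2 : (leave_in B n.+1 x @[n --> \oo] -->
      (degree x)%:R^-1 * \sum_(y <- nbrs x) q y).
    rewrite /= xB (negbTE xo) /=; apply: cvgM; first exact: cvg_cst.
    by apply: cvg_sum_seq => y _; exact: cv.
  by rewrite (cvg_unique _ (cvS x) c2) // mulrA mulfV ?degree_neq0 // mul1r.
Qed.

Lemma sum_eq0_nbrs (q : G -> R) x y : (forall x, 0 <= q x) ->
  \sum_(y <- nbrs x) q y = 0 -> adj x y -> q y = 0.
Proof.
move=> q0 /eqP; rewrite psumr_eq0; last by [].
by move=> /allP H; rewrite -mem_nbrs => /H/eqP.
Qed.

(** The probability of leaving [B] before [o], divided by its Laplacian at [o]. *)
Lemma finite_potential (B : {fset G}) : o \in B -> exists h : G -> R,
  [/\ forall x, 0 <= h x, h o = 0, laplacian h o = 1 &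
      forall x, x \in B -> x != o -> laplacian h x = 0].
Proof.
move=> oB; have [q [q01 qo qB ql]] := leave_limit B.
have q0 x : 0 <= q x by case/andP: (q01 x).
have lapo : laplacian q o = \sum_(y <- nbrs o) q y.
  by rewrite laplacianD qo // mulr0 subr0.
(* Otherwise the zero of [q] at [o] spreads along edges, from [o] by assumption and from other
   vertices of [B] by harmonicity, and the infinite graph would lie in [B], as [q = 1] outside. *)
have c0 : laplacian q o != 0.
  apply/eqP; rewrite lapo => s0.
  have zero x y : adj x y -> q x = 0 -> q y = 0.
    move=> xy qx; have [xo|xo] := eqVneq x o.
      by apply: sum_eq0_nbrs s0 _; rewrite -?xo.
    have xB : x \in B.
      by apply: contraT => /qB /eqP; rewrite qx eq_sym oner_eq0.
    apply: (@sum_eq0_nbrs q x) xy => //.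
    by have := ql x xB xo; rewrite laplacianD qx mulr0 subr0.
  apply: (@vertex_infinite G); apply: (sub_finite_set _ (finite_fset B)) => x _.
  apply: contraT => /qB q1; have [p pp lp] := adj_connected o x.
  suff : q x = 0 by move/eqP; rewrite q1 oner_eq0.
  elim: p (o) pp lp (qo oB) => [|z p IH] a /=; first by move=> _ ->.
  by move=> /andP[az pp] lp qa; apply: IH pp lp (zero _ _ az qa).
exists (fun x => q x / laplacian q o).
have lapZ x : laplacian (fun x => q x / laplacian q o) x =
    laplacian q x / laplacian q o.
  by rewrite laplacianE [in RHS]laplacianE mulr_suml;
    apply: eq_bigr => y _; rewrite mulrBl.
have c1 : 0 <= laplacian q o by rewrite lapo sumr_ge0.
split => [x|||x xB xo]; first exact: divr_ge0.
- by rewrite qo // mul0r.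
- by rewrite lapZ mulfV.
- by rewrite lapZ ql // mul0r.
Qed.

(** Harnack inequality along a path from [o]: a non-negative function harmonic at [y] is at most
    [degree y] times its value at [y] on each neighbour, and the unit Laplacian at [o] starts the
    chain. The constant does not depend on [B]. *)
Lemma finite_potential_bound x : exists (C : R) (F : seq G),
  forall (B : {fset G}) (h : G -> R), {subset F <= B} ->
  (forall x, 0 <= h x) -> h o = 0 -> laplacian h o = 1 ->
  (forall x, x \in B -> x != o -> laplacian h x = 0) -> h x <= C.
Proof.
have [p pp <-] := adj_connected o x; elim/last_ind: p pp => [|p z IH].
  by move=> _; exists 0, [::] => B h _ _ ->.
rewrite rcons_path last_rcons => /andP[/IH [C [F CF]] yz].
set y := last o p in yz CF *.
have nbr_le (h : G -> R) : (forall x, 0 <= h x) -> h z <= \sum_(a <- nbrs y) h a.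
  move=> h0; rewrite (big_fsetD1 z) ?mem_nbrs //= lerDl sumr_ge0 //.
have [yo|yo] := eqVneq y o.
  exists 1, [::] => B h _ h0 ho lo _; apply: le_trans (nbr_le h h0) _.
  by rewrite yo -lo laplacianD ho mulr0 subr0.
exists ((degree y)%:R * C), (y :: F) => B h FB h0 ho lo lB.
apply: le_trans (nbr_le h h0) _.
have yB : y \in B by apply: FB; rewrite inE eqxx.
have := lB y yB yo; rewrite laplacianD => /eqP; rewrite subr_eq0 => /eqP ->.
rewrite ler_wpM2l //; apply: CF ho lo lB => // a aF.
by apply: FB; rewrite inE aF orbT.
Qed.

(** The finite potentials are bounded at each vertex, so they converge at all vertices at once along
    an ultrafilter; Laplacians are finite sums and pass to the limit. *)
Theorem potential_exists : exists h : G -> R, potential o h.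
Proof.
have finB (N : nat) : finite_set [set x : G | (choice.pickle x < N)%N \/ x = o].
  rewrite -[X in finite_set X]/([set x : G | (choice.pickle x < N)%N] `|` [set o]).
  rewrite finite_setU; split => //.
  apply: (@finite_preimage _ _ `I_N (@choice.pickle G)) => [x y _ _|].
    exact: (pcan_inj choice.pickleK).
  exact: finite_II.
pose B (N : nat) : {fset G} := fset_set [set x : G | (choice.pickle x < N)%N \/ x = o].
have memB (N : nat) (x : G) : (x \in B N) = ((choice.pickle x < N)%N || (x == o)).
  rewrite in_fset_set //; apply/idP/orP => [|H].
    by rewrite inE => -[|/eqP]; [left|right].
  by apply/mem_set; case: H => [|/eqP]; [left|right].
have oB N : o \in B N by rewrite memB eqxx orbT.
have /choice[u uP] := fun N => finite_potential (oB N).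
have subB (F : seq G) : \forall N \near \oo, {subset F <= B N}.
  elim: F => [|a F IH]; first by near=> N.
  near=> N.
  have FB : {subset F <= B N} by near: N; exact: IH.
  have aN : (choice.pickle a < N)%N by near: N; exact: nbhs_infty_gt.
  by move=> x; rewrite inE => /orP[/eqP ->|/FB //]; rewrite memB aN.
have [U [UU inU]] := ultraFilterLemma (@eventually_filter).
have PU : ProperFilter U by exact: ultra_proper.
have cv x : exists l : R, u^~ x @ U --> l.
  have [C [F CF]] := finite_potential_bound x.
  have := @segment_compact R 0 C; rewrite compact_ultra.
  move=> /(_ (u^~ x @ U) (ultra_fmap _ UU)) [|l [_ ul]]; last by exists l.
  apply: inU; near=> N; rewrite /= in_itv /=.
  have [h0 ho lo lB] := uP N; rewrite h0 /=.
  by apply: CF (h0) ho lo lB; near: N; exact: subB.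
have [h hP] := choice cv.
have lapc x : (laplacian (u N) x @[N --> U] --> laplacian h x).
  rewrite laplacianE; under eq_cvg do rewrite laplacianE.
  by apply: cvg_sum_seq => y _; apply: cvgB.
have eqc (f : nat -> R) (a l : R) : f @ U --> l ->
    (\forall N \near \oo, f N = a) -> l = a.
  move=> fl fa; have c2 : f @ U --> a by apply: cvg_near_cst; exact: inU.
  exact: cvg_unique fl c2.
exists h; split.
- move=> x; apply: (cvgr_to_ge (hP x)); apply: inU; near=> N.
  by have [h0 _ _ _] := uP N.
- apply: eqc (hP o) _; near=> N; by have [_ ho _ _] := uP N.
- apply: eqc (lapc o) _; near=> N; by have [_ _ lo _] := uP N.
- move=> x xo; apply: eqc (lapc x) _; near=> N.
  have [_ _ _ lB] := uP N; apply: lB => //.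
  have : {subset [:: x] <= B N} by near: N; exact: subB.
  by apply; rewrite inE.
Unshelve. all: by end_near.
Qed.

End Existence.

(** * Edges of the subdivided graph *)

Definition words (l : nat) : seq ternary :=
  iter l (fun s => [seq i :: t | t <- s, i <- enum 'I_3]) [:: [::]].

Lemma mem_words l t : (t \in words l) = (size t == l).
Proof.
elim: l t => [|l IH] t; first by rewrite inE; case: t.
apply/allpairsP/idP => [[[s i] /= [sl _ ->]]|].
  by rewrite /= eqSS -IH.
case: t => [//|i t]; rewrite /= eqSS -IH => tl.
by exists (t, i); split => //=; rewrite mem_enum.
Qed.

Lemma words_uniq l : uniq (words l).
Proof.
elim: l => [//|l IH]; apply: allpairs_uniq => //; first exact: enum_uniq.
by move=> [s i] [s' i'] _ _ /= [-> ->].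
Qed.

Lemma size_words l : size (words l) = (3 ^ l)%N.
Proof.
by elim: l => [//|l IH]; rewrite size_allpairs IH size_enum_ord expnSr.
Qed.

Lemma sum_words (V : nmodType) l (F : ternary -> V) :
  \sum_(t <- words l.+1) F t = \sum_(t <- words l) \sum_i F (i :: t).
Proof.
by rewrite big_allpairs_dep /=; apply: eq_bigr => t _; rewrite big_enum.
Qed.

Definition ball_size (l : nat) : nat := \sum_(j < l.+1) 3 ^ j.

Lemma ball_sizeS l : ball_size l.+1 = (ball_size l + 3 ^ l.+1)%N.
Proof. exact: big_ord_recr. Qed.

Lemma ball_size2_lt l : (ball_size l * 2 < 3 ^ l.+1)%N.
Proof.
elim: l => [|l IH]; first by rewrite /ball_size big_ord1.
by rewrite ball_sizeS [X in (_ < X)%N]expnS; lia.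
Qed.

Lemma ball_size_lt l : (ball_size l < 3 ^ l.+1)%N.
Proof. by have := ball_size2_lt l; lia. Qed.

Lemma ball_size_gt l : (l < ball_size l)%N.
Proof.
elim: l => [|l IH]; first by rewrite /ball_size big_ord1.
rewrite ball_sizeS; have := expn_gt0 3 l.+1; lia.
Qed.

Lemma ball_size_mono l m : (l <= m)%N -> (ball_size l <= ball_size m)%N.
Proof.
by apply: homo_leq leqnn leq_trans _ l m => n; rewrite ball_sizeS leq_addr.
Qed.

Lemma downclosed_seq (s : seq nat) : uniq s ->
  (forall m n, (m <= n)%N -> n \in s -> m \in s) ->
  forall n, (n \in s) = (n < size s)%N.
Proof.
move=> us dc n; apply/idP/idP => [ns|].
  rewrite -[n.+1](size_iota 0); apply: uniq_leq_size; first exact: iota_uniq.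
  by move=> m; rewrite mem_iota => /andP[_ mn]; apply: dc ns.
apply: contraTT => ns; rewrite -leqNgt -[n](size_iota 0).
apply: uniq_leq_size => // m ms; rewrite mem_iota /= add0n ltnNge.
by apply: contra ns => nm; exact: dc ms.
Qed.

Section Structure.
Variable v : bfs_enumeration.

(** Levels are non-decreasing along the enumeration, so the words of length at most [l] form an
    initial segment, whose length is their number. *)
Lemma bfs_ballE l n : (size (v n) <= l)%N = (n < ball_size l)%N.
Proof.
have [w vK wK] := bfs_bij v.
pose W := [seq w t | t <- flatten [seq words j | j <- iota 0 l.+1]].
have mW m : (m \in W) = (size (v m) <= l)%N.
  apply/mapP/idP => [[t /flattenP[s /mapP[j jl ->]]]|vl].
    rewrite mem_words => /eqP tj mE; move: jl.
    by rewrite mE wK tj mem_iota add0n => /andP[].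
  exists (v m); last by rewrite vK.
  apply/flattenP; exists (words (size (v m))); last by rewrite mem_words.
  by apply: map_f; rewrite mem_iota.
have uW : uniq W.
  rewrite map_inj_uniq; last exact: can_inj wK.
  have : forall k j, uniq (flatten [seq words i | i <- iota j k]); last exact.
  elim=> [//|k IH] j /=; rewrite cat_uniq words_uniq IH andbT /=.
  apply/hasPn => t /flattenP[s /mapP[i]]; rewrite mem_iota => /andP[ji _] ->.
  by rewrite !mem_words => /eqP ->; rewrite gtn_eqF.
have sW : size W = ball_size l.
  rewrite size_map size_flatten /shape -map_comp sumnE big_map.
  rewrite (_ : iota 0 l.+1 = index_iota 0 l.+1) ?/index_iota ?subn0 //.
  rewrite -[X in iota 0 X]subn0 -/(index_iota 0 l.+1) big_mkord.
  by apply: eq_bigr => j _; rewrite /= size_words.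
rewrite -mW -sW; apply: downclosed_seq => // m k mk; rewrite !mW.
by apply: leq_trans; exact: bfs_level.
Qed.

Lemma sum_bfs_level (V : nmodType) l (F : ternary -> V) :
  \sum_(ball_size l <= n < ball_size l.+1) F (v n) = \sum_(t <- words l.+1) F t.
Proof.
have [w vK wK] := bfs_bij v.
rewrite -(big_map v xpredT); apply: perm_big; apply: uniq_perm.
- by rewrite map_inj_uniq ?iota_uniq //; exact: can_inj vK.
- exact: words_uniq.
move=> t; rewrite mem_words; apply/mapP/idP => [[n]|/eqP tl].
  rewrite mem_index_iota leqNgt -!bfs_ballE => /andP[nl ln] ->.
  by rewrite eqn_leq ln ltnNge.
exists (w t); last by rewrite wK.
by rewrite mem_index_iota leqNgt -!bfs_ballE wK tl leqnn ltnn.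
Qed.

Lemma bfs0 : v 0%N = [::].
Proof.
have := bfs_ballE 0 0; rewrite /ball_size big_ord1 /= leqn0.
by move/nilP.
Qed.

Notation src := branch_src.
Notation tgt := (branch_tgt v).
Notation len := (branch_len v).
Notation V := (G_vertex v).

Definition edge_vertex (e : branch_edge) (k : nat) : G v :=
  path_vertex src tgt len e k.

Lemma at_edge0 e : edge_vertex e 0 = inl (src e).
Proof. by []. Qed.

Lemma at_edge_len e : edge_vertex e (len e) = inl (tgt e).
Proof. exact: path_vertex_len (branch_len_gt0 v) e. Qed.

Lemma at_edge_in e (j : 'I_(len e).-1) :
  edge_vertex e j.+1 = inr (existT (fun e => 'I_(len e).-1) e j).
Proof. exact: path_vertex_in. Qed.

Lemma adjP (x y : G v) : reflect (exists e k, (k < len e)%N /\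
    (x = edge_vertex e k /\ y = edge_vertex e k.+1 \/
     y = edge_vertex e k /\ x = edge_vertex e k.+1)) (adj x y).
Proof. exact: asboolP. Qed.

Lemma at_edge_adj e k : (k < len e)%N ->
  adj (edge_vertex e k : G v) (edge_vertex e k.+1).
Proof. by move=> kl; apply/adjP; exists e, k; split => //; left. Qed.

(* [psi e k] is the value at position [k] of [e]; the interior vertex of index
   [j] is at position [j.+1]. *)
Definition profile {X : Type} (chi : branch_vertex -> X)
    (psi : branch_edge -> nat -> X) (x : G v) : X :=
  match x with inl s => chi s | inr u => psi (tag u) (tagged u).+1 end.

Lemma profileE {X : Type} (chi : branch_vertex -> X) psi e k :
  psi e 0%N = chi (src e) -> psi e (len e) = chi (tgt e) -> (k <= len e)%N ->
  profile chi psi (edge_vertex e k) = psi e k.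
Proof.
move=> p0 pl kl; rewrite /edge_vertex.
have [->|->|j ->] := path_vertexP src tgt (branch_len_gt0 v) kl => //=.
Qed.

Definition ray_index (s : branch_vertex) : nat :=
  if s is inr m then m.+1 else 0.

(** A left inverse of the map from positions on paths to unit edges, in both orientations; it
    replaces a pairwise comparison of paths. Two branch vertices are adjacent only along the ray,
    every other path having interior vertices. *)
Definition edge_code (x y : G v) : branch_edge * nat :=
  match x, y with
  | inr u, inr u' => (tag u, (minn (tagged u) (tagged u')).+1)
  | inr u, inl s | inl s, inr u =>
      (tag u, if (nat_of_ord (tagged u) == 0%N) && (s == src (tag u)) then 0%N
              else (tagged u).+1)
  | inl s, inl t => (RayEdge (minn (ray_index s) (ray_index t)), 0%N)
  end.

Lemma branch_len_gt2 e : (2 < len e)%N \/ exists n, e = RayEdge n.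
Proof.
have L l : (2 < 3 ^ 3 ^ l)%N.
  by rewrite (leq_trans _ (leq_pexp2l _ (_ : 1 <= 3 ^ l))%N) // expn_gt0.
by case: e => [s i|n|n]; [left; exact: L|right; exists n|left; exact: L].
Qed.

Lemma edge_codeE e k : (k < len e)%N ->
  edge_code (edge_vertex e k) (edge_vertex e k.+1) = (e, k) /\
  edge_code (edge_vertex e k.+1) (edge_vertex e k) = (e, k).
Proof.
move=> kl; have [l2|[n en]] := branch_len_gt2 e; last first.
  have {kl} -> : k = 0%N by move: kl; rewrite en /= ltnS leqn0 => /eqP.
  rewrite en.
  rewrite at_edge0 [edge_vertex _ 1](at_edge_len (RayEdge n)).
  by case: n {en} => [|n] /=; split; congr (RayEdge _, _); lia.
rewrite /edge_vertex; case: (path_vertexP src tgt (branch_len_gt0 v) (ltnW kl));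
  case: (path_vertexP src tgt (branch_len_gt0 v) kl) => //.
- by move=> kL k0; move: kL; rewrite k0; lia.
- by move=> j [kj] k0 /=; rewrite -kj k0 !eqxx.
- by move=> _ kL; move: kl; rewrite kL ltnn.
- by move=> j _ kL; move: kl; rewrite kL ltnn.
- move=> kL j kj /=; rewrite kj in kL *; case: eqP => //= j0.
  by move: kL; rewrite j0; lia.
- move=> j' [kj'] j kj /=; split; congr (_, _); lia.
Qed.

Lemma at_edge_inj e k e' k' : (k < len e)%N -> (k' < len e')%N ->
  (edge_vertex e k = edge_vertex e' k' /\ edge_vertex e k.+1 = edge_vertex e' k'.+1) \/
  (edge_vertex e k = edge_vertex e' k'.+1 /\ edge_vertex e k.+1 = edge_vertex e' k') ->
  e = e' /\ k = k'.
Proof.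
move=> kl kl' H; suff : (e, k) = (e', k') by case.
have [<- _] := edge_codeE kl; have [E E'] := edge_codeE kl'.
by case: H => -[-> ->].
Qed.

End Structure.

Arguments edge_code : simpl never.

(** * Functions harmonic inside the paths *)

Section Slopes.
Context {R : realType} (v : bfs_enumeration).
Implicit Types (f : G v -> R) (e : branch_edge) (s : branch_vertex).

Notation src := branch_src.
Notation tgt := (branch_tgt v).
Notation len := (branch_len v).
Notation at_edge := (edge_vertex v).

Definition branch s : G v := inl s.

Definition inner e (j : 'I_(len e).-1) : G v :=
  inr (existT (fun e => 'I_(len e).-1) e j).

Lemma sum_nbrs_seq (x : G v) (L : seq (G v)) (F : G v -> R) : uniq L ->
  (forall y, (y \in L) = adj x y) ->
  \sum_(y <- nbrs x) F y = \sum_(y <- L) F y.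
Proof.
move=> uL mL; apply: perm_big; apply: uniq_perm => //.
by move=> y; rewrite mem_nbrs mL.
Qed.

(** Half-edges: [(e, true)] is [e] seen from its source, [(e, false)] from its target. *)
Definition far_end (h : branch_edge * bool) : G v :=
  if h.2 then at_edge h.1 1 else at_edge h.1 (len h.1).-1.

Lemma laplacian_branch f s (I : seq (branch_edge * bool)) :
  uniq [seq h.1 | h <- I] ->
  (forall h, h \in I <-> (if h.2 then src h.1 = s else tgt h.1 = s)) ->
  laplacian f (branch s) = \sum_(h <- I) (f (far_end h) - f (branch s)).
Proof.
move=> uI mI; rewrite laplacianE (@sum_nbrs_seq _ (map far_end I)) ?big_map //.
  apply: (@map_uniq _ _ (fun y => (edge_code (branch s) y).1)).
  rewrite -map_comp (_ : map _ I = [seq h.1 | h <- I]) //.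
  apply/eq_in_map => -[e b] /mI /= es.
  rewrite -[LHS]/((edge_code (branch s) (far_end (e, b))).1).
  have l0 := branch_len_gt0 v e; case: b es => /= es.
    have -> : branch s = at_edge e 0 by rewrite /branch -es.
    rewrite -[far_end _]/(at_edge e 1).
    by rewrite (edge_codeE l0).1.
  have l1 : ((len e).-1 < len e)%N by rewrite prednK.
  have -> : branch s = at_edge e (len e).-1.+1.
    by rewrite prednK // at_edge_len es.
  rewrite -[far_end _]/(at_edge e (len e).-1).
  by rewrite (edge_codeE l1).2.
move=> y; apply/mapP/adjP => [[[e b] /mI /= eb ->]|].
  have l0 := branch_len_gt0 v e; case: b eb => es; rewrite /far_end /branch -es.
    by exists e, 0%N; split => //; left.
  exists e, (len e).-1; rewrite prednK //; split => //; right.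
  by rewrite at_edge_len.
move=> [e [k [kl H]]].
have ends j : (j <= len e)%N -> branch s = at_edge e j ->
    j = 0%N /\ src e = s \/ j = len e /\ tgt e = s.
  move=> jl; rewrite /branch /edge_vertex.
  by case: (path_vertexP src tgt (branch_len_gt0 v) jl) => // -> [->]; tauto.
case: H => [[H ->]|[-> H]].
  have [[k0 es]|[kL _]] := ends k (ltnW kl) H; last by rewrite kL ltnn in kl.
  by exists (e, true); [exact/mI|rewrite k0].
have [[//]|[kL es]] := ends k.+1 kl H.
by exists (e, false); [exact/mI|rewrite /far_end /= -kL].
Qed.

Lemma laplacian_inner f e (j : 'I_(len e).-1) :
  laplacian f (inner j) =
  f (at_edge e j) + f (at_edge e j.+2) - f (at_edge e j.+1) *+ 2.
Proof.
have jl : (j.+1 < len e)%N by rewrite -[X in (_ < X)%N]prednK ?branch_len_gt0 // ltnS.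
have jx : inner j = at_edge e j.+1 by rewrite at_edge_in.
rewrite laplacianE (@sum_nbrs_seq _ [:: at_edge e j; at_edge e j.+2]).
- by rewrite !big_cons big_nil jx mulr2n; ring.
- rewrite /= inE andbT; apply/eqP => H.
  have [_] : e = e /\ j = j.+1 :> nat.
    by apply: (@at_edge_inj v) => //; [exact: ltnW|right].
  by move/n_Sn.
move=> y; apply/idP/adjP; rewrite !inE.
  case/orP => /eqP ->.
    by exists e, j; split; [exact: ltnW|right].
  by exists e, j.+1; split; [exact: jl|left].
move=> [e' [k [kl H]]].
have mid i : (i <= len e')%N -> inner j = at_edge e' i -> e' = e /\ i = j.+1.
  move=> il; rewrite /inner /edge_vertex.
  case: (path_vertexP src tgt (branch_len_gt0 v) il) => // j' -> H'.
  split; first by case: H'.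
  by move/(congr1 (fun x : G v => if x is inr u then nat_of_ord (tagged u)
                                  else 0%N)): H' => /= ->.
case: H => [[H ->]|[-> H]].
  by have [-> ->] := mid _ (ltnW kl) H; rewrite eqxx orbT.
by have [-> [->]] := mid _ kl H; rewrite eqxx.
Qed.

(** The current through [e]: for a function harmonic inside the paths, its increment across every
    unit edge of [e]. *)
Definition slope f e : R :=
  (f (branch (tgt e)) - f (branch (src e))) / (len e)%:R.

Definition harmonic_inside f : Prop :=
  forall e (j : 'I_(len e).-1), laplacian f (inner j) = 0.

Lemma len_neq0 e : (len e)%:R != 0 :> R.
Proof. by rewrite pnatr_eq0 -lt0n branch_len_gt0. Qed.

Lemma at_edge_linear f e k : harmonic_inside f -> (k <= len e)%N ->
  f (at_edge e k) = f (branch (src e)) + k%:R * slope f e.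
Proof.
move=> hf.
pose d := f (at_edge e 1) - f (at_edge e 0).
have lin i : (i.+1 <= len e)%N ->
    f (at_edge e i) = f (at_edge e 0) + i%:R * d /\
    f (at_edge e i.+1) = f (at_edge e 0) + i.+1%:R * d.
  elim: i => [|i IH] il; first by rewrite /d; split; ring.
  have [E1 E2] := IH (ltnW il); split => //.
  have jl : (i < (len e).-1)%N by rewrite -ltnS prednK ?branch_len_gt0.
  have := hf e (Ordinal jl); rewrite laplacian_inner /= E1 E2.
  rewrite -!natr1 mulr2n; lra.
have l0 := branch_len_gt0 v e.
have dE : d = slope f e.
  have l1 : ((len e).-1.+1 <= len e)%N by rewrite prednK.
  have [_] := lin _ l1; rewrite prednK // at_edge_len at_edge0 => E.
  by rewrite /slope /branch E addrC addKr mulrC mulKf // len_neq0.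
rewrite -dE; case: k => [|k] kl; first by rewrite mul0r addr0.
by have [_] := lin k kl.
Qed.

Lemma far_end_slope f h : harmonic_inside f ->
  f (far_end h) = if h.2 then f (branch (src h.1)) + slope f h.1
                  else f (branch (tgt h.1)) - slope f h.1.
Proof.
case: h => e b hf; rewrite /far_end /=; have l0 := branch_len_gt0 v e.
case: b; first by rewrite at_edge_linear // mul1r.
rewrite at_edge_linear ?leq_pred // -subn1 natrB // mulrBl mul1r addrA.
by congr (_ - _); rewrite /slope mulrC divfK ?len_neq0 // addrC subrK.
Qed.

(** At the root, the ray edge leaving it stands in for the missing parent, with the opposite sign,
    so that [laplacian_word] has one form for all words. *)
Definition up_slope f (t : ternary) : R :=
  if t is i :: s then slope f (TreeEdge s i) else - slope f (RayEdge 0).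

Lemma laplacian_word f n : harmonic_inside f ->
  laplacian f (branch (inl (v n))) =
  \sum_i slope f (TreeEdge (v n) i) - up_slope f (v n) - slope f (LinkEdge n).
Proof.
move=> hf; have vinj : injective v by exact: bij_inj (bfs_bij v).
pose I0 := (if v n is i :: s then (TreeEdge s i, false) else (RayEdge 0, true)).
rewrite (@laplacian_branch _ _ (I0 :: (LinkEdge n, false) ::
  [seq (TreeEdge (v n) i, true) | i <- enum 'I_3])).
- rewrite !big_cons big_map big_enum /=.
  rewrite (eq_bigr (fun i => slope f (TreeEdge (v n) i))); last first.
    by move=> i _; rewrite far_end_slope //= addrAC subrr add0r.
  have -> : f (far_end I0) - f (branch (inl (v n))) = - up_slope f (v n).
    rewrite /I0; case: (v n) => [|i s]; rewrite far_end_slope //=.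
      by rewrite opprK addrAC subrr add0r.
    by rewrite addrAC subrr add0r.
  rewrite far_end_slope //=; ring.
- rewrite /= -map_comp map_inj_uniq; last by move=> i j [].
  rewrite enum_uniq andbT inE negb_or /I0.
  apply/andP; split; [apply/andP; split|].
  + by case: (v n).
  + by apply/mapP => -[j _]; case: (v n) => [//|i s] [] /(congr1 size)/n_Sn.
  + by apply/mapP => -[].
- move=> [e b]; rewrite !inE /=; split.
    case/or3P => [/eqP|/eqP [-> ->] //|/mapP[i _ [-> ->]] //].
    by rewrite /I0; case: (v n) => [|i s] [-> ->].
  case: b => es; last first.
    case: e es => [s i|m|m] //= [] E; rewrite /I0 -?E ?eqxx //.
    by move/vinj: E => ->; rewrite eqxx orbT.
  case: e es => [s i|[|m]|m] //= [] E.
    rewrite E (_ : (_ \in [seq _ | _ <- _]) = true) ?orbT //.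
    by apply: map_f; rewrite mem_enum.
  by rewrite /I0 -E eqxx.
Qed.

Lemma laplacian_ray f n : harmonic_inside f ->
  laplacian f (branch (inr n)) =
  slope f (RayEdge n.+1) + slope f (LinkEdge n) - slope f (RayEdge n).
Proof.
move=> hf; rewrite (@laplacian_branch _ _
  [:: (RayEdge n, false); (RayEdge n.+1, true); (LinkEdge n, true)]).
- rewrite !big_cons big_nil !far_end_slope //=; ring.
- rewrite /= !inE negb_or /= !andbT; apply/eqP => -[] /n_Sn.
  exact.
- move=> [e b]; rewrite !inE /=; split.
    by case/or3P => /eqP [-> ->].
  case: b; case: e => [s i|[|m]|m] //= [] -> //; rewrite !eqxx ?orbT //.
Qed.

Lemma slope_pair f e k : harmonic_inside f -> (k < len e)%N ->
  f (at_edge e k.+1) - f (at_edge e k) = slope f e.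
Proof.
move=> hf kl; rewrite !at_edge_linear //; last exact: ltnW.
by rewrite -natr1; ring.
Qed.

End Slopes.

(** * Cutoff functions *)

Section Cutoffs.
Context {R : realType} (v : bfs_enumeration).

Notation src := branch_src.
Notation tgt := (branch_tgt v).
Notation len := (branch_len v).
Notation at_edge := (edge_vertex v).

Lemma sum_single (T : eqType) (s : seq T) (a : T) (c : R) : uniq s -> 0 <= c ->
  \sum_(x <- s) (if x == a then c else 0) <= c.
Proof.
move=> us c0; rewrite -big_mkcond big_const_seq iter_addr_0.
rewrite (@count_uniq_mem _ _ a us); by case: (a \in s); rewrite ?mulr1n ?mulr0n.
Qed.

Lemma pair_sum_cover (A : {fset G v}) (L : seq (G v * G v)) (F : G v -> G v -> R) :
  (forall x y, 0 <= F x y) ->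
  (forall x y, adj x y -> F x y != 0 -> (x, y) \in L) ->
  pair_sum A F <= \sum_(q <- L) F q.1 q.2.
Proof.
move=> F0 FL.
apply: (@le_trans _ _ (\sum_(x <- A) \sum_(y <- A) \sum_(q <- L)
    if x == q.1 then (if y == q.2 then F q.1 q.2 else 0) else 0)).
  apply: ler_sum => x _; rewrite big_mkcond; apply: ler_sum => y _.
  have S0 (q : G v * G v) :
      0 <= if x == q.1 then (if y == q.2 then F q.1 q.2 else 0) else 0.
    by do 2 case: ifP => _ //.
  have [->|Fxy] := eqVneq (F x y) 0; first by rewrite if_same sumr_ge0.
  case: ifP => xy; last by rewrite sumr_ge0.
  have := FL x y xy Fxy; elim: (L) => [//|q l IH].
  rewrite inE big_cons => /orP[/eqP <-|/IH {}IH] /=.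
    by rewrite !eqxx lerDl sumr_ge0.
  by rewrite ler_wpDl.
under eq_bigr do rewrite exchange_big.
rewrite exchange_big; apply: ler_sum => q _.
apply: le_trans (sum_single q.1 (fset_uniq A) (F0 q.1 q.2)).
apply: ler_sum => x _; case: ifP => _; last by rewrite big1.
exact: sum_single.
Qed.

Definition interpolate (chi : branch_vertex -> R) : G v -> R :=
  profile chi (fun e k =>
    chi (src e) + k%:R / (len e)%:R * (chi (tgt e) - chi (src e))).

Lemma interpolateE chi e k : (k <= len e)%N -> interpolate chi (at_edge e k) =
  chi (src e) + k%:R / (len e)%:R * (chi (tgt e) - chi (src e)).
Proof.
move=> kl; rewrite /interpolate profileE // ?mul0r ?addr0 //.
by rewrite mulfV ?len_neq0 // mul1r addrC subrK.
Qed.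

(** Each jump is spread over [len e] unit edges; the factor 2 counts both orientations. *)
Lemma dirichlet_interpolate chi (A : {fset G v}) (E : seq branch_edge) :
  (forall e, chi (tgt e) != chi (src e) -> e \in E) ->
  dirichlet A (interpolate chi) <=
  \sum_(e <- E) 2 * (chi (tgt e) - chi (src e)) ^+ 2 / (len e)%:R.
Proof.
move=> EP; pose L := flatten [seq flatten [seq
    [:: (at_edge e k, at_edge e k.+1); (at_edge e k.+1, at_edge e k)]
  | k <- iota 0 (len e)] | e <- E].
have step e k : (k < len e)%N ->
    (interpolate chi (at_edge e k.+1) - interpolate chi (at_edge e k)) ^+ 2 =
    (chi (tgt e) - chi (src e)) ^+ 2 / (len e)%:R ^+ 2.
  move=> kl; rewrite !interpolateE //; last exact: ltnW.
  rewrite -expr_div_n; congr (_ ^+ 2); rewrite -natr1; field.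
  exact: len_neq0.
apply: le_trans (@pair_sum_cover A L
  (fun x y => (interpolate chi y - interpolate chi x) ^+ 2) _ _) _.
- by move=> x y; exact: sqr_ge0.
- move=> x y /adjP[e [k [kl H]]] D0.
  have eE : e \in E.
    apply: EP; apply: contra_neq D0 => cE.
    have := step _ _ kl; rewrite cE subrr expr0n mul0r => s0.
    by case: H => -[-> ->] //; rewrite -sqrrN opprB.
  apply/flattenP; eexists; first by apply/mapP; exists e.
  apply/flattenP; eexists; first by apply/mapP; exists k; rewrite ?mem_iota.
  by case: H => -[-> ->]; rewrite !inE eqxx ?orbT.
rewrite big_flatten big_map; apply: ler_sum => e _.
rewrite big_flatten big_map big_seq.
rewrite (eq_bigr (fun=> 2 * (chi (tgt e) - chi (src e)) ^+ 2 / (len e)%:R ^+ 2)).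
  rewrite -big_seq big_const_seq count_predT size_iota iter_addr_0 -[leLHS]mulr_natr.
  rewrite le_eqVlt; apply/orP; left; apply/eqP; field; exact: len_neq0.
move=> k; rewrite mem_iota => /andP[_ kl]; rewrite !big_cons big_nil /=.
rewrite -[X in _ + (X + _)]sqrrN opprB step //; ring.
Qed.

(** On the tree a sharp cutoff is cheap because the paths to the next level are long. Ray edges have
    length 1, so on the ray the cutoff decreases over [l.+1] steps beyond the ball; truncated
    subtraction keeps it in [0, 1]. *)
Definition cutoff_value (l : nat) (s : branch_vertex) : R :=
  match s with
  | inl t => (size t <= l)%N%:R
  | inr n => (l.+1 - (n - ball_size l))%N%:R / l.+1%:R
  end.

Lemma cutoff_value01 l s : 0 <= cutoff_value l s <= 1.
Proof.
case: s => [t|n] /=; first by case: leqP; rewrite ?lexx ?ler01.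
by rewrite divr_ge0 //= ler_pdivrMr ?ltr0n // mul1r ler_nat leq_subr.
Qed.

Lemma interpolate01 chi x : (forall s, 0 <= chi s <= 1) ->
  0 <= interpolate chi x <= 1.
Proof.
move=> c01; case: x => [s|[e j]]; first exact: c01.
rewrite /interpolate /=; have /andP[a0 a1] := c01 (src e).
have /andP[b0 b1] := c01 (tgt e).
set q := _ / _; have q0 : 0 <= q by rewrite divr_ge0.
have q1 : q <= 1.
  rewrite ler_pdivrMr ?ltr0n ?branch_len_gt0 // mul1r ler_nat.
  by apply: leq_trans (ltn_ord j) _; exact: leq_pred.
apply/andP; split; nra.
Qed.

Definition depth (s : branch_vertex) : nat :=
  match s with inl t => size t | inr n => n end.

Definition vertex_depth (x : G v) : nat :=
  match x with
  | inl s => depth s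
  | inr u => maxn (depth (src (tag u))) (depth (tgt (tag u)))
  end.

Lemma cutoff_value1 l s : (depth s <= l)%N -> cutoff_value l s = 1.
Proof.
case: s => [t|n] /= dl; first by rewrite dl.
have /ltnW nl := leq_ltn_trans dl (ball_size_gt l).
by rewrite (eqP (nl : (n - ball_size l == 0)%N)) subn0 mulfV // pnatr_eq0.
Qed.

Lemma cutoff1 l x : (vertex_depth x <= l)%N -> interpolate (cutoff_value l) x = 1.
Proof.
case: x => [s|[e j]] /=; first exact: cutoff_value1.
rewrite geq_max => /andP[dl dl'].
by rewrite /interpolate /= !cutoff_value1 // subrr mulr0 addr0.
Qed.

Lemma cutoff_finite l :
  finite_set [set x | interpolate (cutoff_value l) x != 0].
Proof.
pose S : seq branch_vertex :=
  [seq inl t | t <- flatten [seq words j | j <- iota 0 l.+1]] ++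
  [seq inr n | n <- iota 0 (ball_size l + l.+1)].
have inS s : cutoff_value l s != 0 -> s \in S.
  rewrite mem_cat; case: s => [t|n] H.
    apply/orP; left. apply/mapP; exists t => //; apply/flattenP.
    exists (words (size t)).
      apply: map_f; rewrite mem_iota add0n ltnS.
      by move: H; rewrite /=; case: leqP => //; rewrite eqxx.
    by rewrite mem_words.
  apply/orP; right; apply/mapP; exists n => //; rewrite mem_iota /=.
  rewrite ltnNge; apply: contra_neqN H => nl; rewrite /=.
  rewrite (_ : (_ - _)%N = 0%N) ?mul0r //; lia.
have fI s : finite_set [set e | src e = s \/ tgt e = s].
  exact: branch_incident_finite.
apply: (@sub_finite_set _ _ ([set (inl s : G v) | s in [set` S]] `|`
  \bigcup_(s in [set` S]) \bigcup_(e in [set e | src e = s \/ tgt e = s])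
    (at_edge e @` `I_(len e)))); last first.
  rewrite finite_setU; split; first exact/finite_image/finite_seq.
  apply: bigcup_finite => [|s _]; first exact: finite_seq.
  by apply: bigcup_finite => // e _; exact/finite_image/finite_II.
move=> [s|[e j]] /=.
  by move=> /inS sS; left; exists s.
move=> H; right.
have : cutoff_value l (src e) != 0 \/ cutoff_value l (tgt e) != 0.
  apply/orP; apply: contra_neqT H; rewrite negb_or !negbK.
  by move=> /andP[/eqP E /eqP E']; rewrite /interpolate /= E E' subrr mulr0 addr0.
have jx : at_edge e j.+1 = inr (existT _ e j) by exact: at_edge_in.
have jl : (j.+1 < len e)%N by rewrite -[X in (_ < X)%N]prednK ?branch_len_gt0 // ltnS.
case=> /inS sS; [exists (src e)|exists (tgt e)] => //; exists e => //=;
  by [left|right|exists j.+1].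
Qed.

Lemma leq_pow3 l : (2 * l < 3 ^ l)%N.
Proof. by elim: l => // l IH; rewrite expnS; lia. Qed.

Lemma cutoff_energy l A :
  dirichlet A (interpolate (cutoff_value l)) <= 6 / l.+1%:R.
Proof.
(* The only paths with a jump: those from level [l] to the next, the ray edges of the ramp, and the
   links issuing from the ramp, whose words are beyond level [l]. Each kind contributes at most
   [2 / l.+1%:R]. *)
pose E := [seq TreeEdge t i | t <- words l, i <- enum 'I_3] ++
  [seq RayEdge n | n <- iota (ball_size l).+1 l.+1] ++
  [seq LinkEdge n | n <- iota (ball_size l) l.+1].
apply: le_trans (@dirichlet_interpolate _ A E _) _.
  case=> [s i|n|n] /= H; rewrite !mem_cat.
  - rewrite (_ : _ \in [seq TreeEdge _ _ | _ <- _, _ <- _]) //.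
    apply/allpairsP; exists (s, i); rewrite mem_enum mem_words; split => //=.
    by apply: contraNT H => sl; apply/eqP; congr (_%:R); lia.
  - rewrite (_ : _ \in [seq RayEdge _ | _ <- _]) ?orbT //.
    apply: map_f; rewrite mem_iota; apply: contraNT H => nl; apply/eqP.
    case: n nl => [|n] nl /=.
      rewrite (_ : (0 - _)%N = 0%N) ?sub0n // subn0.
      by rewrite mulfV ?pnatr_eq0.
    by congr (_%:R / _); lia.
  - rewrite (_ : _ \in [seq LinkEdge _ | _ <- _]) ?orbT //.
    apply: map_f; rewrite mem_iota; apply: contraNT H => nl; apply/eqP.
    rewrite bfs_ballE; case: ltnP => nl'.
      rewrite (_ : (n - _)%N = 0%N); last by lia.
      by rewrite subn0 mulfV ?pnatr_eq0.
    rewrite (_ : (_ - _)%N = 0%N); last by move: nl; rewrite nl' /=; lia.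
    by rewrite mul0r.
have lp : 0 < l.+1%:R :> R by rewrite ltr0n.
have sq1 (a b : R) : 0 <= a <= 1 -> 0 <= b <= 1 -> (a - b) ^+ 2 <= 1.
  by move=> /andP[? ?] /andP[? ?]; nra.
have D2 : l.+1%:R / (3 ^ 3 ^ l.+1)%:R <= (l.+1%:R : R)^-1.
  rewrite ler_pdivrMr ?ltr0n ?expn_gt0 // ler_pdivlMl // -natrM ler_nat.
  apply: (@leq_trans (3 ^ l.+1 * 3 ^ l.+1)); first by have := leq_pow3 l.+1; nia.
  by rewrite -expnD leq_exp2l //; have := leq_pow3 l.+1; lia.
have D3 : (3 ^ l.+1)%:R / (3 ^ 3 ^ l.+1)%:R <= (l.+1%:R : R)^-1.
  rewrite ler_pdivrMr ?ltr0n ?expn_gt0 // ler_pdivlMl // -natrM ler_nat.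
  apply: (@leq_trans (3 ^ l.+1 * 3 ^ l.+1)); first by have := leq_pow3 l.+1; nia.
  by rewrite -expnD leq_exp2l //; have := leq_pow3 l.+1; lia.
rewrite !big_cat.
have S1 : \sum_(e <- [seq TreeEdge t i | t <- words l, i <- enum 'I_3])
    2 * (cutoff_value l (tgt e) - cutoff_value l (src e)) ^+ 2 / (len e)%:R <=
    2 / l.+1%:R.
  rewrite big_allpairs_dep big_seq.
  apply: (@le_trans _ _ (\sum_(t <- words l | t \in words l)
      \sum_(i <- enum 'I_3) 2 / (3 ^ 3 ^ l.+1)%:R)).
    apply: ler_sum => t; rewrite mem_words => /eqP tl; apply: ler_sum => i _.
    rewrite /= tl ler_pM2r ?invr_gt0 ?ltr0n ?expn_gt0 //.
    by rewrite ler_piMr //; apply: sq1; rewrite -?[_%:R]/(cutoff_value l (inl _)); case: leqP; rewrite ?lexx ?ler01.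
  rewrite -big_seq !big_const_seq !count_predT size_words size_enum_ord.
  rewrite !iter_addr_0 -mulrnA -expnS -[leLHS]mulr_natr -mulrA. rewrite ler_pM2l //.
  by rewrite mulrC.
have S2 : \sum_(e <- [seq RayEdge n | n <- iota (ball_size l).+1 l.+1])
    2 * (cutoff_value l (tgt e) - cutoff_value l (src e)) ^+ 2 / (len e)%:R <=
    2 / l.+1%:R.
  rewrite big_map.
  apply: (@le_trans _ _ (\sum_(n <- iota (ball_size l).+1 l.+1)
      2 / l.+1%:R ^+ 2)).
    rewrite big_seq [leRHS]big_seq; apply: ler_sum => n.
    rewrite mem_iota; case: n => [//|n] /andP[nl nu] /=.
    rewrite divr1 -mulrBl expr_div_n ler_pM2l // ler_piMl ?invr_ge0 ?exprn_ge0 //.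
    rewrite (_ : (l.+1 - (n - _))%N = (l.+1 - (n.+1 - ball_size l)).+1); last by lia.
    by rewrite -natr1 opprD addrA subrr sub0r sqrrN expr1n.
  rewrite big_const_seq count_predT size_iota iter_addr_0 -[leLHS]mulr_natr.
  rewrite le_eqVlt; apply/orP; left; apply/eqP; field.
  by rewrite gt_eqF.
have S3 : \sum_(e <- [seq LinkEdge n | n <- iota (ball_size l) l.+1])
    2 * (cutoff_value l (tgt e) - cutoff_value l (src e)) ^+ 2 / (len e)%:R <=
    2 / l.+1%:R.
  rewrite big_map.
  apply: (@le_trans _ _ (\sum_(n <- iota (ball_size l) l.+1)
      2 / (3 ^ 3 ^ l.+1)%:R)).
    rewrite big_seq [leRHS]big_seq; apply: ler_sum => n.
    rewrite mem_iota => /andP[nl _]; rewrite -[X in X <= _]mulrA ler_pM2l //.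
    apply: (@le_trans _ _ (len (LinkEdge n))%:R^-1).
      by rewrite ler_piMl ?invr_ge0 //; apply: sq1; exact: cutoff_value01.
    rewrite lef_pV2 ?posrE ?ltr0n ?expn_gt0 // ler_nat /= !leq_exp2l //.
    by rewrite ltnNge bfs_ballE -leqNgt.
  rewrite big_const_seq count_predT size_iota iter_addr_0 -[leLHS]mulr_natr.
  by rewrite -mulrA ler_pM2l // mulrC.
rewrite (_ : 6 / l.+1%:R = 2 / l.+1%:R + (2 / l.+1%:R + 2 / l.+1%:R) :> R).
  by rewrite !lerD.
by rewrite -!mulrDl; congr (_ / _); ring.
Qed.

Theorem G_cutoffs : null_cutoffs R (G v).
Proof.
move=> F eps eps0.
pose l := maxn (\max_(x <- F) vertex_depth x) (Num.truncn (6 / eps)).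
exists (interpolate (cutoff_value l)); split.
- by move=> x; apply: interpolate01; exact: cutoff_value01.
- move=> x xF; apply: cutoff1; rewrite leq_max; apply/orP; left.
  exact: leq_bigmax_seq.
- exact: cutoff_finite.
move=> A; apply: le_trans (cutoff_energy _ _) _.
rewrite ler_pdivrMr ?ltr0n // mulrC -ler_pdivrMr //.
apply: le_trans (ltW (truncnS_gt _)) _; by rewrite ler_nat ltnS leq_maxr.
Qed.

End Cutoffs.

(** * Flows through the levels of the tree *)

Section Flow.
Context {R : realType} (v : bfs_enumeration).

Notation src := branch_src.
Notation tgt := (branch_tgt v).
Notation len := (branch_len v).
Notation br := (branch v).

Definition level_sum (l : nat) (F : ternary -> 'I_3 -> R) : R :=
  \sum_(t <- words l) \sum_i F t i.

Definition jump (b : branch_vertex -> R) (e : branch_edge) : R :=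
  b (tgt e) - b (src e).

(** The Dirichlet form on the ball of level [l], with one term for each path. *)
Definition edge_form (b : branch_vertex -> R) (f : G v -> R) (l : nat) : R :=
  \sum_(0 <= n < ball_size l) (jump b (RayEdge n) * slope f (RayEdge n) +
    jump b (LinkEdge n) * slope f (LinkEdge n)) +
  \sum_(0 <= j < l) level_sum j (fun t i =>
    jump b (TreeEdge t i) * slope f (TreeEdge t i)).

(** Summation by parts along the ray. *)
Lemma ray_sum (b : branch_vertex -> R) (s lk : nat -> R) a c : (a <= c)%N ->
  \sum_(a <= n < c) b (inr n) * (s n.+1 + lk n - s n) =
  \sum_(a <= n < c) b (inr n) * lk n + b (ray_vertex c) * s c -
  b (ray_vertex a) * s a -
  \sum_(a <= n < c) (b (inr n) - b (ray_vertex n)) * s n.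
Proof.
elim: c => [|c IH]; first by rewrite leqn0 => /eqP ->; rewrite !big_geq //; ring.
rewrite leq_eqVlt => /orP[/eqP ->|]; first by rewrite !big_geq //; ring.
by rewrite ltnS => ac; rewrite !big_nat_recr //= IH //; ring.
Qed.

(** Green's formula on the ball. The boundary consists of the ray edge at its exit and of the paths
    to the next level; interior vertices of paths contribute nothing. *)
Lemma level_green (b : branch_vertex -> R) (f : G v -> R) l :
  harmonic_inside f ->
  \sum_(0 <= n < ball_size l)
    (b (inl (v n)) * laplacian f (br (inl (v n))) +
     b (inr n) * laplacian f (br (inr n))) =
  b (ray_vertex (ball_size l)) * slope f (RayEdge (ball_size l)) +
  level_sum l (fun t i => b (inl t) * slope f (TreeEdge t i)) -
  edge_form b f l.
Proof.
move=> hf; elim: l => [|l IH].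
  have b0 : ball_size 0 = 1%N by rewrite /ball_size big_ord1.
  rewrite /edge_form b0 !big_nat1 [\sum_(0 <= j < 0) _]big_geq // /level_sum big_seq1.
  rewrite laplacian_word // laplacian_ray // /jump /= ?bfs0 /=.
  rewrite -mulr_sumr; ring.
have le_ball : (ball_size l <= ball_size l.+1)%N by exact: ball_size_mono.
rewrite (big_cat_nat (leq0n _) le_ball) //= IH {IH}.
rewrite /edge_form [in RHS](big_cat_nat (leq0n _) le_ball) //= [in RHS]big_nat_recr //=.
rewrite [X in _ + X = _]big_split /=.
rewrite [X in _ + (_ + X) = _](_ : _ =
   \sum_(ball_size l <= n < ball_size l.+1) b (inr n) *
     (slope f (RayEdge n.+1) + slope f (LinkEdge n) - slope f (RayEdge n))).
  2: by apply: eq_bigr => n _; rewrite laplacian_ray.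
rewrite (ray_sum b (fun n => slope f (RayEdge n))
  (fun n => slope f (LinkEdge n)) le_ball).
rewrite [X in _ + (X + _) = _](_ : _ =
   \sum_(ball_size l <= n < ball_size l.+1)
     (b (inl (v n)) * (\sum_i slope f (TreeEdge (v n) i) - up_slope f (v n))) -
   \sum_(ball_size l <= n < ball_size l.+1)
     b (inl (v n)) * slope f (LinkEdge n)); last first.
  rewrite -sumrB; apply: eq_bigr => n _; rewrite laplacian_word //; ring.
rewrite (sum_bfs_level v l (fun t =>
  b (inl t) * (\sum_i slope f (TreeEdge t i) - up_slope f t))).
have -> : \sum_(t <- words l.+1)
    b (inl t) * (\sum_i slope f (TreeEdge t i) - up_slope f t) =
    level_sum l.+1 (fun t i => b (inl t) * slope f (TreeEdge t i)) -
    (level_sum l (fun t i => jump b (TreeEdge t i) * slope f (TreeEdge t i)) +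
     level_sum l (fun t i => b (inl t) * slope f (TreeEdge t i))).
  rewrite /level_sum -big_split /=.
  rewrite [X in _ = _ - X](_ : _ = \sum_(t <- words l.+1) b (inl t) * up_slope f t).
    rewrite -sumrB; apply: eq_bigr => t _; rewrite mulrBr mulr_sumr //.
  rewrite sum_words; apply: eq_bigr => t _; rewrite -big_split /=.
  by apply: eq_bigr => i _; rewrite /jump /=; ring.
rewrite [X in _ = _ - (_ + X + _)]big_split /=.
have -> : \sum_(ball_size l <= i < ball_size l.+1)
    jump b (LinkEdge i) * slope f (LinkEdge i) =
    \sum_(ball_size l <= n < ball_size l.+1) b (inl (v n)) * slope f (LinkEdge n)
    - \sum_(ball_size l <= n < ball_size l.+1) b (inr n) * slope f (LinkEdge n).
  by rewrite -sumrB; apply: eq_bigr => n _; rewrite /jump /= mulrBl.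
have -> : \sum_(ball_size l <= i < ball_size l.+1)
    jump b (RayEdge i) * slope f (RayEdge i) =
    \sum_(ball_size l <= n < ball_size l.+1)
      (b (inr n) - b (ray_vertex n)) * slope f (RayEdge n).
  by apply: eq_bigr.
ring.
Qed.

Lemma level_green_root (b : branch_vertex -> R) (f : G v -> R) l :
  harmonic_inside f ->
  (forall n, (0 < n < ball_size l)%N -> laplacian f (br (inl (v n))) = 0) ->
  (forall n, (n < ball_size l)%N -> laplacian f (br (inr n)) = 0) ->
  b (inl [::]) * laplacian f (G_root v) =
  b (ray_vertex (ball_size l)) * slope f (RayEdge (ball_size l)) +
  level_sum l (fun t i => b (inl t) * slope f (TreeEdge t i)) -
  edge_form b f l.
Proof.
move=> hf fv fr; rewrite -level_green //.
have b0 : (0 < ball_size l)%N by exact: leq_ltn_trans (ball_size_gt l).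
rewrite big_ltn // big_nat big1 ?addr0.
  by rewrite (fr 0%N) // mulr0 addr0 bfs0.
by move=> n /andP[n0 nl]; rewrite fr // fv ?n0 // !mulr0 addr0.
Qed.

Lemma level_flux (f : G v -> R) l :
  harmonic_inside f ->
  (forall n, (0 < n < ball_size l)%N -> laplacian f (br (inl (v n))) = 0) ->
  (forall n, (n < ball_size l)%N -> laplacian f (br (inr n)) = 0) ->
  laplacian f (G_root v) = slope f (RayEdge (ball_size l)) +
    level_sum l (fun t i => slope f (TreeEdge t i)).
Proof.
move=> hf fv fr; have := level_green_root (fun=> 1) hf fv fr.
rewrite !mul1r => ->; rewrite /edge_form /jump subrr.
rewrite [X in _ - (X + _)]big1 => [|n _]; last by rewrite !mul0r addr0.
rewrite [X in _ - (_ + X)]big1 => [|n _]; last first.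
  by rewrite /level_sum big1 // => t _; rewrite big1 // => i _; rewrite mul0r.
rewrite addr0 subr0; congr (_ + _); apply: eq_bigr => t _; apply: eq_bigr => i _.
by rewrite mul1r.
Qed.

Lemma ler_level_sum l F F' :
  (forall t i, size t = l -> F t i <= F' t i) ->
  level_sum l F <= level_sum l F'.
Proof.
move=> FF; rewrite /level_sum big_seq [leRHS]big_seq.
apply: ler_sum => t; rewrite mem_words => /eqP tl.
by apply: ler_sum => i _; exact: FF.
Qed.

Lemma level_sum_const l c : level_sum l (fun _ _ => c) = (3 ^ l.+1)%:R * c.
Proof.
rewrite /level_sum; under eq_bigr do rewrite sumr_const card_ord.
by rewrite big_const_seq count_predT size_words iter_addr_0 -mulrnA -expnS mulr_natl.
Qed.

Lemma level_sumD l F F' :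
  level_sum l (fun t i => F t i + F' t i) = level_sum l F + level_sum l F'.
Proof.
by rewrite /level_sum -big_split; apply: eq_bigr => t _; rewrite -big_split.
Qed.

Lemma level_sumZ l c F :
  level_sum l (fun t i => c * F t i) = c * level_sum l F.
Proof.
by rewrite /level_sum mulr_sumr; apply: eq_bigr => t _; rewrite mulr_sumr.
Qed.

Lemma ler_norm_level_sum l F :
  `|level_sum l F| <= level_sum l (fun t i => `|F t i|).
Proof.
apply: le_trans (ler_norm_sum _ _ _) _; apply: ler_sum => t _.
exact: ler_norm_sum.
Qed.

Definition D (l : nat) : nat := 3 ^ 3 ^ l.

Lemma D_gt0 l : (0 < D l)%N. Proof. by rewrite expn_gt0. Qed.

Lemma DS l : D l.+1 = (D l ^ 3)%N.
Proof. by rewrite /D expnS mulnC expnM. Qed.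

Lemma D_mono j l : (j <= l)%N -> (D j <= D l)%N.
Proof. by move=> jl; rewrite /D !leq_exp2l. Qed.

Lemma D_ge l : (3 ^ l.+1 <= D l)%N.
Proof. by rewrite /D leq_exp2l //; have := leq_pow3 l; lia. Qed.

Lemma D_ge2 l : (3 ^ l.+1 * 3 ^ l <= D l)%N.
Proof. by rewrite -expnD /D leq_exp2l //; have := leq_pow3 l; lia. Qed.

(** The number of paths leaving level [l] times the typical slope [D l / D l.+1] produced by values
    of order [D l]. *)
Definition level_delta (l : nat) : R := (3 ^ l.+1)%:R / (D l)%:R ^+ 2.

Lemma DR_gt0 l : 0 < (D l)%:R :> R. Proof. by rewrite ltr0n D_gt0. Qed.

Lemma delta_decr l : level_delta l.+1 <= level_delta l.
Proof.
have d0 := DR_gt0 l; have d1 := DR_gt0 l.+1.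
rewrite /level_delta ler_pdivrMr ?exprn_gt0 // mulrAC ler_pdivlMr ?exprn_gt0 //.
have D3 : (3 <= D l)%N.
  by apply: leq_trans (D_ge l); rewrite expnS leq_pmulr // expn_gt0.
have D6 : (3 * D l ^ 2 <= D l.+1 ^ 2)%N.
  rewrite DS -expnM (_ : 3 * 2 = 1 + (3 + 2))%N // expnD expn1 leq_mul //.
  by rewrite expnD leq_pmull // expn_gt0 D_gt0.
by rewrite -!natrX -!natrM ler_nat [(3 ^ l.+2)%N]expnS -mulnA mulnCA leq_mul2l D6 orbT.
Qed.

Lemma delta_D l : (D l)%:R * level_delta l <= (3 ^ l)%:R^-1.
Proof.
have d0 := DR_gt0 l.
have -> : (D l)%:R * level_delta l = (3 ^ l.+1)%:R / (D l)%:R.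
  by rewrite /level_delta; field; rewrite gt_eqF.
rewrite ler_pdivrMr // ler_pdivlMl ?ltr0n ?expn_gt0 // -natrM ler_nat mulnC.
exact: D_ge2.
Qed.

Lemma delta_le l : level_delta l <= (3 ^ l)%:R^-1.
Proof.
apply: le_trans (delta_D l); rewrite ler_peMl ?ler1n ?D_gt0 //.
by rewrite /level_delta divr_ge0 // exprn_ge0.
Qed.

End Flow.

(** * The potential is almost carried by the ray *)

Section PotentialEstimates.
Context {R : realType} (v : bfs_enumeration).

Notation src := branch_src.
Notation tgt := (branch_tgt v).
Notation len := (branch_len v).
Notation br := (branch v).
Notation root := (G_root v).
Notation delta := (@level_delta R).
Notation DR l := ((D l)%:R : R).

Lemma bfs_neq_root n : (0 < n)%N -> v n <> [::].
Proof.
move=> n0; rewrite -(bfs0 v) => /(bij_inj (bfs_bij v)) E.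
by rewrite E in n0.
Qed.

(** * Currents of a potential through the levels *)

Section OnePotential.
Variable h : G v -> R.
Hypothesis pot : potential root h.

Lemma pot_inside : harmonic_inside h.
Proof. by case: pot => _ _ _ lap e j; apply: lap. Qed.

Lemma pot_word n : (0 < n)%N -> laplacian h (br (inl (v n))) = 0.
Proof.
move=> n0; case: pot => _ _ _ lap; apply: lap.
by apply/eqP => -[]; exact: bfs_neq_root.
Qed.

Lemma pot_ray n : laplacian h (br (inr n)) = 0.
Proof. by case: pot => _ _ _ lap; apply: lap. Qed.

Lemma slope_le1 e : `|slope h e| <= 1.
Proof.
have l0 := branch_len_gt0 v e.
rewrite -(slope_pair pot_inside l0) ler_norml.
have lip := potential_lipschitz (@G_cutoffs R v) pot.
have a0 := at_edge_adj l0; rewrite lip // andbT.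
by have := lip _ _ (etrans (adj_sym _ _) a0); lra.
Qed.

Lemma pot_slope e :
  h (br (tgt e)) = h (br (src e)) + (len e)%:R * slope h e.
Proof. by rewrite /slope mulrC divfK ?len_neq0 // addrC subrK. Qed.

Lemma pot_ray_le n : h (br (ray_vertex n)) <= n%:R.
Proof.
elim: n => [|n IH]; first by case: pot => _ -> _ _.
have := pot_slope (RayEdge n); rewrite mul1r [tgt _]/= => ->.
have := slope_le1 (RayEdge n); rewrite ler_norml => /andP[_ s1].
by rewrite -natr1 lerD.
Qed.

(** The word is reached along the ray and then its link, each of length at most [D l], with slopes
    at most 1. *)
Lemma pot_word_le l t : (size t <= l)%N -> h (br (inl t)) <= 2 * DR l.
Proof.
have [w vK wK] := bfs_bij v; rewrite -(wK t); move: (w t) => n nl.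
have nb : (n < ball_size l)%N by rewrite -(bfs_ballE v).
have := slope_le1 (LinkEdge n); rewrite ler_norml => /andP[_ s1].
have := pot_slope (LinkEdge n); rewrite [tgt _]/= => ->.
have h1 := pot_ray_le n.+1.
have h2 : (len (LinkEdge n))%:R <= DR l by rewrite ler_nat D_mono.
have h3 : n.+1%:R <= DR l.
  rewrite ler_nat (leq_trans nb) // (leq_trans _ (D_ge l)) // ltnW //.
  exact: ball_size_lt.
have h4 : (len (LinkEdge n))%:R * slope h (LinkEdge n) <= (len (LinkEdge n))%:R.
  by rewrite -[leRHS]mulr1 ler_wpM2l.
have : h (br (src (LinkEdge n))) <= n.+1%:R by [].
lra.
Qed.

Lemma pot_ge0 x : 0 <= h x. Proof. by case: pot. Qed.

Lemma tree_slopeE t i :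
  slope h (TreeEdge t i) = (h (br (inl (i :: t))) - h (br (inl t))) /
    DR (size t).+1.
Proof. by []. Qed.

Lemma DR_S l : DR l.+1 = DR l ^+ 3.
Proof. by rewrite DS natrX. Qed.

Lemma DR0 l : 0 < DR l. Proof. exact: DR_gt0. Qed.

Lemma pot_over_D t : h (br (inl t)) / DR (size t).+1 <= 2 / DR (size t) ^+ 2.
Proof.
have d0 := DR0 (size t).
rewrite DR_S ler_pdivrMr ?exprn_gt0 //.
have -> : 2 / DR (size t) ^+ 2 * DR (size t) ^+ 3 = 2 * DR (size t).
  by field; rewrite gt_eqF.
exact: pot_word_le.
Qed.

Lemma tree_slope_ge t i : - (2 / DR (size t) ^+ 2) <= slope h (TreeEdge t i).
Proof.
rewrite tree_slopeE mulrBl; have := pot_over_D t.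
have : 0 <= h (br (inl (i :: t))) / DR (size t).+1.
  by rewrite divr_ge0 ?pot_ge0.
lra.
Qed.

Definition total_slope l : R :=
  level_sum l (fun t i => `|slope h (TreeEdge t i)|).

Lemma delta_ge0 l : 0 <= delta l.
Proof. by rewrite /level_delta divr_ge0 // exprn_ge0. Qed.

Lemma level_sum_delta l c :
  level_sum l (fun _ _ => c / DR l ^+ 2) = c * delta l.
Proof. by rewrite level_sum_const /level_delta mulrCA mulrA. Qed.

Lemma pot_flux l : 1 = slope h (RayEdge (ball_size l)) +
    level_sum l (fun t i => slope h (TreeEdge t i)).
Proof.
case: (pot) => _ _ <- _; apply: level_flux.
- exact: pot_inside.
- by move=> n /andP[n0 _]; exact: pot_word.
- by move=> n _; exact: pot_ray.
Qed.

(** Slopes are bounded below through [0 <= h], so absolute values differ from signed values by at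
    most [4 / D l ^ 2]. The signed sum is at most 2, the total flux being 1 and the exit slope at
    least -1. *)
Lemma total_slope_bounded l : total_slope l <= 6.
Proof.
have H : total_slope l <= level_sum l (fun t i =>
    slope h (TreeEdge t i) + 4 / DR l ^+ 2).
  apply: ler_level_sum => t i <-; have := tree_slope_ge t i.
  have : 0 <= 2 / DR (size t) ^+ 2 by rewrite divr_ge0 // exprn_ge0.
  case: ler0P; lra.
apply: le_trans H _; rewrite level_sumD level_sum_delta.
have := pot_flux l; have := slope_le1 (RayEdge (ball_size l)).
rewrite ler_norml => /andP[? _].
have : delta l <= 1.
  apply: le_trans (delta_le l) _.
  by rewrite invf_le1 ?ltr0n ?expn_gt0 // ler1n expn_gt0.
lra.
Qed.

(* The current that a word receives from its children splits almost evenly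
   between its parent and the ray. *)
Lemma total_slope_rec l : 2 * total_slope l <= total_slope l.+1 + 3 * delta l.
Proof.
rewrite {2}/total_slope /level_sum sum_words -/(level_sum l _).
rewrite -level_sum_delta -level_sumD -level_sumZ; apply: ler_level_sum => t i tl.
have [w vK wK] := bfs_bij v.
set t' := i :: t; set m := w t'.
have m0 : (0 < m)%N.
  by rewrite lt0n; apply/eqP => E; have := wK t'; rewrite -/m E bfs0.
have := pot_word m0; rewrite laplacian_word; last exact: pot_inside.
rewrite /m wK /= => E.
have d0 := DR0 l.
(* The two paths ending at the word have the same length, so their slopes differ only through the
   values at their sources. *)
have lkE : slope h (LinkEdge m) = slope h (TreeEdge t i) +
    (h (br (inl t)) - h (br (inr m))) / DR l.+1.
  rewrite tree_slopeE /slope /= wK -tl /= -/(D (size t).+1) -mulrDl.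
  by congr (_ / _); rewrite addrA subrK.
have r3 : `|(h (br (inl t)) - h (br (inr m))) / DR l.+1| <= 3 / DR l ^+ 2.
  rewrite normrM [X in _ * X]ger0_norm ?invr_ge0 // DR_S.
  rewrite ler_pdivrMr ?exprn_gt0 //.
  have -> : 3 / DR l ^+ 2 * DR l ^+ 3 = 3 * DR l by field; rewrite gt_eqF.
  have h1 : h (br (inl t)) <= 2 * DR l by apply: pot_word_le; rewrite tl.
  have h2 : h (br (inr m)) <= 3 * DR l.
    apply: le_trans (pot_ray_le m.+1) _; rewrite -natrM ler_nat.
    have mb : (m < ball_size l.+1)%N by rewrite -(bfs_ballE v) wK /= tl.
    apply: leq_trans mb _; apply: leq_trans (ltnW (ball_size_lt _)) _.
    by rewrite expnS leq_mul2l D_ge.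
  have := pot_ge0 (br (inl t)); have := pot_ge0 (br (inr m)).
  rewrite ler_norml => ? ?; apply/andP; split; lra.
have : `|\sum_j slope h (TreeEdge t' j)| <=
    \sum_j `|slope h (TreeEdge t' j)| by exact: ler_norm_sum.
move: r3 E; rewrite -/m lkE.
set S := \sum_j _; set s := slope _ _.
rewrite !ler_norml => /andP[? ?] E /andP[? ?].
case: (ler0P s); lra.
Qed.

(** The recursion halves the crude bound 6 with every level at which it is started further out;
    [delta] decreasing keeps the error at [3 * delta j]. *)
Lemma total_slope_le l : total_slope l <= 3 * delta l.
Proof.
have H k j : total_slope j <= 3 * delta j + 6 / 2 ^+ k.
  elim: k j => [|k IH] j.
    rewrite expr0 divr1; have := total_slope_bounded j; have := delta_ge0 j; lra.
  have := total_slope_rec j; have := IH j.+1; have := @delta_decr R j.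
  rewrite exprS invfM; set q := _^-1; lra.
apply/ler_addgt0Pr => e e0.
pose k := Num.truncn (6 / e).
apply: le_trans (H k l) _; rewrite lerD2l ler_pdivrMr ?exprn_gt0 //.
rewrite mulrC -ler_pdivrMr // (le_trans (ltW (truncnS_gt _))) //.
by rewrite -natrX ler_nat ltn_expl.
Qed.

(* The ray vertex at the exit of the ball carries no inflow, so all of it comes
   through the tree. *)
Lemma escape_le (w : G v -> R) l :
  (forall x, 0 <= w x <= h x) -> w (br (ray_vertex (ball_size l).+1)) = 0 ->
  (forall x, x != root -> x != br (ray_vertex (ball_size l).+1) ->
    laplacian w x = 0) ->
  laplacian w root <= 5 * (3 ^ l)%:R^-1.
Proof.
move=> wh wr lap; have w0 x : 0 <= w x by case/andP: (wh x).
have hw : harmonic_inside w by move=> e j; exact: lap.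
rewrite (@level_flux R v w l hw); first last.
- by move=> n nl; apply: lap => //; apply/eqP => -[] E; rewrite E ltnn in nl.
- move=> n /andP[n0 _]; apply: lap => //.
  by apply/eqP => -[]; exact: bfs_neq_root.
apply: (@le_trans _ _ (5 * delta l)); last first.
  by rewrite ler_pM2l // delta_le.
have : slope w (RayEdge (ball_size l)) <= 0.
  rewrite /slope [tgt _]/= wr sub0r divr1 oppr_le0; exact: w0.
have := total_slope_le l.
(* From [0 <= w <= h], a slope of [w] is at most the value of [h] at the child over the length, that
   is, the slope of [h] plus a term bounded by [pot_over_D]. *)
have : level_sum l (fun t i => slope w (TreeEdge t i)) <=
    total_slope l + 2 * delta l.
  rewrite -level_sum_delta -level_sumD; apply: ler_level_sum => t i tl.
  have -> : slope w (TreeEdge t i) =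
    (w (br (inl (i :: t))) - w (br (inl t))) / DR (size t).+1 by [].
  have D0 := DR0 (size t).+1.
  have s1 : (w (br (inl (i :: t))) - w (br (inl t))) / DR (size t).+1 <=
      h (br (inl (i :: t))) / DR (size t).+1.
    rewrite ler_pM2r ?invr_gt0 //.
    by have /andP[_ ?] := wh (br (inl (i :: t))); have := w0 (br (inl t)); lra.
  have s2 := pot_over_D t.
  have s3 := ler_norm (slope h (TreeEdge t i)).
  rewrite [leLHS]tree_slopeE [leLHS]mulrBl in s3; rewrite -tl; lra.
lra.
Qed.

End OnePotential.

(** The difference is harmonic everywhere, so its energy in a ball is a boundary term: values of
    order [D l] times currents of order [delta l]. *)
Theorem potential_unique (h1 h2 : G v -> R) :
  potential root h1 -> potential root h2 -> h1 = h2.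
Proof.
move=> p1 p2; pose g x := h1 x - h2 x.
have lapg x : laplacian g x = laplacian h1 x - laplacian h2 x.
  by rewrite !laplacianE -sumrB; apply: eq_bigr => y _; rewrite /g; ring.
have lap0 x : laplacian g x = 0.
  rewrite lapg; have [_ _ l1 m1] := p1; have [_ _ l2 m2] := p2.
  by have [->|xo] := eqVneq x root; rewrite ?l1 ?l2 ?m1 ?m2 // subrr.
have hg : harmonic_inside g by move=> e j; exact: lap0.
have sg e : slope g e = slope h1 e - slope h2 e.
  by rewrite /slope /g -mulrBl; congr (_ / _); ring.
pose b s := g (br s).
have jumpE e : jump v b e * slope g e = (len e)%:R * slope g e ^+ 2.
  by rewrite expr2 mulrA; congr (_ * _); rewrite /slope mulrC divfK ?len_neq0.
have sq0 e : 0 <= jump v b e * slope g e.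
  by rewrite jumpE mulr_ge0 // sqr_ge0.
have g0 : g root = 0.
  by rewrite /g; have [_ -> _ _] := p1; have [_ -> _ _] := p2; rewrite subrr.
(* The unit fluxes cancel, so the current of [g] through the exit edge is as small as that through
   the tree. *)
have flux l : slope g (RayEdge (ball_size l)) =
    - level_sum l (fun t i => slope g (TreeEdge t i)).
  have := @level_flux R v g l hg (fun _ _ => lap0 _) (fun _ _ => lap0 _).
  rewrite lap0; lra.
have tg l : level_sum l (fun t i => `|slope g (TreeEdge t i)|) <= 6 * delta l.
  have := total_slope_le p1 l; have := total_slope_le p2 l.
  suff : level_sum l (fun t i => `|slope g (TreeEdge t i)|) <=
    total_slope h1 l + total_slope h2 l by lra.
  rewrite -level_sumD; apply: ler_level_sum => t i _; rewrite sg.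
  exact: ler_normB.
have g_word l t : (size t <= l)%N -> `|g (br (inl t))| <= 2 * DR l.
  move=> tl; rewrite /g.
  have := pot_word_le p1 tl; have := pot_word_le p2 tl.
  have := pot_ge0 p1 (br (inl t)); have := pot_ge0 p2 (br (inl t)).
  by move=> *; rewrite ler_norml; apply/andP; split; lra.
have g_ray l : `|g (br (ray_vertex (ball_size l)))| <= DR l.
  have bD : (ball_size l)%:R <= DR l.
    by rewrite ler_nat (leq_trans (ltnW (ball_size_lt l))) // D_ge.
  rewrite /g; have := pot_ray_le p1 (ball_size l).
  have := pot_ray_le p2 (ball_size l).
  have := pot_ge0 p1 (br (ray_vertex (ball_size l))).
  have := pot_ge0 p2 (br (ray_vertex (ball_size l))).
  by move=> *; rewrite ler_norml; apply/andP; split; lra.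
have form_le l : edge_form b g l <= 18 * (3 ^ l)%:R^-1.
  have := @level_green_root R v b g l hg (fun _ _ => lap0 _) (fun _ _ => lap0 _).
  rewrite lap0 mulr0; set B1 := b _ * _; set B2 := level_sum _ _ => E.
  have d0 := DR0 l; have del0 := delta_ge0 l.
  have b1 : `|B1| <= 6 * (DR l * delta l).
    rewrite /B1 normrM (_ : 6 * _ = DR l * (6 * delta l)); last by ring.
    apply: ler_pM => //; first exact: g_ray.
    rewrite flux normrN; apply: le_trans (ler_norm_level_sum _ _) _.
    exact: tg.
  have b2 : `|B2| <= 12 * (DR l * delta l).
    apply: le_trans (ler_norm_level_sum _ _) _.
    rewrite (_ : 12 * _ = 2 * DR l * (6 * delta l)); last by ring.
    apply: (@le_trans _ _ (2 * DR l *
      level_sum l (fun t i => `|slope g (TreeEdge t i)|))).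
      rewrite -level_sumZ; apply: ler_level_sum => t i tl; rewrite normrM.
      by apply: ler_pM => //; apply: g_word; rewrite tl.
    by rewrite ler_wpM2l ?tg // mulr_ge0 // ltW.
  have := @delta_D R l.
  move: b1 b2; rewrite !ler_norml => /andP[? ?] /andP[? ?]; lra.
have small (c : R) : (forall l, exists2 m, (l <= m)%N & c <= 18 * (3 ^ m)%:R^-1) ->
    c <= 0.
  move=> H; apply/ler_addgt0Pr => e e0; rewrite add0r.
  have [m lm] := H (Num.truncn (18 / e)).
  move=> cm; apply: le_trans cm _.
  rewrite ler_pdivrMr ?ltr0n ?expn_gt0 // mulrC -ler_pdivrMr //.
  apply: le_trans (ltW (truncnS_gt _)) _; rewrite ler_nat.
  by apply: leq_ltn_trans lm _; exact: ltn_expl.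
have level_sum_ge0 j (F : ternary -> 'I_3 -> R) : (forall t i, 0 <= F t i) ->
    0 <= level_sum j F.
  by move=> F0; apply: sumr_ge0 => t _; exact: sumr_ge0.
have part1_ge0 m : 0 <= \sum_(0 <= n < ball_size m) (jump v b (RayEdge n) *
    slope g (RayEdge n) + jump v b (LinkEdge n) * slope g (LinkEdge n)).
  by apply: sumr_ge0 => n _; rewrite addr_ge0.
have part2_ge0 m : 0 <= \sum_(0 <= j < m) level_sum j (fun t i =>
    jump v b (TreeEdge t i) * slope g (TreeEdge t i)).
  by apply: sumr_ge0 => j _; exact: level_sum_ge0.
(* The terms of the energy form are non-negative, so the square of one slope is bounded by the form
   at arbitrarily high levels. *)
have ray0 n : slope g (RayEdge n) = 0.
  apply/eqP; rewrite -sqrf_eq0 eq_le sqr_ge0 andbT; apply: small => l.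
  exists (maxn l n); first exact: leq_maxl.
  apply: le_trans (form_le _); rewrite /edge_form.
  apply: ler_wpDr => //.
  have nb : (n < ball_size (maxn l n))%N.
    by apply: leq_ltn_trans (leq_maxr l n) _; exact: ball_size_gt.
  rewrite (@big_cat_nat _ _ _ n) //=; last exact: ltnW.
  rewrite [X in _ + X]big_ltn // jumpE mul1r.
  rewrite addrCA -addrA lerDl !addr_ge0 // sumr_ge0 // => i _; rewrite addr_ge0 //.
have tree0 t i : slope g (TreeEdge t i) = 0.
  apply/eqP; rewrite -sqrf_eq0 eq_le sqr_ge0 andbT; apply: small => l.
  exists (maxn l (size t).+1); first exact: leq_maxl.
  apply: le_trans (form_le _); rewrite /edge_form.
  apply: ler_wpDl => //.
  have nb : (size t < maxn l (size t).+1)%N by exact: leq_maxr.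
  rewrite (@big_cat_nat _ _ _ (size t)) //=; last exact: ltnW.
  rewrite ler_wpDl //; rewrite big_ltn // ler_wpDr //.
    by apply: sumr_ge0 => j _; exact: level_sum_ge0.
  rewrite /level_sum (bigD1_seq t) ?words_uniq ?mem_words //=.
  rewrite ler_wpDr //; first by apply: sumr_ge0 => s _; exact: sumr_ge0.
  rewrite (bigD1 i) //= ler_wpDr //; first exact: sumr_ge0.
  rewrite jumpE ler_peMl ?sqr_ge0 // ler1n; exact: branch_len_gt0.
have slopeE e : slope g e = 0 -> g (br (tgt e)) = g (br (src e)).
  move=> s0; apply/eqP; rewrite -subr_eq0.
  by move/eqP: s0; rewrite mulf_eq0 invr_eq0 (negbTE (len_neq0 _ _)) orbF.
have gb s : g (br s) = 0.
  case: s => [t|n].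
    by elim: t => [//|i t IH]; rewrite -IH; exact: (slopeE _ (tree0 t i)).
  elim: n => [|n IH]; first by rewrite -g0; exact: (slopeE _ (ray0 0%N)).
  by rewrite -IH; exact: (slopeE _ (ray0 n.+1)).
apply/funext => x; apply/eqP; rewrite -subr_eq0 -/(g x); apply/eqP.
case: x => [s|[e j]]; first exact: gb.
have -> : inr (existT _ e j) = edge_vertex v e j.+1 by rewrite at_edge_in.
rewrite at_edge_linear // ?gb ?add0r; last first.
  by apply: leq_trans (ltn_ord j) _; exact: leq_pred.
by rewrite /slope !gb subrr mul0r mulr0.
Qed.

Theorem h_process_visits (h : G v -> R) (pot : potential root h)
    (d : measure_display) (Omega : measurableType d) (P : probability Omega R)
    (X : nat -> Omega -> h_state h) l : h_process root P X ->
  (P [set a | forall i, val (X i a) != br (ray_vertex (ball_size l).+1)] <=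
    (5 * (3 ^ l)%:R^-1)%:E)%E.
Proof.
move=> hp; have [w [wh wr lap H]] :=
  h_process_avoid pot (br (ray_vertex (ball_size l).+1)).
apply: le_trans (H _ _ _ _ hp) _; rewrite lee_fin.
exact: (escape_le pot wh wr lap).
Qed.

(** By a union bound at one high level, both processes visit the same exit vertex with probability
    close to 1. So the event that from some level on every exit vertex is missed by one of them is
    null. *)
Theorem h_processes_intersect (h : G v -> R) (pot : potential root h)
    (d : measure_display) (Omega : measurableType d) (P : probability Omega R)
    (X Y : nat -> Omega -> h_state h) :
  h_process root P X -> h_process root P Y ->
  {ae P, forall w, infinite_set (visited X w `&` visited Y w)}.
Proof.
move=> hX hY.
pose r l := br (ray_vertex (ball_size l).+1).
pose AX l := [set a | forall i, val (X i a) != r l].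
pose AY l := [set a | forall i, val (Y i a) != r l].
have mX l : measurable (AX l).
  exact: (path_event_measurable hX (fun=> [set x | val x != r l])).
have mY l : measurable (AY l).
  exact: (path_event_measurable hY (fun=> [set x | val x != r l])).
pose B l := \bigcap_(m in [set m | (l <= m)%N]) (AX m `|` AY m).
have mB l : measurable (B l).
  apply: bigcap_measurable => [|m _]; first by exists l => /=.
  exact: measurableU.
have B0 l : P (B l) = 0%E.
  apply/eqP; rewrite eq_le measure_ge0 andbT.
  apply/lee_addgt0Pr => e e0; rewrite add0e.
  pose m := maxn l (Num.truncn (10 / e)).
  apply: (@le_trans _ _ (P (AX m) + P (AY m))%E).
    have U2 : (P (AX m `|` AY m) <= P (AX m) + P (AY m))%E by exact: measureU2.
    apply: le_trans U2.
    apply: le_measure; rewrite ?inE //; first exact: measurableU.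
    by move=> w /(_ m); apply; exact: leq_maxl.
  have := h_process_visits pot m hX; have := h_process_visits pot m hY.
  move=> h1 h2; apply: le_trans (leeD h2 h1) _; rewrite -EFinD lee_fin.
  rewrite -mulrDl ler_pdivrMr ?ltr0n ?expn_gt0 // mulrC -ler_pdivrMr //.
  rewrite (_ : 5 + 5 = 10 :> R); last by ring.
  apply: le_trans (ltW (truncnS_gt _)) _; rewrite ler_nat.
  by apply: leq_ltn_trans (leq_maxr l _) _; exact: ltn_expl.
have : P.-negligible (\bigcup_l B l).
  by apply: negligible_bigcup => l; exists (B l); split; [exact: mB|exact: B0|move=> x].
apply: negligibleS => w /= H; apply: contrapT => nB; apply: H => fin.
have inj : injective (fun l => ray_vertex (ball_size l).+1).
  move=> l m [] E; apply/eqP; rewrite eqn_leq.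
  have mono a c : (a < c)%N -> (ball_size a < ball_size c)%N.
    move=> ac; apply: leq_trans (ball_size_mono ac).
    by rewrite ball_sizeS -addn1 leq_add2l expn_gt0.
  by apply/andP; split; rewrite leqNgt; apply/negP => /mono; rewrite E ltnn.
have fin' : finite_set (r @^-1` (val @` (visited X w `&` visited Y w))).
  apply: finite_preimage (finite_image val fin).
  by move=> l m _ _ [E]; apply: inj; rewrite /= E.
have [M MP] : exists M, forall l,
    (exists2 x : h_state h, (visited X w `&` visited Y w) x & val x = r l) ->
    (l < M)%N.
  have /finite_seqP[s sE] := fin'.
  exists (\max_(l <- s) l).+1 => l Hl; rewrite ltnS.
  have : [set` s] l by rewrite -sE.
  by move=> ls; exact: leq_bigmax_seq.
apply: nB; exists M => // m /= Mm; apply: contrapT => /not_orP[nX nY].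
move/existsNP: nX => [i /negP/negPn/eqP Xi].
move/existsNP: nY => [j /negP/negPn/eqP Yj].
have /= := MP m; rewrite ltnNge Mm => H; suff : false by []; apply: H.
exists (X i w) => //; split; first by exists i.
by exists j; apply: val_inj; rewrite Xi Yj.
Qed.

End PotentialEstimates.

(** * Exchanging edges of spanning trees *)

Section Relations.
Context {V : eqType}.
Implicit Types (r : rel V) (a b x y : V) (p : seq V).

Definition same_edge a b : rel V :=
  fun x y => (x == a) && (y == b) || (x == b) && (y == a).

Definition del r a b : rel V := fun x y => r x y && ~~ same_edge a b x y.

Definition add r a b : rel V := fun x y => r x y || same_edge a b x y.

Lemma same_edge_sym a b : symmetric (same_edge a b).
Proof.
by move=> x y; rewrite /same_edge orbC; congr (_ || _); rewrite andbC.
Qed.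

Lemma same_edgeC a b : same_edge a b =2 same_edge b a.
Proof. by move=> x y; rewrite /same_edge orbC. Qed.

Lemma same_edge_inv a b x y : same_edge a b x y = same_edge x y a b.
Proof.
by rewrite /same_edge ![a == _]eq_sym ![b == _]eq_sym [(y == a) && _]andbC.
Qed.

Lemma same_edgexx a b : same_edge a b a b.
Proof. by rewrite /same_edge !eqxx. Qed.

Lemma del_sym r a b : symmetric r -> symmetric (del r a b).
Proof. by move=> rs x y; rewrite /del rs same_edge_sym. Qed.

Lemma add_sym r a b : symmetric r -> symmetric (add r a b).
Proof. by move=> rs x y; rewrite /add rs same_edge_sym. Qed.

Lemma sub_linked r r' x y : subrel r r' -> linked r x y -> linked r' x y.
Proof.
move=> rr' [p pp lp]; exists p => //; exact: sub_path pp.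
Qed.

Lemma eq_linked r r' x y : r =2 r' -> linked r x y -> linked r' x y.
Proof. by move=> rr'; apply: sub_linked => a b; rewrite rr'. Qed.

Lemma eq_acyclic r r' : r =2 r' -> acyclic r -> acyclic r'.
Proof. by move=> rr' ac c cc; apply: ac; rewrite (eq_cycle rr'). Qed.

Lemma linked_uniq r x y : linked r x y ->
  exists p, [/\ path r x p, last x p = y & uniq (x :: p)].
Proof. by case=> p pp <-; case/shortenP: pp => p' pp' up' _; exists p'. Qed.

Lemma map_linked (W : eqType) r (r' : rel W) (f : V -> W) x y :
  (forall u w, r u w -> f u = f w \/ r' (f u) (f w)) ->
  linked r x y -> linked r' (f x) (f y).
Proof.
move=> H [p]; elim: p x => [|z p IH] x /=; first by move=> _ ->; exact: linked_refl.
case/andP=> xz pp lp; have {}IH := IH _ pp lp.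
by case: (H _ _ xz) => [->//|fxz]; exact: linked_trans (linked_edge fxz) IH.
Qed.

Lemma linked_steps r r' x y :
  (forall u w, r u w -> linked r' u w) -> linked r x y -> linked r' x y.
Proof.
move=> H [p]; elim: p x => [|z p IH] x /=; first by move=> _ ->; exact: linked_refl.
by case/andP=> xz pp lp; exact: linked_trans (H _ _ xz) (IH _ pp lp).
Qed.

Lemma del_path r x y z p : y \notin z :: p -> path r z p -> path (del r x y) z p.
Proof.
elim: p z => [//|u p IH] z /=; rewrite !inE !negb_or => /and3P[yz yu yp].
case/andP=> zu pp; rewrite IH ?inE ?negb_or ?yu // andbT /del zu /same_edge.
by rewrite [u == y]eq_sym [z == y]eq_sym (negbTE yz) (negbTE yu) andbF.
Qed.

Lemma delC r x y : del r x y =2 del r y x.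
Proof. by move=> u w; rewrite /del same_edgeC. Qed.

Lemma first_bad_step r (q : rel V) x p : path r x p ->
  path (fun u w => r u w && ~~ q u w) x p \/
  exists p1 y p2, p = p1 ++ y :: p2 /\ q (last x p1) y.
Proof.
elim: p x => [|y p IH] x /=; first by left.
case/andP=> xy /IH[pp|[p1 [z [p2 [-> qz]]]]]; last first.
  by right; exists (y :: p1), z, p2.
have [qxy|nq] := boolP (q x y); first by right; exists [::], y, p.
by left; rewrite xy.
Qed.

Lemma split_path r a p1 y p2 : path r a (p1 ++ y :: p2) ->
  uniq (a :: p1 ++ y :: p2) ->
  [/\ r (last a p1) y, linked (del r (last a p1) y) a (last a p1) &
      linked (del r (last a p1) y) y (last y p2)].
Proof.
rewrite -cat_cons cat_uniq cat_path => /andP[pp1 /= /andP[xy pp2]].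
case/and3P=> u1 ; rewrite negb_or => /andP[y1 /hasPn h2] u2.
split=> //.
  by exists p1 => //; apply: del_path.
exists p2 => //; rewrite (eq_path (delC r _ _)); apply: del_path => //.
rewrite inE negb_or; apply/andP; split.
  by apply: contraNneq y1 => <-; exact: mem_last.
by apply/negP => /h2 /negP; apply; exact: mem_last.
Qed.

Lemma acyclic_edge r a b : symmetric r -> a != b -> acyclic r -> r a b ->
  ~ linked (del r a b) a b.
Proof.
move=> rs ab ac rab /linked_uniq[p [pp lp up]].
have := ac (a :: p) _ up; rewrite /cycle rcons_path lp rs rab andbT.
have sub : subrel (del r a b) r by move=> u w /andP[].
move=> /(_ (sub_path sub pp)); case: p pp lp {up} => [|z [|z' p]] //= pp lp _.
  by rewrite lp eqxx in ab.
by move: pp; rewrite lp /del same_edgexx andbF.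
Qed.

(** The rest of a cycle of length at least 3 links the ends of its first edge without that edge. *)
Lemma acyclicP r : (forall a b, r a b -> ~ linked (del r a b) a b) ->
  symmetric r -> acyclic r.
Proof.
move=> H rs [|x [|y [|z s]]] //= /and3P[xy yz ps].
rewrite !inE !negb_or => /and4P[/and3P[xy' xz xs] /andP[yz' ys] zs us].
case: (H _ _ xy); apply: linked_sym; first exact: del_sym.
exists (z :: rcons s x); last by rewrite /= last_rcons.
rewrite /= {1}/del yz /same_edge (eq_sym z x) (negbTE xz) (eq_sym y x).
rewrite (negbTE xy') andbF /=; apply: del_path ps.
by rewrite inE mem_rcons inE !negb_or yz' (eq_sym y x) xy'.
Qed.

(** The simple path from [a] to [b] in a forest is unique: an edge whose deletion leaves them linked
    is not on it, so all such edges can be deleted together. *)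
Lemma acyclic_del_all r (q : rel V) a b : symmetric r -> irreflexive r ->
  acyclic r -> linked r a b ->
  (forall x y, r x y -> q x y -> linked (del r x y) a b) ->
  linked (fun x y => r x y && ~~ q x y) a b.
Proof.
move=> rs ri ac /linked_uniq[p [pp <- up]] H.
have [pq|[p1 [y [p2 [pE qy]]]]] := first_bad_step q pp; first by exists p.
move: pp up H; rewrite pE => pp up H; have [xy l1 l2] := split_path pp up.
have := H _ _ xy qy; rewrite last_cat /= => l3.
have xNy : last a p1 != y by apply: contraTneq xy => ->; rewrite ri.
case: (acyclic_edge rs xNy ac xy).
have ds := del_sym (last a p1) y rs.
apply: linked_trans (linked_sym ds l1) _.
exact: linked_trans l3 (linked_sym ds l2).
Qed.

Lemma linked_through r x y a b : symmetric r -> linked r a b ->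
  ~ linked (del r x y) a b ->
  r x y /\ (linked (del r x y) a x /\ linked (del r x y) y b \/
            linked (del r x y) a y /\ linked (del r x y) x b).
Proof.
move=> rs /linked_uniq[p [pp <- up]] nl.
have [pq|[p1 [z [p2 [pE qz]]]]] := first_bad_step (same_edge x y) pp.
  by case: nl; exists p.
move: pp up nl; rewrite pE last_cat /= => pp up nl.
have [xy l1 l2] := split_path pp up.
case/orP: qz => /andP[/eqP xE /eqP zE]; rewrite xE zE in xy l1 l2 *.
  by split=> //; left.
split; first by rewrite rs.
by right; split; apply: eq_linked (delC r _ _) _.
Qed.

Section Exchange.
Variables (r : rel V) (x y a b : V).
Hypotheses (rs : symmetric r) (nl : ~ linked (del r x y) a b).

Definition exchange : rel V := add (del r x y) a b.

Lemma exchange_sym : symmetric exchange.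
Proof. exact/add_sym/del_sym. Qed.

Lemma exchange_linked u w : linked r a b -> linked r u w -> linked exchange u w.
Proof.
move=> lab luw; have ds := del_sym x y rs.
have sub c d : linked (del r x y) c d -> linked exchange c d.
  by apply: sub_linked => ? ? h; rewrite /exchange /add h.
have ab : linked exchange a b.
  by apply: linked_edge; rewrite /exchange /add same_edgexx orbT.
have xy : linked exchange x y.
  have [_ [[l1 l2]|[l1 l2]]] := linked_through rs lab nl.
    apply: linked_trans (sub _ _ (linked_sym ds l1)) _.
    exact: linked_trans ab (sub _ _ (linked_sym ds l2)).
  apply: linked_trans (sub _ _ l2) _.
  apply: linked_trans (linked_sym exchange_sym ab) (sub _ _ l1).
apply: linked_steps luw => c d rcd.
have [/orP[|]|ncd] := boolP (same_edge x y c d).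
- by case/andP=> /eqP -> /eqP ->.
- by case/andP=> /eqP -> /eqP ->; exact: linked_sym exchange_sym xy.
by apply: linked_edge; rewrite /exchange /add /del rcd ncd.
Qed.

Lemma exchange_acyclic : irreflexive r -> acyclic r -> acyclic exchange.
Proof.
move=> ri ac; apply: acyclicP; last exact: exchange_sym.
move=> c d ecd lcd; have ds := del_sym x y rs.
have [abcd|nab] := boolP (same_edge a b c d).
  have : linked (del r x y) c d.
    apply: sub_linked lcd => u w /andP[/orP[//|h1] /negP[]].
    case/orP: abcd => /andP[/eqP -> /eqP ->] //.
    by rewrite same_edgeC.
  case/orP: abcd => /andP[/eqP -> /eqP ->] // lba.
  by apply: nl; exact: linked_sym ds lba.
have rcd : del r x y c d by move: ecd; rewrite /exchange /add (negbTE nab) orbF.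
have [rcd' _] := andP rcd.
have cd : c != d by apply: contraTneq rcd' => ->; rewrite ri.
pose s := del (del r x y) c d.
have ss : symmetric s by exact: del_sym.
have nscd : ~ linked s c d.
  move=> lscd; apply: (acyclic_edge rs cd ac rcd').
  by apply: sub_linked lscd => u w /andP[/andP[h1 _] h2]; rewrite /del h1.
have es : symmetric (del exchange c d) by exact/del_sym/exchange_sym.
have sub : subrel (del (del exchange c d) a b) s.
  move=> u w /andP[/andP[/orP[h1|h1] h2] h3]; first by rewrite /s /del h2 andbT.
  by rewrite h1 in h3.
(* [c d] is a bridge of [r], so a cycle through it must use [a b]; the rest of that cycle would link
   [a] and [b] in [del r x y]. *)
have nl2 : ~ linked (del (del exchange c d) a b) c d.
  by move/(sub_linked sub).
have sdel : subrel s (del r x y) by move=> u w /andP[].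
have up u w : linked s u w -> linked (del r x y) u w by exact: sub_linked.
have [_ [[l1 l2]|[l1 l2]]] := linked_through es lcd nl2.
  apply: nl; have m1 := linked_sym ds (up _ _ (sub_linked sub l1)).
  exact: linked_trans m1 (linked_trans (linked_edge rcd)
    (linked_sym ds (up _ _ (sub_linked sub l2)))).
apply: nl; have m1 := up _ _ (sub_linked sub l2).
apply: linked_trans m1 _.
apply: linked_trans (linked_sym ds (linked_edge rcd)) _.
exact: (up _ _ (sub_linked sub l1)).
Qed.

End Exchange.
End Relations.

(** * Counting spanning trees of a finite subgraph by exchanges *)

Section SpanningTrees.
Context {G : graph}.
Variable H : finite_subgraph G.
Implicit Types (T : {fset G * G}) (P Q : set {fset G * G}).

Definition tree_rel T : rel G := edge_rel (fun e => e \in T).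

Definition swap T (x y a b : G) : {fset G * G} :=
  ((T `\` [fset (x, y); (y, x)]) `|` [fset (a, b); (b, a)])%fset.

Lemma tree_rel_swap T x y a b :
  tree_rel (swap T x y a b) =2 exchange (tree_rel T) x y a b.
Proof.
move=> u w; rewrite /tree_rel /edge_rel /swap /exchange /add /del /same_edge.
by rewrite !inE !xpair_eqE andbC.
Qed.

Section OneTree.
Variable T : {fset G * G}.
Hypothesis tree : spanning_trees H T.

Lemma tree_sym : symmetric (tree_rel T).
Proof. by case: tree => _ s _ _ x y; apply/idP/idP; exact: s. Qed.

Lemma tree_sub x y : tree_rel T x y -> (x, y) \in sub_edges H.
Proof. by case: tree => /fsubsetP s _ _ _; exact: s. Qed.

Lemma tree_adj x y : tree_rel T x y -> adj x y.
Proof. by move=> /tree_sub; exact: sub_edges_adj. Qed.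

Lemma tree_irr : irreflexive (tree_rel T).
Proof. by move=> x; apply/negP => /tree_adj; rewrite adj_irr. Qed.

Lemma tree_acyclic : acyclic (tree_rel T).
Proof. by case: tree. Qed.

Lemma tree_linked x y : x \in sub_vertices H -> y \in sub_vertices H ->
  linked (tree_rel T) x y.
Proof. by case: tree => _ _ c _; exact: c. Qed.

Lemma tree_linked_edge a b : (a, b) \in sub_edges H -> linked (tree_rel T) a b.
Proof.
move=> ab; apply: tree_linked; first exact: sub_edges_vertices ab.
by apply: sub_edges_vertices (sub_edges_sym ab).
Qed.

Lemma swap_tree x y a b : (a, b) \in sub_edges H ->
  ~ linked (del (tree_rel T) x y) a b -> spanning_trees H (swap T x y a b).
Proof.
move=> ab nl; have ts := tree_sym; have E := tree_rel_swap T x y a b.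
have lab := tree_linked_edge ab; split.
- apply/fsubsetP => e; rewrite !inE => /orP[/andP[_]|/orP[] /eqP -> //].
    by case: tree => /fsubsetP s _ _ _; exact: s.
  exact: sub_edges_sym.
- move=> u w; have := exchange_sym x y a b ts u w.
  by rewrite -!E /tree_rel /edge_rel => ->.
- move=> u w uH wH; apply: eq_linked (fun u w => esym (E u w)) _.
  by apply: exchange_linked => //; exact: tree_linked.
- apply: eq_acyclic (fun u w => esym (E u w)) _.
  by apply: exchange_acyclic => //; [exact: tree_irr|exact: tree_acyclic].
Qed.

Lemma not_linked_mem x y a b : (a, b) \in sub_edges H ->
  ~ linked (del (tree_rel T) x y) a b -> tree_rel T x y.
Proof.
by move=> ab nl; have [] := linked_through tree_sym (tree_linked_edge ab) nl.
Qed.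

End OneTree.

Lemma finite_spanning_trees : finite_set (spanning_trees H).
Proof.
apply: (@sub_finite_set _ _ [set` fpowerset (sub_edges H)]).
  by move=> T [TH _ _ _] /=; rewrite fpowersetE.
exact: finite_fset.
Qed.

Definition trees P : {fset {fset G * G}} := fset_set (spanning_trees H `&` P).

Lemma mem_trees P T : (T \in trees P) = `[< spanning_trees H T /\ P T >].
Proof.
rewrite in_fset_set; first by apply/idP/asboolP; rewrite inE.
exact: finite_setIl finite_spanning_trees.
Qed.

Definition count_trees P : nat := #|` trees P|.

Lemma count_trees_le P Q : (forall T, spanning_trees H T -> P T -> Q T) ->
  (count_trees P <= count_trees Q)%N.
Proof.
move=> PQ; apply: fsubset_leq_card; apply/fsubsetP => T.
by rewrite !mem_trees => /asboolP[tT pT]; apply/asboolP; split=> //; exact: PQ.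
Qed.

Lemma count_treesU P Q :
  (count_trees (P `|` Q) <= count_trees P + count_trees Q)%N.
Proof.
apply: (@leq_trans #|` (trees P `|` trees Q)%fset|); last exact: leq_card_fsetU.
apply: fsubset_leq_card; apply/fsubsetP => T; rewrite inE !mem_trees.
by case/asboolP => tT [pT|qT]; apply/orP; [left|right]; apply/asboolP.
Qed.

Lemma count_trees_seq (I : eqType) (s : seq I) (F : I -> set {fset G * G}) :
  (count_trees (fun T => exists2 i, i \in s & F i T) <=
   \sum_(i <- s) count_trees (F i))%N.
Proof.
elim: s => [|i s IH].
  rewrite big_nil leqn0 cardfs_eq0; apply/eqP/fsetP => T.
  by rewrite mem_trees inE; apply/negbTE/asboolPn => -[_ []].
rewrite big_cons; apply: leq_trans (leq_add (leqnn _) IH).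
apply: leq_trans (count_treesU _ _); apply: count_trees_le => T _ [j].
rewrite inE => /orP[/eqP ->|js] FT; first by left.
by right; exists j.
Qed.

(* A tree not containing [ab] in which every edge [x j, y j] separates [a]
   from [b] yields [m] different trees by exchanging [ab] with one of them. *)
Lemma count_exchange P (a b : G) (x y : nat -> G) (m : nat) :
  (a, b) \in sub_edges H ->
  (forall i j, (i < m)%N -> (j < m)%N -> same_edge (x i) (y i) (x j) (y j) ->
    i = j) ->
  (forall T, spanning_trees H T -> P T -> (a, b) \notin T /\
    forall j, (j < m)%N -> ~ linked (del (tree_rel T) (x j) (y j)) a b) ->
  (count_trees P * m <= count_trees setT)%N.
Proof.
move=> ab inj PH.
pose f T j := swap T (x j) (y j) a b.
have sep T : T \in trees P -> [/\ spanning_trees H T, (a, b) \notin T,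
    (b, a) \notin T & forall j, (j < m)%N ->
      ~ linked (del (tree_rel T) (x j) (y j)) a b].
  rewrite mem_trees => /asboolP[tT pT]; have [abT nl] := PH T tT pT.
  split=> //; rewrite -[_ \in T]/(tree_rel T b a) (tree_sym tT).
  exact: abT.
have memT T j : T \in trees P -> (j < m)%N -> tree_rel T (x j) (y j).
  by case/sep => tT _ _ nl jm; exact: (not_linked_mem tT ab (nl j jm)).
have memf T i u w : tree_rel (f T i) u w =
    (tree_rel T u w && ~~ same_edge (x i) (y i) u w) || same_edge a b u w.
  exact: tree_rel_swap.
have nab T j : T \in trees P -> (j < m)%N -> ~~ same_edge a b (x j) (y j).
  move=> tT jm; have := memT T j tT jm; have [_ n1 n2 _] := sep _ tT.
  rewrite /tree_rel /edge_rel; apply: contraTN.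
  by case/orP=> /andP[/eqP -> /eqP ->].
suff U : uniq [seq f T j | T <- trees P, j <- iota 0 m].
  rewrite -[m](size_iota 0) -(size_allpairs f); apply: uniq_leq_size => // T.
  case/allpairsP=> -[T' j] [/= T'P]; rewrite mem_iota => /andP[_ jm] ->.
  rewrite mem_trees; apply/asboolP; split=> //.
  by have [tT _ _ nl] := sep _ T'P; apply: swap_tree => //; exact: nl.
apply: allpairs_uniq; [exact: fset_uniq|exact: iota_uniq|].
move=> [T i] [T' j] /allpairsP[[T1 i1] /= [TP im [-> ->]]].
case/allpairsP=> -[T2 j1] /= [T'P jm [-> ->]] E.
rewrite !mem_iota !add0n /= in im jm.
(* The index can be read off: a tree of [P] contains all the edges [x j, y j], and [f T i] lacks
   exactly the [i]-th of them. *)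
have ij : i1 = j1.
  apply: inj => //; rewrite same_edge_inv; apply: contraT => nij.
  have := memf T1 i1 (x i1) (y i1); rewrite E memf same_edgexx andbF.
  by rewrite (negbTE (nab _ _ TP im)) memT // nij.
rewrite {}ij in E im *; congr (_, _); apply/fsetP => -[u w].
have := memf T1 j1 u w; rewrite E memf.
rewrite -[(u, w) \in T1]/(tree_rel T1 u w) -[(u, w) \in T2]/(tree_rel T2 u w).
have [[_ n1 n1' _] [_ n2 n2' _]] := (sep _ TP, sep _ T'P).
have [|nse] := boolP (same_edge (x j1) (y j1) u w).
  have s1 := tree_sym (let: And4 t _ _ _ := sep _ TP in t).
  have s2 := tree_sym (let: And4 t _ _ _ := sep _ T'P in t).
  case/orP=> /andP[/eqP -> /eqP ->] _; first by rewrite !memT.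
  by rewrite s1 s2 !memT.
have [|nse'] := boolP (same_edge a b u w).
  case/orP=> /andP[/eqP -> /eqP ->] _; rewrite /tree_rel /edge_rel.
    by rewrite (negbTE n1) (negbTE n2).
  by rewrite (negbTE n1') (negbTE n2').
by rewrite !andbT !orbF => ->.
Qed.

End SpanningTrees.

(** * Rare configurations of spanning trees *)

Section Rare.
Context {R : realType} (v : bfs_enumeration).
Variable H : finite_subgraph (G v).
Implicit Types (e : branch_edge) (k : nat) (T : {fset G v * G v}).

Notation src := branch_src.
Notation tgt := (branch_tgt v).
Notation len := (branch_len v).
Notation at_edge := (edge_vertex v).
Notation br := (branch v).

Definition present T e k : bool := tree_rel T (at_edge e k) (at_edge e k.+1).

Definition full T e : Prop := forall k, (k < len e)%N -> present T e k.

Definition edge_in e k : Prop := (at_edge e k, at_edge e k.+1) \in sub_edges H.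

Definition ends_of e k (x y : G v) : Prop :=
  x = at_edge e k /\ y = at_edge e k.+1 \/ y = at_edge e k /\ x = at_edge e k.+1.

Lemma ends_same_edge e k x y : ends_of e k x y ->
  same_edge (at_edge e k) (at_edge e k.+1) x y.
Proof. by case=> -[-> ->]; rewrite /same_edge !eqxx ?orbT. Qed.

Lemma same_edge_ends e k e' k' : (k < len e)%N -> (k' < len e')%N ->
  same_edge (at_edge e k) (at_edge e k.+1) (at_edge e' k') (at_edge e' k'.+1) ->
  e = e' /\ k = k'.
Proof.
move=> kl kl' /orP[|] /andP[/eqP E /eqP E']; apply: (at_edge_inj kl kl').
  by left.
by right.
Qed.

(** The tree with the unit edge at [kap e] deleted from each path [e] of [es]. *)
Definition cut_rel T (es : set branch_edge) (kap : branch_edge -> nat) : rel (G v) :=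
  fun x y => `[< exists e k, [/\ (k < len e)%N, ends_of e k x y,
                              present T e k & es e -> k <> kap e] >].

Section OneTree.
Variable T : {fset G v * G v}.
Hypothesis tree : spanning_trees H T.

Lemma tree_step x y : tree_rel T x y ->
  exists e k, [/\ (k < len e)%N, ends_of e k x y & present T e k].
Proof.
move=> xy; have /adjP[e [k [kl E]]] := tree_adj tree xy.
exists e, k; split=> //; rewrite /present.
by case: E => -[<- <-] //; rewrite (tree_sym tree).
Qed.

(** Used in contrapositive form: if no path of [es] separates, all the cuts can be made at once by
    [acyclic_del_all], and an invariant of the cut tree refutes the link. *)
Lemma cut_family (es : set branch_edge) a b : (a, b) \in sub_edges H ->
  (forall e, es e -> exists2 k, (k < len e)%N &
    linked (del (tree_rel T) (at_edge e k) (at_edge e k.+1)) a b) ->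
  exists2 kap, forall e, es e -> (kap e < len e)%N &
    linked (cut_rel T es kap) a b.
Proof.
move=> ab Hes.
have /choice[kap kapP] : forall e, exists k, es e -> (k < len e)%N /\
    linked (del (tree_rel T) (at_edge e k) (at_edge e k.+1)) a b.
  move=> e; have [ee|ne] := pselect (es e); last by exists 0%N.
  by have [k kl lk] := Hes e ee; exists k.
exists kap; first by move=> e /kapP[].
pose q : rel (G v) := fun x y => `[< exists2 e, es e &
  same_edge (at_edge e (kap e)) (at_edge e (kap e).+1) x y >].
have := @acyclic_del_all _ (tree_rel T) q a b (tree_sym tree) (tree_irr tree)
  (tree_acyclic tree) (tree_linked_edge tree ab) _.
move=> h; feed h.
  move=> x y _ /asboolP[e ee /orP[|] /andP[/eqP -> /eqP ->]].
    by have [] := kapP e ee.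
  by apply: eq_linked (delC _ _ _) _; have [] := kapP e ee.
apply: sub_linked h => x y /andP[/tree_step[e [k [kl E pr]]] /asboolPn nq].
apply/asboolP; exists e, k; split=> // ee kE; apply: nq; exists e => //.
by rewrite -kE; exact: ends_same_edge.
Qed.

(** [chi] and [psi] describe an invariant, which may jump only at missing or cut unit edges. *)
Lemma cut_constant (X : eqType) (chi : branch_vertex -> X) psi es kap a b :
  (forall e, psi e 0%N = chi (src e)) -> (forall e, psi e (len e) = chi (tgt e)) ->
  (forall e k, (k < len e)%N -> present T e k -> (es e -> k <> kap e) ->
    psi e k = psi e k.+1) ->
  linked (cut_rel T es kap) a b ->
  profile (v := v) chi psi a = profile (v := v) chi psi b.
Proof.
move=> p0 pl step; pose f := profile (v := v) chi psi.
case=> p; elim: p a => [|z p IH] a /=; first by move=> _ ->.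
case/andP=> /asboolP[e [k [kl E pr nk]]] pp lp; rewrite -(IH z pp lp).
have F j : (j <= len e)%N -> f (at_edge e j) = psi e j by exact: profileE.
have st := step e k kl pr nk.
by case: E => -[-> ->]; rewrite -/f !F ?st //; exact: ltnW.
Qed.

End OneTree.

Definition total : R := (count_trees H setT)%:R.

Definition cnt (P : set {fset G v * G v}) : R := (count_trees H P)%:R.

Lemma cnt_le P Q : (forall T, spanning_trees H T -> P T -> Q T) -> cnt P <= cnt Q.
Proof. by move=> PQ; rewrite ler_nat; exact: count_trees_le. Qed.

Lemma cntU P Q : cnt (P `|` Q) <= cnt P + cnt Q.
Proof. by rewrite -natrD ler_nat; exact: count_treesU. Qed.

Lemma cnt_seq (I : eqType) (s : seq I) (F : I -> set {fset G v * G v}) :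
  cnt (fun T => exists2 i, i \in s & F i T) <= \sum_(i <- s) cnt (F i).
Proof. by rewrite -natr_sum ler_nat; exact: count_trees_seq. Qed.

Lemma total_ge0 : 0 <= total. Proof. exact: ler0n. Qed.

Definition separated T e k e' : Prop := forall k', (k' < len e')%N ->
  ~ linked (del (tree_rel T) (at_edge e' k') (at_edge e' k'.+1))
      (at_edge e k) (at_edge e k.+1).

Lemma cnt_separated e k e' : (k < len e)%N -> edge_in e k ->
  cnt (fun T => ~~ present T e k /\ separated T e k e') <= total / (len e')%:R.
Proof.
move=> kl ek; rewrite ler_pdivlMr ?ltr0n ?branch_len_gt0 //.
rewrite -natrM ler_nat.
apply: (@count_exchange _ H _ (at_edge e k) (at_edge e k.+1) (at_edge e')
  (fun j => at_edge e' j.+1) (len e')) => //.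
by move=> i j il jl /(same_edge_ends il jl)[].
Qed.

Lemma not_separated T (es : set branch_edge) e k :
  ~ (exists2 e', es e' & separated T e k e') ->
  forall e', es e' -> exists2 k', (k' < len e')%N &
    linked (del (tree_rel T) (at_edge e' k') (at_edge e' k'.+1))
      (at_edge e k) (at_edge e k.+1).
Proof.
move=> ns e' ee'; apply: contrapT => nk; apply: ns; exists e' => // k' kl' lk.
by apply: nk; exists k'.
Qed.

Lemma present_vertex T e k : spanning_trees H T -> present T e k ->
  at_edge e k.+1 \in sub_vertices H.
Proof.
move=> tT; rewrite /present (tree_sym tT) => /(tree_sub tT).
exact: sub_edges_vertices.
Qed.

Lemma ray_bound : exists M, forall m, br (inr m) \in sub_vertices H -> (m < M)%N.
Proof.
pose idx (x : G v) := if x is inl (inr m) then m else 0%N.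
exists (\max_(x <- sub_vertices H) idx x).+1 => m mH; rewrite ltnS.
exact: (@leq_bigmax_seq _ _ xpredT idx _ mH).
Qed.

(* Crossing the missing ray edge requires a link further out. *)
Lemma ray_missing T M n : spanning_trees H T -> edge_in (RayEdge n) 0 ->
  (forall m, br (inr m) \in sub_vertices H -> (m < M)%N) ->
  ~~ present T (RayEdge n) 0 ->
  exists2 m, m \in index_iota n M & separated T (RayEdge n) 0 (LinkEdge m).
Proof.
move=> tT ein MH np; apply: contrapT => nm.
pose es : set branch_edge := [set e | exists2 m, (n <= m < M)%N & e = LinkEdge m].
have [|kap kl lk] := cut_family tT ein (es := es).
  apply: not_separated => -[e' [m nmM ->] sep]; apply: nm; exists m => //.
  by rewrite mem_index_iota.
(* The invariant marks the ray beyond the missing edge, up to the bound [M] of the finite subgraph,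
   and the links issuing from it up to their cuts. *)
pose chi (s : branch_vertex) := if s is inr m then (n <= m < M)%N else false.
pose psi e k := match e with
  | TreeEdge _ _ => false
  | RayEdge i => if k is 0 then chi (ray_vertex i) else chi (inr i)
  | LinkEdge m => (n <= m < M)%N && (k <= kap (LinkEdge m))%N end.
have nM : (n < M)%N.
  apply: MH; have := sub_edges_vertices (sub_edges_sym ein).
  by rewrite (at_edge_len v (RayEdge n)).
have := cut_constant (chi := chi) (psi := psi) _ _ _ lk.
move=> h; feed h; [|feed h; [|feed h]].
- by case=> [s i|i|m] //=; rewrite leq0n andbT.
- case=> [s i|i|m] //; rewrite /psi [chi _]/=; apply/negbTE/negP => /andP[nm'].
  by rewrite leqNgt kl //; exists m.
- case=> [s i|i|m] k //.
    case: k => // _ pi _; rewrite /psi.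
    have iM : (i < M)%N.
      by apply: MH; have := present_vertex tT pi; rewrite (at_edge_len v (RayEdge i)).
    have ni : i <> n by move=> E; rewrite -E pi in np.
    clear pi; case: i iM ni => [|i] iM ni /=; lia.
  move=> kl' _ nk; rewrite /psi; case: (boolP (n <= m < M)%N) => //= nm'.
  have : k <> kap (LinkEdge m) by apply: nk; exists m.
  lia.
move: h; rewrite (at_edge_len v (RayEdge n)) /= leqnn nM.
by rewrite /chi; case: (n) => [//|n'] /=; rewrite ltnn.
Qed.

Lemma pow2_len m : (2 ^ m.+1 <= len (LinkEdge m))%N.
Proof.
(* Comparison of cubes: [8 ^ m.+1 <= 9 ^ m.+1 <= 3 ^ 3 ^ (size (v m)).+1]. *)
rewrite -(leq_exp2r _ _ (_ : 0 < 3)%N) // -!expnM /=.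
have mb : (m < ball_size (size (v m)))%N by rewrite -(bfs_ballE v).
have mb2 : (m.+1 * 2 <= 3 ^ (size (v m)).+1)%N.
  by have := ball_size2_lt (size (v m)); move: mb; lia.
rewrite mulnC expnM (_ : 3 ^ size (v m) * 3 = 3 ^ (size (v m)).+1)%N; last first.
  by rewrite expnSr.
apply: (@leq_trans (3 ^ (m.+1 * 2))%N); last by rewrite leq_exp2l.
by rewrite [(m.+1 * 2)%N]mulnC expnM leq_exp2r.
Qed.

Lemma geometric_tail n M : \sum_(n <= m < M) 2 ^- m.+1 <= 2 ^- n :> R.
Proof.
suff : (n <= M)%N -> \sum_(n <= m < M) 2 ^- m.+1 = 2 ^- n - 2 ^- M :> R.
  have [nM|Mn] := leqP n M; last by rewrite big_geq ?invr_ge0 ?exprn_ge0 // ltnW.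
  by move=> -> //; rewrite gerBl invr_ge0 exprn_ge0.
elim: M => [|M IH]; first by rewrite leqn0 => /eqP ->; rewrite big_geq // subrr.
rewrite leq_eqVlt => /orP[/eqP ->|]; first by rewrite big_geq // subrr.
rewrite ltnS => nM; rewrite big_nat_recr //= IH // exprS invfM.
set q := (2 ^+ M)^-1; lra.
Qed.

Lemma cnt_ray_missing n : edge_in (RayEdge n) 0 ->
  cnt (fun T => ~~ present T (RayEdge n) 0) <= total * 2 ^- n.
Proof.
move=> ein; have [M MH] := ray_bound.
pose Q m T := ~~ present T (RayEdge n) 0 /\ separated T (RayEdge n) 0 (LinkEdge m).
apply: (@le_trans _ _ (\sum_(m <- index_iota n M) cnt (Q m))).
  apply: le_trans (cnt_seq _ _); apply: cnt_le => T tT np.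
  by have [m mI sep] := ray_missing tT ein MH np; exists m.
apply: (@le_trans _ _ (\sum_(m <- index_iota n M) total * 2 ^- m.+1)).
  apply: ler_sum => m _; apply: le_trans (cnt_separated (LinkEdge m) _ ein) _ => //.
  rewrite ler_wpM2l ?total_ge0 // lef_pV2 ?posrE ?ltr0n ?branch_len_gt0 ?exprn_gt0 //.
  by rewrite -natrX ler_nat pow2_len.
by rewrite -mulr_sumr ler_wpM2l ?total_ge0 // geometric_tail.
Qed.

(* A word attached neither to its parent nor to the ray is attached to a
   child. *)
Lemma word_detached T t i m k k' : spanning_trees H T -> v m = i :: t ->
  (k < len (TreeEdge t i))%N -> (k' < len (LinkEdge m))%N ->
  edge_in (TreeEdge t i) k ->
  ~~ present T (TreeEdge t i) k -> ~~ present T (LinkEdge m) k' ->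
  exists j, separated T (TreeEdge t i) k (TreeEdge (i :: t) j).
Proof.
move=> tT vm kl kl' ein np np'; apply: contrapT => nj.
pose w := i :: t.
pose es : set branch_edge := [set e | exists j, e = TreeEdge w j].
have [|kap kapl lk] := cut_family tT ein (es := es).
  by apply: not_separated => -[e' [j ->] sep]; apply: nj; exists j.
(* The invariant marks the word with the ends of its two paths behind the missing unit edges and the
   beginnings of its child paths before the cuts. *)
pose chi (s : branch_vertex) := s == inl w.
pose psi e c := match e with
  | TreeEdge s j => if (s, j) == (t, i) then (k < c)%N
                    else (s == w) && (c <= kap (TreeEdge w j))%N
  | RayEdge _ => false
  | LinkEdge m' => (m' == m) && (k' < c)%N end.
have tw : t <> w by move=> /(congr1 size)/n_Sn.
have := cut_constant (chi := chi) (psi := psi) _ _ _ lk.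
move=> h; feed h; [|feed h; [|feed h]].
- case=> [s j|[|n]|m'] //=; last by rewrite andbF.
  rewrite /chi; case: eqP => [[-> _]|_]; last by rewrite leq0n andbT.
  by apply/esym/eqP => -[].
- case=> [s j|n|m']; rewrite /psi /chi.
  + case: eqP => [[-> ->]|ne]; first by rewrite kl [RHS]/= eqxx.
    have -> : (tgt (TreeEdge s j) == inl w) = false.
      by apply/eqP => -[E1 E2]; apply: ne; rewrite E1 E2.
    apply/negbTE/negP => /andP[/eqP -> ]; rewrite leqNgt kapl //.
    by exists j.
  + by case: n.
  + have [->|nm] := eqVneq m' m; first by rewrite kl' /= vm eqxx.
    rewrite /=; apply/esym/eqP => -[]; rewrite -/w -(vm : v m = w) => /(bij_inj (bfs_bij v)) E.
    by rewrite E eqxx in nm.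
- case=> [s j|n|m'] c cl pc nc //; rewrite /psi.
  + case: eqP => [[Es Ej]|ne].
      have : c <> k by move=> E; rewrite Es Ej E (negbTE np) in pc.
      by lia.
    have [Es|//] := eqVneq s w; rewrite Es in cl pc nc *.
    have : c <> kap (TreeEdge w j) by apply: nc; exists j.
    by lia.
  + have [Em|//] := eqVneq m' m.
    have : c <> k' by move=> E; rewrite Em E (negbTE np') in pc.
    by lia.
move: h; rewrite !profileE ?(ltnW kl) //= ?eqxx ?ltnS ?ltnn ?leqnn //.
- by apply/esym/eqP => -[].
- by rewrite /chi !eqxx.
- by apply/esym/eqP => -[].
- by rewrite /chi !eqxx.
Qed.

(** Union bound over the missing unit edge and the three children: [3 * d / d ^ 3] with [d] the
    length of the path to the parent. *)
Lemma cnt_word_detached t i m : v m = i :: t ->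
  (forall k, (k < len (TreeEdge t i))%N -> edge_in (TreeEdge t i) k) ->
  cnt (fun T => ~ full T (TreeEdge t i) /\ ~ full T (LinkEdge m)) <=
  total * (3 / (D (size t).+1)%:R ^+ 2).
Proof.
move=> vm ein.
pose Q (kj : nat * 'I_3) T := ~~ present T (TreeEdge t i) kj.1 /\
  separated T (TreeEdge t i) kj.1 (TreeEdge (i :: t) kj.2).
pose I := [seq (k, j) | k <- iota 0 (len (TreeEdge t i)), j <- enum 'I_3].
apply: (@le_trans _ _ (\sum_(kj <- I) cnt (Q kj))).
  apply: le_trans (cnt_seq _ _); apply: cnt_le => T tT [nf nf'].
  have [k kl np] : exists2 k, (k < len (TreeEdge t i))%N & ~~ present T (TreeEdge t i) k.
    apply: contrapT => nk; apply: nf => k kl; apply: contrapT => /negP np.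
    by apply: nk; exists k.
  have [k' kl' np'] : exists2 k', (k' < len (LinkEdge m))%N &
      ~~ present T (LinkEdge m) k'.
    apply: contrapT => nk; apply: nf' => k' kl'; apply: contrapT => /negP np'.
    by apply: nk; exists k'.
  have [j sep] := word_detached tT vm kl kl' (ein k kl) np np'.
  exists (k, j) => //; apply/allpairsP; exists (k, j).
  by rewrite mem_iota mem_enum.
have d0 : 0 < (D (size t).+1)%:R :> R by rewrite ltr0n D_gt0.
apply: (@le_trans _ _ (\sum_(kj <- I) total / (D (size t).+2)%:R)).
  rewrite big_seq [leRHS]big_seq; apply: ler_sum => kj /allpairsP[[k j] [kI _ ->]].
  have kl : (k < len (TreeEdge t i))%N by move: kI; rewrite mem_iota.
  have := cnt_separated (TreeEdge (i :: t) j) kl (ein k kl).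
  by rewrite -[len _]/(D (size t).+2).
rewrite big_const_seq count_predT size_allpairs size_iota size_enum_ord.
rewrite iter_addr_0 -[leLHS]mulr_natr natrM -/(D (size t).+1) DS natrX.
rewrite le_eqVlt; apply/orP; left; apply/eqP; field.
by rewrite gt_eqF.
Qed.

Definition in_ball l e : bool :=
  match e with
  | TreeEdge s _ => (size s < l)%N
  | RayEdge n | LinkEdge n => (n < ball_size l)%N
  end.

Definition ball_rel T l : rel (G v) := fun x y =>
  tree_rel T x y && `[< exists e k, [/\ in_ball l e, (k < len e)%N & ends_of e k x y] >].

(* Collapsing everything outside the ball to its exit on the ray maps a path
   between two vertices of the ball into the ball, unless it uses a whole path
   to the next level. *)
Lemma ball_split T l e k : spanning_trees H T -> in_ball l e -> (k < len e)%N ->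
  edge_in e k -> ~ linked (ball_rel T l) (at_edge e k) (at_edge e k.+1) ->
  exists t i, size t = l /\ separated T e k (TreeEdge t i).
Proof.
move=> tT el kl ein nl; apply: contrapT => nt; apply: nl.
pose es : set branch_edge := [set e | exists t i, size t = l /\ e = TreeEdge t i].
have [|kap kapl lk] := cut_family tT ein (es := es).
  by apply: not_separated => -[e' [t [i [tl ->]]] sep]; apply: nt; exists t, i.
pose N := ball_size l; pose out := br (ray_vertex N).
(* The retraction onto the ball. A path to the next level is broken at its cut: the part before it
   collapses to its source, the rest to [out]. *)
pose chi (s : branch_vertex) : G v := match s with
  | inl t => if (size t <= l)%N then br (inl t) else out
  | inr n => if (n < N)%N then br (inr n) else out end.
pose psi e c : G v := if in_ball l e then at_edge e c else
  if e is TreeEdge t i then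
    if (size t == l) && (c <= kap (TreeEdge t i))%N then br (inl t) else out
  else out.
have chi_ray n : (n <= N)%N -> chi (ray_vertex n) = br (ray_vertex n).
  by case: n => [|n] //= ->.
have p0 e' : psi e' 0%N = chi (src e').
  rewrite /psi; case: ifP => ine.
    rewrite at_edge0; case: e' ine => [s i|n|n] /= ine.
    + by rewrite (ltnW ine).
    + by rewrite chi_ray // ltnW.
    + by rewrite /chi ine.
  case: e' ine => [s i|n|n] /= /negbT; rewrite -?leqNgt => ine.
  + by rewrite andbT eqn_leq ine andbT.
  + case: n ine => [|n] /=; first by rewrite leqn0 => /eqP E; rewrite /out /N E.
    rewrite leq_eqVlt => /orP[/eqP E|]; first by rewrite /out /N E ltnSn.
    by rewrite ltnS ltnNge => ->.
  + by rewrite ltnNge -/N ine.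
have pl e' : psi e' (len e') = chi (tgt e').
  rewrite /psi; case: ifP => ine.
    rewrite at_edge_len; case: e' ine => [s i|n|n] /= ine.
    + by rewrite ine.
    + by rewrite ine.
    + by rewrite (bfs_ballE v) ine.
  case: e' ine => [s i|n|n] /= /negbT; rewrite -?leqNgt => ine.
  + rewrite ltnNge ine /=; case: eqP => //= sl.
    by rewrite leqNgt kapl //; exists s, i.
  + by rewrite ltnNge -/N ine.
  + by rewrite (bfs_ballE v) ltnNge -/N ine.
have ρE c : (c <= len e)%N -> profile (v := v) chi psi (at_edge e c) = at_edge e c.
  by move=> cl; rewrite profileE // /psi el.
rewrite -(ρE k (ltnW kl)) -(ρE k.+1 kl); apply: map_linked lk => x y.
case/asboolP=> e' [c [cl E pr nc]].
have F j : (j <= len e')%N -> profile (v := v) chi psi (at_edge e' j) = psi e' j.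
  exact: profileE.
have [ine|nine] := boolP (in_ball l e').
  right; have step : ball_rel T l (at_edge e' c) (at_edge e' c.+1).
    apply/andP; split=> //; apply/asboolP; exists e', c; split=> //; left.
    by split.
  have step' : ball_rel T l (at_edge e' c.+1) (at_edge e' c).
    apply/andP; split; first by rewrite (tree_sym tT).
    by apply/asboolP; exists e', c; split=> //; right.
  by case: E => -[-> ->]; rewrite !F ?(ltnW cl) // /psi ine.
left; suff : psi e' c = psi e' c.+1.
  by case: E => -[-> ->]; rewrite !F ?(ltnW cl).
rewrite /psi (negbTE nine); case: e' cl nc {E pr F nine} => // s i cl nc.
have [sl|//] := eqVneq (size s) l; rewrite /=.
have : c <> kap (TreeEdge s i) by apply: nc; exists s, i.
by move=> ne; rewrite leq_eqVlt; case: eqP ne => // _ _.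
Qed.

Lemma cnt_ball_split l e k : in_ball l e -> (k < len e)%N -> edge_in e k ->
  cnt (fun T => ~ linked (ball_rel T l) (at_edge e k) (at_edge e k.+1)) <=
  total * ((3 ^ l.+1)%:R / (D l.+1)%:R).
Proof.
move=> el kl ein.
pose I := [seq (t, i) | t <- words l, i <- enum 'I_3].
pose Q (ti : ternary * 'I_3) T := ~~ present T e k /\
  separated T e k (TreeEdge ti.1 ti.2).
apply: (@le_trans _ _ (\sum_(ti <- I) cnt (Q ti))).
  apply: le_trans (cnt_seq _ _); apply: cnt_le => T tT nl.
  have [t [i [tl sep]]] := ball_split tT el kl ein nl.
  exists (t, i).
    by apply/allpairsP; exists (t, i); rewrite mem_words tl mem_enum eqxx.
  split=> //; apply/negP => pr; apply: nl; apply: linked_edge.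
  by apply/andP; split=> //; apply/asboolP; exists e, k; split=> //; left.
apply: (@le_trans _ _ (\sum_(ti <- I) total / (D l.+1)%:R)).
  rewrite big_seq [leRHS]big_seq; apply: ler_sum => ti /allpairsP[[t i] /=].
  rewrite mem_words => -[/eqP tl _ ->]; rewrite -tl.
  exact: (cnt_separated (TreeEdge t i) kl ein).
rewrite big_const_seq count_predT size_allpairs size_words size_enum_ord.
by rewrite iter_addr_0 -[leLHS]mulr_natr -expnSr -mulrA [_^-1 * _]mulrC.
Qed.

End Rare.

(** * Exchanging the two paths at a word *)

Section Flips.
Variable v : bfs_enumeration.
Variable H : finite_subgraph (G v).
Variables L K : nat.
Implicit Types (e : branch_edge) (k : nat) (T : {fset G v * G v}).

Notation src := branch_src.
Notation tgt := (branch_tgt v).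
Notation len := (branch_len v).
Notation at_edge := (edge_vertex v).
Notation br := (branch v).

Hypothesis HK : forall e k, in_ball K e -> (k < len e)%N -> edge_in H e k.

(* In a good tree every word above level [L] hangs by exactly one of its paths
   to its parent and to the ray. *)
Definition good T : Prop :=
  [/\ forall n, (ball_size L <= n < ball_size K)%N -> present T (RayEdge n) 0,
      forall t i m, v m = i :: t -> (L <= size t < K)%N ->
        full T (TreeEdge t i) \/ full T (LinkEdge m) &
      forall e k, in_ball L e -> (k < len e)%N ->
        linked (ball_rel T L) (at_edge e k) (at_edge e k.+1)].

(** The ball of level [j] with the ray up to the exit of the ball of level [K]: where both paths of
    a word of level [j.+1] have their sources. *)
Definition core_edge j e : bool :=
  in_ball j e || (if e is RayEdge n then (n < ball_size K)%N else false).

Definition core_rel T j : rel (G v) := fun x y => tree_rel T x y &&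
  `[< exists e k, [/\ core_edge j e, (k < len e)%N & ends_of e k x y] >].

Lemma ends_of_sym e k (x y : G v) : ends_of e k x y -> ends_of e k y x.
Proof. by case=> -[-> ->]; [right|left]. Qed.

Lemma core_edge_mono i j e : (i <= j)%N -> core_edge i e -> core_edge j e.
Proof.
move=> ij /orP[|h]; last by apply/orP; right.
move=> ie; apply/orP; left; case: e ie => [s x|n|n] /=.
- by move=> /leq_trans; exact.
- by move=> /leq_trans -> //; exact: ball_size_mono.
- by move=> /leq_trans -> //; exact: ball_size_mono.
Qed.

Section GoodTree.
Variable T : {fset G v * G v}.
Hypotheses (tree : spanning_trees H T) (gd : good T).

Lemma core_sym j : symmetric (core_rel T j).
Proof.
move=> x y; rewrite /core_rel (tree_sym tree); congr (_ && _).
by apply/asboolP/asboolP => -[e [k [ce kl E]]]; exists e, k; split=> //;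
  exact: ends_of_sym.
Qed.

Lemma core_step j e k : core_edge j e -> (k < len e)%N -> present T e k ->
  core_rel T j (at_edge e k) (at_edge e k.+1).
Proof.
move=> ce kl pr; apply/andP; split=> //; apply/asboolP; exists e, k.
by split=> //; left.
Qed.

Lemma present_linked (r : rel (G v)) e i j : (i <= j)%N ->
  (forall k, (i <= k < j)%N -> r (at_edge e k) (at_edge e k.+1)) ->
  linked r (at_edge e i) (at_edge e j).
Proof.
elim: j => [|j IH]; first by rewrite leqn0 => /eqP -> _; exact: linked_refl.
rewrite leq_eqVlt => /orP[/eqP -> _|]; first exact: linked_refl.
rewrite ltnS => ij st; apply: linked_trans (IH ij _) _.
  by move=> k /andP[ik kj]; apply: st; rewrite ik ltnW.
by apply: linked_edge; apply: st; rewrite ij ltnSn.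
Qed.

Lemma full_linked j e : core_edge j e -> full T e ->
  linked (core_rel T j) (br (src e)) (br (tgt e)).
Proof.
move=> ce fe; have := @present_linked (core_rel T j) e 0 (len e) (leq0n _).
rewrite at_edge0 at_edge_len; apply=> k /andP[_ kl].
by apply: core_step => //; exact: fe.
Qed.

Lemma ball_linked e : in_ball L e ->
  linked (core_rel T L) (br (src e)) (br (tgt e)).
Proof.
move=> ie; have E : at_edge e (len e) = br (tgt e) by exact: at_edge_len.
rewrite -E -[br (src e)]/(at_edge e 0).
suff : forall k, (k <= len e)%N ->
    linked (core_rel T L) (at_edge e 0) (at_edge e k) by exact.
elim=> [|k IH] kl; first exact: linked_refl.
apply: linked_trans (IH (ltnW kl)) _; have [_ _ g3] := gd.
apply: sub_linked (g3 e k ie kl) => x y /andP[xy /asboolP[e' [k' [ie' kl' E']]]].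
apply/andP; split=> //; apply/asboolP; exists e', k'; split=> //.
by rewrite /core_edge ie'.
Qed.

Lemma core_ray n : (n <= ball_size K)%N ->
  linked (core_rel T L) (G_root v) (br (ray_vertex n)).
Proof.
elim: n => [|n IH] nK; first exact: linked_refl.
apply: linked_trans (IH (ltnW nK)) _.
have [nL|Ln] := ltnP n (ball_size L); first exact: (ball_linked (e := RayEdge n)).
apply: (@full_linked L (RayEdge n)); first by rewrite /core_edge nK orbT.
move=> k; rewrite ltnS leqn0 => /eqP ->; have [g1 _ _] := gd.
by apply: g1; rewrite Ln.
Qed.

(** Induction on the level: a word above level [L] hangs by a full path either from its parent,
    already linked, or from the ray, which is intact. *)
Lemma core_word j t : (L <= j <= K)%N -> (size t <= j)%N ->
  linked (core_rel T j) (G_root v) (br (inl t)).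
Proof.
elim: j t => [|j IH] t /andP[Lj jK] tj.
  by case: t tj => // _; exact: linked_refl.
have mono i x y : (i <= j.+1)%N -> linked (core_rel T i) x y ->
    linked (core_rel T j.+1) x y.
  move=> ij; apply: sub_linked => u w /andP[uw /asboolP[e [k [ce kl E]]]].
  apply/andP; split=> //; apply/asboolP; exists e, k; split=> //.
  exact: core_edge_mono ce.
move: Lj; rewrite leq_eqVlt => /orP[/eqP Lj|].
  elim: t tj => [|i t IHt] tj; first exact: linked_refl.
  apply: linked_trans (IHt (ltnW tj)) _; apply: (mono L); first by rewrite Lj.
  by apply: (ball_linked (e := TreeEdge t i)); rewrite /= Lj.
rewrite ltnS => Lj.
have IHj s : (size s <= j)%N -> linked (core_rel T j.+1) (G_root v) (br (inl s)).
  by move=> sj; apply: (mono j) => //; apply: IH => //; rewrite Lj ltnW.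
move: tj; rewrite leq_eqVlt => /orP[/eqP tj|]; last by rewrite ltnS; exact: IHj.
case: t tj => [//|i t] [tj]; have [w vK wK] := bfs_bij v.
set m := w (i :: t); have vm : v m = i :: t by exact: wK.
have mj : (m < ball_size j.+1)%N by rewrite -(bfs_ballE v) vm /= tj.
have [_ g2 _] := gd; have [f|f] : full T (TreeEdge t i) \/ full T (LinkEdge m).
- by apply: (g2 t i m vm); rewrite tj Lj.
- apply: linked_trans (IHj t _) _; first by rewrite tj.
  apply: (@full_linked j.+1 (TreeEdge t i)) => //.
  by rewrite /core_edge /= tj ltnSn.
apply: linked_trans (_ : linked _ _ (br (inr m))) _.
  apply: (mono L); first exact: leqW.
  apply: (@core_ray m.+1); apply: leq_trans mj _; exact: ball_size_mono.
rewrite -vm; apply: (@full_linked j.+1 (LinkEdge m)) => //.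
by rewrite /core_edge /= mj.
Qed.

End GoodTree.

Section AtWord.
Variables (t : ternary) (i : 'I_3) (m : nat).
Hypotheses (vm : v m = i :: t) (Lt : (L <= size t < K)%N).

Let mK : (m < ball_size K)%N.
Proof. by rewrite -(bfs_ballE v) vm; case/andP: Lt. Qed.

Let mt : (ball_size (size t) <= m)%N.
Proof. by rewrite leqNgt -(bfs_ballE v) vm /= ltnn. Qed.

Let p := TreeEdge t i.
Let lk := LinkEdge m.

Lemma len_eq : len p = len lk.
Proof. by rewrite /= vm. Qed.

Lemma tgt_eq : tgt p = tgt lk.
Proof. by rewrite /= vm. Qed.

(** Symmetric in the two paths, so that both directions of the exchange are treated together. *)
Definition pair_edge e1 e2 : Prop := e1 = p /\ e2 = lk \/ e1 = lk /\ e2 = p.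

Lemma pair_facts e1 e2 : pair_edge e1 e2 ->
  [/\ len e1 = len e2, tgt e1 = tgt e2, e1 != e2,
      ~~ core_edge (size t) e1 /\ ~~ core_edge (size t) e2 &
      forall k, (k < len e1)%N -> edge_in H e1 k /\ edge_in H e2 k].
Proof.
have ep k : (k < len p)%N -> edge_in H p k.
  by apply: HK; case/andP: Lt.
have el k : (k < len lk)%N -> edge_in H lk k by exact: HK.
have cp : ~~ core_edge (size t) p by rewrite /core_edge /= ltnn.
have cl : ~~ core_edge (size t) lk by rewrite /core_edge /= orbF -leqNgt.
case=> -[-> ->]; split=> //; rewrite ?len_eq ?tgt_eq //.
  by move=> k kl; split; [apply: ep; rewrite len_eq|exact: el].
by move=> k kl; split; [exact: el|apply: ep; rewrite len_eq].
Qed.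

Section Pair.
Variables (T : {fset G v * G v}) (e1 e2 : branch_edge).
Hypotheses (tree : spanning_trees H T) (gd : good T) (pe : pair_edge e1 e2).

Lemma sources_linked : linked (core_rel T (size t)) (br (src e1)) (br (src e2)).
Proof.
have cs := core_sym tree (size t).
have lt0 : linked (core_rel T (size t)) (G_root v) (br (inl t)).
  apply: (core_word gd) => //.
  by case/andP: Lt => a /ltnW b; rewrite a.
have lm : linked (core_rel T (size t)) (G_root v) (br (inr m)).
  apply: (@sub_linked _ (core_rel T L)); last first.
    exact: (core_ray gd (n := m.+1) mK).
  move=> x y /andP[xy /asboolP[e [k [ce kl E]]]].
  apply/andP; split=> //; apply/asboolP; exists e, k; split=> //.
  by apply: core_edge_mono ce; case/andP: Lt.
case: pe => -[-> ->].
  exact: linked_trans (linked_sym cs lt0) lm.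
exact: linked_trans (linked_sym cs lm) lt0.
Qed.

Lemma core_del e k x y : ~~ core_edge (size t) e -> (k < len e)%N ->
  core_rel T (size t) x y ->
  del (tree_rel T) (at_edge e k) (at_edge e k.+1) x y.
Proof.
move=> ce kl /andP[xy /asboolP[e' [k' [ce' kl' E]]]]; rewrite /del xy /=.
apply/negP => se; case/negP: ce.
suff -> : e = e' by [].
have := ends_same_edge E; rewrite same_edge_inv => se'.
have [] := @at_edge_inj v e k e' k' kl kl' => //.
case/orP: se => /andP[/eqP xE /eqP yE]; case: E => -[x' y'];
  rewrite -?xE -?yE -?x' -?y'; [left|right|right|left]; by split.
Qed.

Lemma present_del e e' k k' : (k < len e)%N -> (k' < len e')%N ->
  (e, k) <> (e', k') -> present T e k ->
  del (tree_rel T) (at_edge e' k') (at_edge e' k'.+1) (at_edge e k) (at_edge e k.+1).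
Proof.
move=> kl kl' ne pr; rewrite /del [tree_rel _ _ _]pr /=; apply/negP => se.
by apply: ne; have [-> ->] := same_edge_ends kl' kl se.
Qed.

(** The unit edges at position [c] of the two paths play the same role: below, their ends are joined
    through the core; above, through the common target. *)
Lemma pair_ends_linked c : (c < len e1)%N ->
  (forall k, (k < len e1)%N -> k != c -> present T e1 k) ->
  (forall k, (k < len e2)%N -> k != c -> present T e2 k) ->
  linked (del (tree_rel T) (at_edge e1 c) (at_edge e1 c.+1))
    (at_edge e1 c) (at_edge e2 c) /\
  linked (del (tree_rel T) (at_edge e1 c) (at_edge e1 c.+1))
    (at_edge e2 c.+1) (at_edge e1 c.+1).
Proof.
move=> cl f1 f2; have [El Et ne [c1 c2] ein] := pair_facts pe.
have ds := del_sym (at_edge e1 c) (at_edge e1 c.+1) (tree_sym tree).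
have seg1 a b : (a <= b <= len e1)%N -> (forall k, (a <= k < b)%N -> k != c) ->
    linked (del (tree_rel T) (at_edge e1 c) (at_edge e1 c.+1))
      (at_edge e1 a) (at_edge e1 b).
  move=> /andP[ab bl] nc; apply: present_linked => // k kab.
  have kl : (k < len e1)%N by case/andP: kab => _ /leq_trans; exact.
  apply: present_del => //; last by apply: f1 => //; exact: nc.
  by case=> E; move: (nc _ kab); rewrite E eqxx.
have seg2 a b : (a <= b <= len e2)%N -> (forall k, (a <= k < b)%N -> k != c) ->
    linked (del (tree_rel T) (at_edge e1 c) (at_edge e1 c.+1))
      (at_edge e2 a) (at_edge e2 b).
  move=> /andP[ab bl] nc; apply: present_linked => // k kab.
  have kl : (k < len e2)%N by case/andP: kab => _ /leq_trans; exact.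
  apply: present_del => //; last by apply: f2 => //; exact: nc.
  by case=> E; move: ne; rewrite E eqxx.
have low k : (0 <= k < c)%N -> k != c by lia.
have high n k : (c.+1 <= k < n)%N -> k != c by lia.
have cl2 : (c < len e2)%N by rewrite -El.
split.
  apply: linked_trans (linked_sym ds (seg1 0%N c _ low)) _.
    by rewrite leq0n ltnW.
  apply: linked_trans (seg2 0%N c _ low); last by rewrite leq0n ltnW.
  by apply: sub_linked sources_linked => x y; exact: core_del.
apply: linked_trans (seg2 _ (len e2) _ (high _)) _; first by rewrite cl2 leqnn.
rewrite at_edge_len -Et -at_edge_len; apply: linked_sym => //.
by apply: seg1 (high _); rewrite cl leqnn.
Qed.

(** The two paths and a link of their sources inside the core would close a cycle. *)
Lemma not_both_full : full T e1 -> full T e2 -> False.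
Proof.
move=> f1 f2; have [El Et ne [c1 c2] ein] := pair_facts pe.
have cl : (0 < len e1)%N by exact: branch_len_gt0.
have [] := @pair_ends_linked 0 cl.
- by move=> k kl _; exact: f1.
- by move=> k kl _; exact: f2.
move=> l1 l2; have p1 := f1 0%N cl.
have neq : at_edge e1 0 != at_edge e1 1.
  by apply: contraTneq p1 => E; rewrite /present -E (tree_irr tree).
apply: (acyclic_edge (tree_sym tree) neq (tree_acyclic tree) p1).
apply: linked_trans l1 _; apply: linked_trans (linked_edge _) l2.
have p2 : present T e2 0 by apply: f2; rewrite -El.
apply: present_del => //; first by rewrite -El.
by case=> E; move: ne; rewrite E eqxx.
Qed.

(** Two gaps would isolate the segment between them from the rest of the tree. *)
Lemma missing_unique c c' : (c < len e2)%N -> (c' < len e2)%N ->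
  ~~ present T e2 c -> ~~ present T e2 c' -> c = c'.
Proof.
wlog cc' : c c' / (c < c')%N.
  move=> W cl cl' nc nc'; case: (ltngtP c c') => // h.
    exact: W.
  by apply/esym; exact: W.
move=> cl cl' nc nc'; exfalso.
have [El Et ne [c1 c2] ein] := pair_facts pe.
pose psi e k := (e == e2) && (c < k <= c')%N.
pose chi (s : branch_vertex) := false.
have l2 : (c.+1 < len e2)%N by exact: leq_ltn_trans cc' cl'.
have aH : at_edge e2 c.+1 \in sub_vertices H.
  have cl1 : (c < len e1)%N by rewrite El.
  exact: sub_edges_vertices (sub_edges_sym (ein c cl1).2).
have bH : at_edge e2 0 \in sub_vertices H.
  exact: sub_edges_vertices (ein 0%N (branch_len_gt0 v e1)).2.
have lnk : linked (cut_rel T set0 (fun=> 0%N)) (at_edge e2 c.+1) (at_edge e2 0).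
  apply: sub_linked (tree_linked tree aH bH) => x y /(tree_step tree)[e [k [kl E pr]]].
  by apply/asboolP; exists e, k.
have := cut_constant (chi := chi) (psi := psi) _ _ _ lnk.
move=> h; feed h; [|feed h; [|feed h]].
- by move=> e; rewrite /psi ltn0 andbF.
- move=> e; rewrite /psi; case: eqP => //= ->.
  by apply/negbTE/negP => /andP[_]; rewrite leqNgt cl'.
- move=> e k kl pr _; rewrite /psi; case: eqP => //= E; rewrite E in kl pr.
  have kc : k <> c by move=> E'; rewrite E' (negbTE nc) in pr.
  have kc' : k <> c' by move=> E'; rewrite E' (negbTE nc') in pr.
  lia.
have F k : (k <= len e2)%N -> profile (v := v) chi psi (at_edge e2 k) = psi e2 k.
  move=> kl; apply: profileE => //; rewrite /psi eqxx ?ltn0 //=.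
  by apply/negbTE/negP => /andP[_]; rewrite leqNgt cl'.
by move: h; rewrite !F // /psi eqxx ltnSn cc' ltn0.
Qed.

(** The gap of [e2] moves to the same position of [e1]; keeping the position makes the operation an
    involution. *)
Definition flip_at c :=
  swap T (at_edge e1 c) (at_edge e1 c.+1) (at_edge e2 c) (at_edge e2 c.+1).

Lemma present_flip_at c e k : (c < len e1)%N -> (k < len e)%N ->
  present (flip_at c) e k =
  present T e k && ((e, k) != (e1, c)) || ((e, k) == (e2, c)).
Proof.
move=> cl kl; have [El Et ne [c1 c2] ein] := pair_facts pe.
have cl2 : (c < len e2)%N by rewrite -El.
have se e' c' : (c' < len e')%N ->
    same_edge (at_edge e' c') (at_edge e' c'.+1) (at_edge e k) (at_edge e k.+1) =
    ((e, k) == (e', c')).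
  move=> cl'; apply/idP/eqP => [/(same_edge_ends cl' kl)[-> ->] //|[-> ->]].
  exact: same_edgexx.
by rewrite /present tree_rel_swap /exchange /add /del !se.
Qed.

Lemma flip_at_good c : (c < len e1)%N -> full T e1 -> ~~ present T e2 c ->
  [/\ spanning_trees H (flip_at c), good (flip_at c), full (flip_at c) e2,
      ~~ present (flip_at c) e1 c &
      forall e k, (k < len e)%N -> e != e1 -> e != e2 ->
        present (flip_at c) e k = present T e k].
Proof.
move=> cl f1 nc; have [El Et ne [c1 c2] ein] := pair_facts pe.
have cl2 : (c < len e2)%N by rewrite -El.
have f2 k : (k < len e2)%N -> k != c -> present T e2 k.
  move=> kl kc; apply: contraT => np.
  by rewrite (missing_unique kl cl2 np nc) eqxx in kc.
have pc := f1 c cl.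
have neq : at_edge e1 c != at_edge e1 c.+1.
  by apply: contraTneq pc => E; rewrite /present -E (tree_irr tree).
have oth e k : (k < len e)%N -> e != e1 -> e != e2 ->
    present (flip_at c) e k = present T e k.
  move=> kl n1 n2; rewrite present_flip_at // !xpair_eqE (negbTE n1) (negbTE n2).
  by rewrite andbT orbF.
have ff2 : full (flip_at c) e2.
  move=> k kl; rewrite present_flip_at // !xpair_eqE (eq_sym e2) (negbTE ne).
  rewrite eqxx /= andbT; have [->|kc] := eqVneq k c; first by rewrite orbT.
  by rewrite f2.
have [l1 l2] := pair_ends_linked cl (fun k kl _ => f1 k kl) f2.
have nl : ~ linked (del (tree_rel T) (at_edge e1 c) (at_edge e1 c.+1))
    (at_edge e2 c) (at_edge e2 c.+1).
  move=> l12; apply: (acyclic_edge (tree_sym tree) neq (tree_acyclic tree) pc).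
  exact: linked_trans l1 (linked_trans l12 l2).
split=> //.
- by apply: swap_tree => //; have [] := ein c cl.
- have np : forall n, (RayEdge n != e1) && (RayEdge n != e2).
    by move=> n; case: pe => -[-> ->].
  have [g1 g2 g3] := gd; split.
  + move=> n nn; have /andP[n1 n2] := np n.
    by rewrite oth //; exact: g1.
  + move=> t' i' m' vm' Lt'.
    have [E|nE] := eqVneq (TreeEdge t' i') p.
      move: E; rewrite /p => -[Et' Ei']; rewrite Et' Ei' in vm' *.
      have mm : m' = m by apply: (bij_inj (bfs_bij v)); rewrite vm' vm.
      rewrite mm; case: pe => -[E1 E2]; rewrite E2 in ff2.
        by right.
      by left.
    have nm : m' <> m.
      by move=> E; move: vm'; rewrite E vm => -[Ei Et']; rewrite /p Ei Et' eqxx in nE.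
    have nlk : LinkEdge m' != lk by apply/eqP => -[].
    have tp : TreeEdge t' i' != lk by [].
    have lp : LinkEdge m' != p by [].
    have oth2 e : e != p -> e != lk -> (e != e1) && (e != e2).
      by case: pe => -[-> ->] -> ->.
    have [f|f] := g2 t' i' m' vm' Lt'; [left|right] => k kl.
      by have /andP[n1 n2] := oth2 _ nE tp; rewrite oth //; exact: f.
    by have /andP[n1 n2] := oth2 _ lp nlk; rewrite oth //; exact: f.
  + move=> e k ie kl; apply: sub_linked (g3 e k ie kl) => x y.
    move=> /andP[xy /asboolP[e' [k' [ie' kl' E]]]].
    have pr : present T e' k'.
      by rewrite /present; case: E => -[<- <-] //; rewrite (tree_sym tree).
    have /andP[n1 n2] : (e' != e1) && (e' != e2).
      suff [h1 h2] : e' != p /\ e' != lk by case: pe => -[-> ->]; rewrite h1 h2.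
      split; apply: contraTneq ie' => -> /=; rewrite -leqNgt.
        by case/andP: Lt.
      by apply: leq_trans mt; apply: ball_size_mono; case/andP: Lt.
    have pr' : present (flip_at c) e' k' by rewrite oth.
    apply/andP; split; last by apply/asboolP; exists e', k'.
    have fs : symmetric (tree_rel (flip_at c)).
      move=> a b; rewrite !tree_rel_swap.
      exact: exchange_sym (tree_sym tree) _ _.
    by case: E => -[-> ->] //; rewrite fs.
- rewrite present_flip_at // eqxx andbF /= xpair_eqE (negbTE ne) //.
Qed.

End Pair.

End AtWord.

End Flips.

(** * Fair independent coins *)

Definition flip (w : ternary) (c : ternary -> bool) : ternary -> bool :=
  fun t => if t == w then ~~ c t else c t.

Lemma flip_neq w c t : t != w -> flip w c t = c t.
Proof. by rewrite /flip => /negbTE ->. Qed.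

Lemma flip_eq w c : flip w c w = ~~ c w.
Proof. by rewrite /flip eqxx. Qed.

Fixpoint descendants (j : nat) (s : seq ternary) : seq ternary :=
  if j is j'.+1 then [seq i :: t | t <- descendants j' s, i <- enum 'I_3] else s.

(** The [j] steps from [t] towards the root all have coin [true]. *)
Fixpoint reach (c : ternary -> bool) (j : nat) (t : ternary) : bool :=
  if j is j'.+1 then (if t is i :: s then c t && reach c j' s else false)
  else true.

Section Coins.
Context {R : realType} {X : eqType}.
Variables (s : seq X) (coin : X -> ternary -> bool) (L K : nat).

(** Not normalised: fairness is then an equality between sums over trees. *)
Definition avg (F : (ternary -> bool) -> R) : R := \sum_(x <- s) F (coin x).

Hypothesis fair : forall w F, (L < size w <= K)%N ->
  avg F = avg (fun c => F (flip w c)).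

Lemma avg_half w F : (L < size w <= K)%N ->
  avg F = avg (fun c => (F c + F (flip w c)) / 2).
Proof.
move=> wLK; have E := fair F wLK; rewrite /avg in E *.
by rewrite -mulr_suml big_split /= -E; field.
Qed.

(** The coins of [ws] are integrated out one at a time, each replacing [q] by the mean of 1 and [q];
    invariance of [b] and [Z] under the flips takes the place of conditional independence. *)
Lemma avg_coins (ws : seq ternary) (b : ternary -> (ternary -> bool) -> bool)
    (Z : (ternary -> bool) -> R) (q : R) :
  uniq ws -> (forall w, w \in ws -> (L < size w <= K)%N) ->
  (forall w t c, w \in ws -> t \in ws -> b t (flip w c) = b t c) ->
  (forall w c, w \in ws -> Z (flip w c) = Z c) ->
  avg (fun c => Z c * \prod_(w <- ws) (if c w && b w c then q else 1)) =
  avg (fun c => Z c * \prod_(w <- ws) (if b w c then (1 + q) / 2 else 1)).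
Proof.
elim: ws Z => [|w ws IH] Z /=; first by move=> *; apply: eq_bigr => x _; rewrite !big_nil.
move=> /andP[wNs us] LK bI ZI.
have wsI t : t \in ws -> t \in w :: ws by rewrite inE orbC => ->.
have tw t : t \in ws -> t != w by apply: contraTneq => ->.
have w_in : w \in w :: ws by rewrite inE eqxx.
transitivity (avg (fun c => (Z c * (if c w && b w c then q else 1)) *
    \prod_(w <- ws) (if b w c then (1 + q) / 2 else 1))).
  rewrite -IH //.
  - by apply: eq_bigr => x _; rewrite big_cons mulrA.
  - by move=> t tws; apply: LK; exact: wsI.
  - by move=> t t' c tws t'ws; apply: bI; exact: wsI.
  - move=> t c tws; rewrite ZI ?wsI // (bI t w c (wsI t tws) w_in).
    by rewrite flip_neq // eq_sym tw.
pose F1 c := (Z c * (if c w && b w c then q else 1)) *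
    \prod_(w <- ws) (if b w c then (1 + q) / 2 else 1).
rewrite -[LHS]/(avg F1) (avg_half F1 (LK w w_in)) /F1.
apply: eq_bigr => x _; rewrite big_cons.
set c := coin x; rewrite ZI // bI // flip_eq.
have -> : \prod_(w0 <- ws) (if b w0 (flip w c) then (1 + q) / 2 else 1) =
    \prod_(w0 <- ws) (if b w0 c then (1 + q) / 2 else 1).
  by apply: eq_big_seq => t tws; rewrite bI // wsI.
set P := \prod_(_ <- _) _.
by case: (c w); case: (b w c) => /=; field.
Qed.

Variable us : seq ternary.
Hypothesis us_uniq : uniq us.
Hypothesis us_size : forall u, u \in us -> size u = L.

Lemma size_descendants j t : t \in descendants j us -> size t = (L + j)%N.
Proof.
elim: j t => [|j IH] t /=; first by rewrite addn0; exact: us_size.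
by case/allpairsP=> -[t' i] /= [/IH t'L _ ->]; rewrite /= t'L addnS.
Qed.

Lemma descendants_uniq j : uniq (descendants j us).
Proof.
elim: j => [//|j IH]; apply: allpairs_uniq => //; first exact: enum_uniq.
by move=> [t i] [t' i'] _ _ /= [-> ->].
Qed.

Lemma reach_flip w c j t : (size t < size w)%N -> reach (flip w c) j t = reach c j t.
Proof.
elim: j t => [//|j IH] [//|i t] /= tw; rewrite IH ?(ltnW tw) //.
by rewrite flip_neq //; apply: contraTneq tw => <-; rewrite ltnn.
Qed.

(** The generating function of the [j]-th generation before averaging: [q] to the number of words
    attached to their ancestors in [us]. *)
Definition survival (q : R) j (c : ternary -> bool) : R :=
  \prod_(t <- descendants j us) (if reach c j t then q else 1).

(* A word has three children, each attached to it with probability 1/2. *)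
Definition extinction_step (q : R) : R := ((1 + q) / 2) ^+ 3.

Lemma avg_survival q j : (L + j < K)%N ->
  avg (survival q j.+1) = avg (survival (extinction_step q) j).
Proof.
move=> jK; pose ws := descendants j.+1 us.
pose b (t : ternary) (c : ternary -> bool) := reach c j (behead t).
have swd t : t \in ws -> size t = (L + j).+1.
  by move/size_descendants; rewrite addnS.
transitivity (avg (fun c => 1 * \prod_(w <- ws) (if c w && b w c then q else 1))).
  apply: eq_bigr => x _; rewrite mul1r; apply: eq_big_seq => t tws.
  by case: t tws => [/swd|i t].
rewrite avg_coins //.
- apply: eq_bigr => x _; rewrite mul1r /ws /= big_allpairs_dep /=.
  apply: eq_bigr => t _; rewrite big_enum /b /=.
  by rewrite prodr_const card_ord; case: ifP => // _; rewrite expr1n.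
- exact: descendants_uniq.
- by move=> w /swd ->; rewrite ltnS leq_addr jK.
- move=> w t c /swd sw /swd st; rewrite /b reach_flip // size_behead st sw //.
Qed.

Definition extinction j : R := iter j extinction_step 0.

(** The interval [0, 1/2] is invariant under [extinction_step], as [(3 / 4) ^ 3 = 27 / 64]. *)
Lemma extinction_le j : 0 <= extinction j <= 2^-1.
Proof.
elim: j => [|j /andP[q0 q1]]; first by rewrite lexx invr_ge0 ler0n.
rewrite /extinction iterS -/(extinction j) /extinction_step.
move: (extinction j) q0 q1 => q q0 q1.
have h0 : 0 <= (1 + q) / 2 by lra.
have h1 : (1 + q) / 2 <= 3 / 4 by lra.
rewrite exprn_ge0 //=; apply: le_trans (lerXn2r 3 _ _ h1) _; rewrite ?nnegrE //; lra.
Qed.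

(** At [q = 0] the generating function is the indicator of extinction; removing the generations one
    by one leaves a factor [extinction j] for each word of [us]. *)
Lemma avg_extinct j : (L + j <= K)%N ->
  avg (survival 0 j) <= avg (fun=> 1) * 2^-1 ^+ size us.
Proof.
have H i : (i <= j)%N -> (L + j <= K)%N ->
    avg (survival 0 j) = avg (survival (extinction i) (j - i)).
  elim: i => [|i IH] ij jK; first by rewrite subn0.
  rewrite IH ?(ltnW ij) // -[(j - i)%N]prednK ?subn_gt0 //.
  rewrite avg_survival; last by lia.
  by rewrite -subnS.
move=> jK; rewrite (H j) // subnn.
rewrite /avg mulr_suml; apply: ler_sum => x _; rewrite mul1r /survival /=.
have /andP[q0 q1] := extinction_le j.
rewrite big_const_seq count_predT iter_mulr_1.
by apply: lerXn2r; rewrite ?nnegrE ?invr_ge0.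
Qed.

Lemma survival0 j c : survival 0 j c =
  (~~ has (reach c j) (descendants j us))%:R.
Proof.
rewrite /survival; elim: (descendants j us) => [|t l IH]; first by rewrite big_nil.
by rewrite big_cons IH /=; case: (reach c j t); rewrite ?mul0r ?mul1r.
Qed.

End Coins.

(** * The coins of good trees *)

Section TreeCoins.
Context {R : realType} (v : bfs_enumeration).
Variable H : finite_subgraph (G v).
Variables L K : nat.
Implicit Types (T : {fset G v * G v}).

Notation src := branch_src.
Notation tgt := (branch_tgt v).
Notation len := (branch_len v).
Notation at_edge := (edge_vertex v).

Hypothesis HK : forall e k, in_ball K e -> (k < len e)%N -> edge_in H e k.

Definition tree_coin T (t : ternary) : bool :=
  if t is i :: s then `[< full T (TreeEdge s i) >] else false.

Section AtWord.
Variables (t : ternary) (i : 'I_3) (m : nat).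
Hypotheses (vm : v m = i :: t) (Lt : (L <= size t < K)%N).

Let p := TreeEdge t i.
Let lk := LinkEdge m.

(** In a good tree one path is full and the other has a single gap, so the first difference is that
    gap, whichever path has it. *)
Definition flip_index T : nat :=
  find (fun k => present T p k != present T lk k) (iota 0 (len p)).

Definition flip_tree T : {fset G v * G v} :=
  if tree_coin T (i :: t) then flip_at T p lk (flip_index T)
  else flip_at T lk p (flip_index T).

Lemma flip_treeE T e1 e2 c : spanning_trees H T -> good L K T ->
  pair_edge t i m e1 e2 -> full T e1 -> (c < len e1)%N -> ~~ present T e2 c ->
  flip_tree T = flip_at T e1 e2 c.
Proof.
move=> tree gd pe f1 cl nc.
have [El _ _ _ _] := pair_facts HK vm Lt pe.
have leq : len p = len lk by exact: len_eq.
have lp : len e1 = len p by case: pe => -[-> _].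
have dif k : (k < len p)%N -> (present T p k != present T lk k) = (k == c).
  move=> kl; have k1 : present T e1 k by apply: f1; rewrite lp.
  have k2 : present T e2 k = (k != c).
    have [->|kc] := eqVneq k c; first exact/negbTE.
    apply: contraT => np; have := missing_unique HK vm Lt tree pe _ _ np nc.
    by rewrite -El lp => /(_ kl); rewrite -lp => /(_ cl) E; rewrite E eqxx in kc.
  by case: pe k1 k2 => -[-> ->] -> ->; case: (k == c).
have -> : flip_tree T = if tree_coin T (i :: t) then flip_at T p lk c
                        else flip_at T lk p c.
  rewrite /flip_tree (_ : flip_index T = c) //.
  rewrite /flip_index lp in cl *.
  have hs : has (fun k => present T p k != present T lk k) (iota 0 (len p)).
    by apply/hasP; exists c; rewrite ?mem_iota // dif // eqxx.
  have := nth_find 0%N hs; set f := find _ _.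
  have fl : (f < len p)%N by rewrite -[X in (_ < X)%N](size_iota 0) -has_find.
  by rewrite nth_iota // add0n dif // => /eqP.
have nf2 : ~ full T e2 by move=> f2; case: (not_both_full HK vm Lt tree gd pe f1 f2).
case: pe f1 nf2 => -[-> ->] f1 nf2.
  by rewrite /tree_coin; case: asboolP.
by rewrite /tree_coin; case: asboolP.
Qed.

Lemma good_pair T : spanning_trees H T -> good L K T -> exists e1 e2 c,
  [/\ pair_edge t i m e1 e2, full T e1, (c < len e1)%N & ~~ present T e2 c].
Proof.
move=> tree gd; have [_ g2 _] := gd.
have [e1 [e2 [pe f1]]] : exists e1 e2, pair_edge t i m e1 e2 /\ full T e1.
  have [f|f] := g2 t i m vm Lt; first by exists p, lk; split=> //; left.
  by exists lk, p; split=> //; right.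
have [El _ _ _ _] := pair_facts HK vm Lt pe.
have [c cl nc] : exists2 c, (c < len e2)%N & ~~ present T e2 c.
  apply: contrapT => nk; apply: (not_both_full HK vm Lt tree gd pe f1) => k kl.
  by apply: contrapT => /negP np; apply: nk; exists k.
by exists e1, e2, c; rewrite El.
Qed.

Lemma flip_tree_good T : spanning_trees H T -> good L K T ->
  [/\ spanning_trees H (flip_tree T), good L K (flip_tree T),
      flip_tree (flip_tree T) = T &
      tree_coin (flip_tree T) = flip (i :: t) (tree_coin T)].
Proof.
move=> tree gd; have [e1 [e2 [c [pe f1 cl nc]]]] := good_pair tree gd.
have [El _ ne _ _] := pair_facts HK vm Lt pe.
rewrite (flip_treeE tree gd pe f1 cl nc).
have [tree' gd' f2 nc1 oth] := flip_at_good HK vm Lt tree gd pe cl f1 nc.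
have cl2 : (c < len e2)%N by rewrite -El.
have pe' : pair_edge t i m e2 e1 by case: pe => -[-> ->]; [right|left].
split=> //.
  rewrite (flip_treeE tree' gd' pe' f2 cl2 nc1); apply/fsetP => -[x y].
  rewrite -[LHS]/(tree_rel _ x y) /flip_at tree_rel_swap /exchange /add /del.
  rewrite tree_rel_swap /exchange /add /del.
  have [E|nE1] := boolP (same_edge (at_edge e1 c) (at_edge e1 c.+1) x y).
    rewrite orbT; have pc := f1 c cl; apply/esym.
    case/orP: E => /andP[/eqP -> /eqP ->]; first exact: pc.
    by rewrite -[LHS]/(tree_rel T _ _) (tree_sym tree).
  have [E|nE2] := boolP (same_edge (at_edge e2 c) (at_edge e2 c.+1) x y).
    rewrite andbF /=; apply/esym/negbTE; apply: contra nc => xy.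
    case/orP: E => /andP[/eqP xE /eqP yE]; rewrite /present -xE -yE //.
    by rewrite (tree_sym tree).
  by rewrite !andbT !orbF.
apply/funext => -[//|j s]; have [E|nE] := eqVneq (j :: s) (i :: t).
  rewrite E flip_eq /tree_coin.
  have nf1 : ~ full (flip_at T e1 e2 c) e1 by move=> /(_ c cl); rewrite (negbTE nc1).
  have nf2 : ~ full T e2 by move=> /(_ c cl2); rewrite (negbTE nc).
  case: pe f1 f2 nf1 nf2 {tree' gd' oth nc1} => -[-> ->] f1 f2 nf1 nf2.
    by do 2 case: asboolP.
  by do 2 case: asboolP.
rewrite flip_neq // /tree_coin.
have nep : TreeEdge s j != p by apply: contra_neq nE => -[-> ->].
have /andP[n1 n2] : (TreeEdge s j != e1) && (TreeEdge s j != e2).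
  by case: pe => -[-> ->]; rewrite nep.
apply/asboolP/asboolP => f k kl; have := f k kl; by rewrite oth.
Qed.

End AtWord.

Definition good_trees := trees H (good L K).

(** [flip_tree] is an involution of the good trees that changes the coin at [w] and no other. *)
Lemma tree_coins_fair w (F : (ternary -> bool) -> R) : (L < size w <= K)%N ->
  avg good_trees tree_coin F = avg good_trees tree_coin (fun c => F (flip w c)).
Proof.
case: w => [//|i t] /= Lt; have [w vK wK] := bfs_bij v.
have vm : v (w (i :: t)) = i :: t by exact: wK.
pose Phi := flip_tree t i (w (i :: t)).
have memG T : T \in good_trees -> spanning_trees H T /\ good L K T.
  by rewrite mem_trees => /asboolP.
have spec T : T \in good_trees -> [/\ Phi T \in good_trees, Phi (Phi T) = T &
    tree_coin (Phi T) = flip (i :: t) (tree_coin T)].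
  move=> /memG[tree gd]; have [h1 h2 h3 h4] := flip_tree_good vm Lt tree gd.
  by split=> //; rewrite mem_trees; apply/asboolP.
rewrite /avg; transitivity (\sum_(T <- map Phi good_trees) F (tree_coin T)).
  apply: perm_big; apply: uniq_perm; first exact: fset_uniq.
    rewrite map_inj_in_uniq ?fset_uniq // => T T' /spec[_ E _] /spec[_ E' _] EE.
    by rewrite -E -E' EE.
  move=> T; apply/idP/mapP => [TG|[T' /spec[h _ _] ->] //].
  by have [h E _] := spec T TG; exists (Phi T).
rewrite big_map; apply: eq_big_seq => T /spec[_ _ ->] //.
Qed.

End TreeCoins.

(** * Probability of the exceptional configurations *)

Section Exceptional.
Context {R : realType} (v : bfs_enumeration).

Notation src := branch_src.
Notation tgt := (branch_tgt v).
Notation len := (branch_len v).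
Notation at_edge := (edge_vertex v).

(* On the edge set of a tree these are [present], [ball_rel] and [tree_coin] by
   conversion; the weak limit is a law on arbitrary configurations. *)
Definition config_present (T : G v * G v -> bool) e k : bool :=
  T (at_edge e k, at_edge e k.+1).

Definition config_ball_rel (T : G v * G v -> bool) l : rel (G v) := fun x y =>
  edge_rel T x y &&
  `[< exists e k, [/\ in_ball l e, (k < len e)%N & ends_of e k x y] >].

Definition config_coin (T : G v * G v -> bool) (t : ternary) : bool :=
  if t is i :: s then
    `[< forall k, (k < len (TreeEdge s i))%N -> config_present T (TreeEdge s i) k >]
  else false.

Definition ball_connected (T : G v * G v -> bool) l : Prop :=
  forall e k, in_ball l e -> (k < len e)%N ->
    linked (config_ball_rel T l) (at_edge e k) (at_edge e k.+1).

(** Children extend a word at its head, so the level-[L] descendants of [a] have it as a suffix. *)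
Definition family (L M : nat) (a : ternary) : seq ternary :=
  [seq x ++ a | x <- words (L - M)].

Definition extinct (T : G v * G v -> bool) L M K a : bool :=
  ~~ has (reach (config_coin T) (K - L)) (descendants (K - L) (family L M a)).

(** Extinction is tested up to level [K] only, so that the event depends on the edges of a ball. *)
Definition exceptional (T : G v * G v -> bool) L M K : Prop :=
  ~ ball_connected T L \/ exists2 a, a \in words M & extinct T L M K a.

Lemma family_uniq L M a : uniq (family L M a).
Proof.
rewrite map_inj_uniq ?words_uniq // => x y.
elim: x y => [|i x IH] [|j y] //= E.
- by have := congr1 size E; rewrite /= size_cat => /eqP; lia.
- by have := congr1 size E; rewrite /= size_cat => /eqP; lia.
- by case: E => -> /IH ->.
Qed.

Lemma size_family L M a : size (family L M a) = (3 ^ (L - M))%N.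
Proof. by rewrite size_map size_words. Qed.

Lemma size_in_family L M a u : (M <= L)%N -> a \in words M ->
  u \in family L M a -> size u = L.
Proof.
move=> ML; rewrite mem_words => /eqP aM /mapP[x].
by rewrite mem_words => /eqP xL ->; rewrite size_cat xL aM subnK.
Qed.

Definition ball_edges l : seq branch_edge :=
  [seq TreeEdge (v n) i | n <- iota 0 (ball_size l), i <- enum 'I_3] ++
  [seq RayEdge n | n <- iota 0 (ball_size l)] ++
  [seq LinkEdge n | n <- iota 0 (ball_size l)].

Lemma mem_ball_edges l e : in_ball l e -> e \in ball_edges l.
Proof.
rewrite !mem_cat; case: e => [s i|n|n] inb.
- apply/orP; left; apply/allpairsP; have [w vK wK] := bfs_bij v.
  exists (w s, i); rewrite /= wK mem_enum; split=> //.
  by rewrite mem_iota /= -(bfs_ballE v) wK ltnW.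
- by apply/orP; right; apply/orP; left; apply: map_f; rewrite mem_iota.
- by apply/orP; right; apply/orP; right; apply: map_f; rewrite mem_iota.
Qed.

Lemma len_in_ball l e : in_ball l e -> (len e <= D l)%N.
Proof.
case: e => [s i|n|n] /=; first by move=> sl; exact: D_mono.
  by move=> _; exact: D_gt0.
by rewrite -(bfs_ballE v) => /D_mono.
Qed.

Section Finite.
Variable H : finite_subgraph (G v).
Variables L K : nat.
Hypothesis LK : (L <= K)%N.
Hypothesis HK : forall e k, in_ball K e -> (k < len e)%N -> edge_in H e k.

Notation cnt := (@cnt R v H).
Notation total := (@total R v H).

Lemma in_ballS e : in_ball L e -> in_ball K e.
Proof.
have bLK := ball_size_mono LK.
by case: e => [s i|n|n] /= h; apply: leq_trans h _.
Qed.

Lemma pow23 n : (2 ^ n <= 3 ^ n)%N.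
Proof. by case: n => // n; rewrite leq_exp2r. Qed.

Lemma cnt_rays_missing :
  cnt (fun T => exists2 n, n \in index_iota (ball_size L) (ball_size K) &
    ~~ present T (RayEdge n) 0) <= total * (2 * 2 ^- L).
Proof.
apply: le_trans (cnt_seq _ _ _) _.
apply: (@le_trans _ _ (\sum_(ball_size L <= n < ball_size K) total * 2 ^- n)).
  rewrite big_seq [leRHS]big_seq; apply: ler_sum => n.
  rewrite mem_index_iota => /andP[_ nK]; apply: cnt_ray_missing.
  exact: HK.
rewrite -mulr_sumr ler_wpM2l ?total_ge0 //.
apply: (@le_trans _ _ (2 * \sum_(ball_size L <= n < ball_size K) 2 ^- n.+1)).
  rewrite mulr_sumr; apply: ler_sum => n _.
  by rewrite exprS invfM mulrA mulfV ?mul1r.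
rewrite ler_pM2l //; apply: le_trans (geometric_tail _ _) _.
rewrite lef_pV2 ?posrE ?exprn_gt0 // -!natrX ler_nat leq_exp2l //.
exact: ltnW (ball_size_gt L).
Qed.

Lemma cnt_words_detached :
  cnt (fun T => exists2 j, j \in index_iota L K & exists2 ti : ternary * 'I_3,
    ti \in [seq (t, i) | t <- words j, i <- enum 'I_3] &
    exists2 m, v m = ti.2 :: ti.1 &
      ~ full T (TreeEdge ti.1 ti.2) /\ ~ full T (LinkEdge m)) <=
  total * 2 ^- L.
Proof.
apply: le_trans (cnt_seq _ _ _) _.
apply: (@le_trans _ _ (\sum_(L <= j < K) total * 2 ^- j.+1)).
  rewrite big_seq [leRHS]big_seq; apply: ler_sum => j.
  rewrite mem_index_iota => /andP[_ jK].
  apply: le_trans (cnt_seq _ _ _) _.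
  have d0 : 0 < (D j.+1)%:R :> R by rewrite ltr0n D_gt0.
  apply: (@le_trans _ _ (\sum_(ti <- [seq (t, i) | t <- words j, i <- enum 'I_3])
      total * (3 / (D j.+1)%:R ^+ 2))).
    rewrite big_seq [leRHS]big_seq; apply: ler_sum => ti /allpairsP[[t i] [tj _ ->]].
    move: tj; rewrite mem_words => /eqP tj; have [w vK wK] := bfs_bij v.
    have vm : v (w (i :: t)) = i :: t by exact: wK.
    rewrite -tj; apply: le_trans (cnt_word_detached vm (H := H) _).
      apply: cnt_le => T _ [m /= vm' [h1 h2]]; split=> //.
      by rewrite (_ : w _ = m) //; apply: (bij_inj (bfs_bij v)); rewrite vm.
    by move=> k; apply: HK; rewrite /= tj.
  rewrite big_const_seq count_predT size_allpairs size_words size_enum_ord.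
  rewrite iter_addr_0 -[leLHS]mulr_natr -mulrA ler_wpM2l ?total_ge0 //.
  apply: (@le_trans _ _ (level_delta j.+1)).
    rewrite /level_delta -expnSr [(3 ^ j.+2)%N]expnS natrM le_eqVlt; apply/orP; left.
    by apply/eqP; field; rewrite gt_eqF.
  apply: le_trans (delta_le _) _.
  by rewrite lef_pV2 ?posrE ?ltr0n ?expn_gt0 ?exprn_gt0 // -natrX ler_nat pow23.
by rewrite -mulr_sumr ler_wpM2l ?total_ge0 // geometric_tail.
Qed.

(** Union bound over at most [5 * ball_size L * D L] unit edges, 5 for the three child paths, the
    ray edge and the link of each index; each is split in a proportion at most [3 ^ L.+1 / D L ^ 3]
    of the trees. *)
Lemma cnt_balls_split :
  cnt (fun T => ~ ball_connected (fun e => e \in T) L) <= total * (3 * 2 ^- L).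
Proof.
pose E := ball_edges L.
pose I := [seq (e, k) | e <- E, k <- iota 0 (D L)].
pose F (ek : branch_edge * nat) T := in_ball L ek.1 /\ (ek.2 < len ek.1)%N /\
  ~ linked (ball_rel T L) (at_edge ek.1 ek.2) (at_edge ek.1 ek.2.+1).
apply: (@le_trans _ _ (\sum_(ek <- I) cnt (F ek))).
  apply: le_trans (cnt_seq _ _ _); apply: cnt_le => T tT nc.
  apply: contrapT => nF; apply: nc => e k inb kl; apply: contrapT => nl.
  apply: nF; exists (e, k) => //; apply/allpairsP; exists (e, k).
  by rewrite mem_ball_edges // mem_iota (leq_trans kl) ?len_in_ball.
pose c : R := (3 ^ L.+1)%:R / (D L.+1)%:R.
have c0 : 0 <= c by rewrite divr_ge0.
apply: (@le_trans _ _ (\sum_(ek <- I) total * c)).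
  apply: ler_sum => -[e k] _.
  have [inb|nin] := boolP (in_ball L e); last first.
    rewrite (_ : cnt _ = 0) ?mulr_ge0 ?total_ge0 //.
    apply/eqP; rewrite pnatr_eq0 cardfs_eq0; apply/eqP/fsetP => T.
    by rewrite mem_trees inE; apply/negbTE/asboolPn => -[_ [/=]]; rewrite (negbTE nin).
  have [kl|kl] := ltnP k (len e); last first.
    rewrite (_ : cnt _ = 0) ?mulr_ge0 ?total_ge0 //.
    apply/eqP; rewrite pnatr_eq0 cardfs_eq0; apply/eqP/fsetP => T.
    by rewrite mem_trees inE; apply/negbTE/asboolPn => -[_ [/= _ []]]; rewrite ltnNge kl.
  apply: le_trans (cnt_ball_split inb kl (HK (in_ballS inb) kl)).
  by apply: cnt_le => T _ [_ []].
rewrite big_const_seq count_predT iter_addr_0 -[leLHS]mulr_natr -mulrA.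
rewrite ler_wpM2l ?total_ge0 //.
have -> : size I = (5 * ball_size L * D L)%N.
  rewrite size_allpairs /E /ball_edges !size_cat size_allpairs size_enum_ord !size_map.
  rewrite !size_iota.
  by congr (_ * _)%N; lia.
have d0 : 0 < (D L)%:R :> R by rewrite ltr0n D_gt0.
have b3 : (5 * ball_size L <= 3 ^ L.+2)%N.
  by have := ball_size2_lt L; rewrite [(3 ^ L.+2)%N]expnS; lia.
have cE : c * (5 * ball_size L * D L)%:R =
    (3 ^ L.+1 * (5 * ball_size L))%:R / (D L)%:R ^+ 2.
  rewrite /c DS [(D L ^ 3)%:R]natrX !natrM; field.
  by rewrite gt_eqF.
rewrite cE ler_pdivrMr ?exprn_gt0 //.
rewrite mulrAC ler_pdivlMr ?exprn_gt0 // -!natrX -!natrM ler_nat.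
have h1 : (3 ^ L.+1 * (5 * ball_size L) * 2 ^ L <= 3 ^ L.+1 * 3 ^ L.+2 * 3 ^ L)%N.
  by rewrite leq_mul ?pow23 // leq_mul.
apply: leq_trans h1 _.
have h2 := D_ge2 L; have h3 : (3 ^ L.+1 * 3 ^ L <= D L ^ 2)%N.
  by apply: leq_trans h2 _; rewrite expnS expn1 leq_pmulr // D_gt0.
have h4 : (3 ^ L.+1 <= D L)%N := D_ge L.
rewrite (_ : 3 ^ L.+1 * 3 ^ L.+2 * 3 ^ L =
             3 * ((3 ^ L.+1 * 3 ^ L) * 3 ^ L.+1))%N; last first.
  by rewrite [(3 ^ L.+2)%N]expnS; ring.
by rewrite leq_mul2l /= -mulnn leq_mul.
Qed.

Lemma cnt_not_good : cnt (fun T => ~ good L K T) <= total * (6 * 2 ^- L).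
Proof.
have := cnt_rays_missing; have := cnt_words_detached; have := cnt_balls_split.
set P3 := (fun T => ~ _); set P2 := (fun T => exists2 j, _ & _).
set P1 := (fun T => exists2 n, _ & _) => h3 h2 h1.
apply: (@le_trans _ _ (cnt (P1 `|` (P2 `|` P3)))).
  apply: cnt_le => T _ ng; apply: contrapT => /not_orP[n1 /not_orP[n2 n3]].
  apply: ng; split.
  - move=> n nn; apply: contrapT => /negP np; apply: n1; exists n => //.
    by rewrite mem_index_iota.
  - move=> t i m vm Lt; apply: contrapT => /not_orP[f1 f2]; apply: n2.
    exists (size t); first by rewrite mem_index_iota.
    exists (t, i); last by exists m.
    by apply/allpairsP; exists (t, i); rewrite mem_words mem_enum.
  - by move/contrapT: n3.
have := @cntU R v H P1 (P2 `|` P3); have := @cntU R v H P2 P3.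
lra.
Qed.

Lemma cnt_extinct M a : (M <= L)%N -> a \in words M ->
  cnt (fun T => good L K T /\ extinct (fun e => e \in T) L M K a) <=
  total * 2^-1 ^+ (3 ^ (L - M)).
Proof.
move=> ML aM.
have fair := @tree_coins_fair R v H L K HK.
have us_size u := size_in_family ML aM (u := u).
have := avg_extinct fair (family_uniq L M a) us_size (j := K - L).
rewrite subnKC // leqnn => /(_ isT).
rewrite size_family; set A1 := avg _ _ (survival _ _ _); set A2 := avg _ _ _ => AA.
apply: (@le_trans _ _ A1).
  rewrite /A1 /avg; under eq_bigr do rewrite survival0.
  rewrite -natr_sum ler_nat -big_mkcond /= sum1_count -size_filter.
  apply: uniq_leq_size => [|T]; first exact: fset_uniq.
  rewrite mem_filter !mem_trees => /asboolP[tT [gT eT]].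
  by apply/andP; split=> //; apply/asboolP.
apply: le_trans AA _; rewrite ler_wpM2r ?exprn_ge0 ?invr_ge0 //.
rewrite /A2 /avg big_const_seq count_predT iter_addr_0 ler_nat.
by apply: fsubset_leq_card; apply/fsubsetP => T; rewrite !mem_trees => /asboolP[tT _];
  apply/asboolP.
Qed.

Lemma cnt_exceptional M : (M <= L)%N ->
  cnt (fun T => exceptional (fun e => e \in T) L M K) <=
  total * (6 * 2 ^- L + (3 ^ M)%:R * 2^-1 ^+ (3 ^ (L - M))).
Proof.
move=> ML; pose P1 (T : {fset G v * G v}) := ~ good L K T.
pose P2 T := exists2 a, a \in words M &
  good L K T /\ extinct (fun e => e \in T) L M K a.
have h : cnt (fun T => exceptional (fun e => e \in T) L M K) <= cnt (P1 `|` P2).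
  apply: cnt_le => T _ ex; have [g|ng] := pselect (good L K T); last by left.
  right; case: ex => [nc|[a aM ea]]; last by exists a.
  by case: nc; case: g.
apply: le_trans h _; apply: le_trans (@cntU R v H P1 P2) _; rewrite mulrDr lerD ?cnt_not_good //.
apply: le_trans (cnt_seq _ _ _) _.
apply: (@le_trans _ _ (\sum_(a <- words M) total * 2^-1 ^+ (3 ^ (L - M)))).
  by rewrite big_seq [leRHS]big_seq; apply: ler_sum => a aM; exact: cnt_extinct.
rewrite big_const_seq count_predT size_words iter_addr_0 -[leLHS]mulr_natr.
by rewrite -mulrA [_ * (3 ^ M)%:R]mulrC.
Qed.

End Finite.
End Exceptional.

(** * Passing to the weak limit *)

Section WeakLimitBound.
Context {R : realType} (v : bfs_enumeration).

Notation len := (branch_len v).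
Notation at_edge := (edge_vertex v).
Notation conf := (configuration (G v)).

Definition agree K (T T' : G v * G v -> bool) : Prop :=
  forall e k, in_ball K e -> (k < len e)%N ->
    T (at_edge e k, at_edge e k.+1) = T' (at_edge e k, at_edge e k.+1) /\
    T (at_edge e k.+1, at_edge e k) = T' (at_edge e k.+1, at_edge e k).

Lemma agree_sym K T T' : agree K T T' -> agree K T' T.
Proof. by move=> A e k ie kl; have [-> ->] := A e k ie kl. Qed.

Lemma agree_ball_rel K L T T' : (L <= K)%N -> agree K T T' ->
  subrel (config_ball_rel T L) (config_ball_rel T' L).
Proof.
move=> LK A x y /andP[xy /asboolP[e [k [ie kl E]]]].
apply/andP; split; last by apply/asboolP; exists e, k.
have [A1 A2] := A e k (in_ballS LK ie) kl.
by move: xy; rewrite /edge_rel; case: E => -[-> ->]; rewrite ?A1 ?A2.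
Qed.

Lemma agree_coin K T T' t : agree K T T' -> (size t <= K)%N ->
  config_coin T t = config_coin T' t.
Proof.
case: t => [//|i s] A sK; rewrite /config_coin.
by apply/asboolP/asboolP => H k kl; have := H k kl;
  rewrite /config_present; have [-> _] := A (TreeEdge s i) k sK kl.
Qed.

Lemma agree_reach K T T' j t : agree K T T' -> (size t <= K)%N ->
  reach (config_coin T) j t = reach (config_coin T') j t.
Proof.
move=> A; elim: j t => [//|j IH] [//|i s] tK.
rewrite /= IH ?(ltnW tK) //; congr (_ && _).
exact: (agree_coin A tK).
Qed.

Lemma agree_exceptional K L M T T' : (M <= L <= K)%N -> agree K T T' ->
  exceptional T L M K -> exceptional T' L M K.
Proof.
move=> /andP[ML LK] A [nc|[a aM ea]]; [left|right].
  move=> c; apply: nc => e k ie kl.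
  by apply: sub_linked (c e k ie kl); apply: agree_ball_rel LK (agree_sym A).
exists a => //; move: ea; rewrite /extinct; congr (~~ _).
apply: eq_in_has => t td; apply: (agree_reach _ A).
rewrite (size_descendants (fun u => size_in_family ML aM (u := u)) td) subnKC //.
Qed.

Definition ball_pairs l : seq (branch_edge * nat) :=
  [seq (e, k) | e <- ball_edges v l, k <- iota 0 (D l)].

Lemma mem_ball_pairs l e k : in_ball l e -> (k < len e)%N ->
  (e, k) \in ball_pairs l.
Proof.
move=> ie kl; apply/allpairsP; exists (e, k).
by rewrite mem_ball_edges // mem_iota (leq_trans kl) ?len_in_ball.
Qed.

Lemma near_seq (I : eqType) (X : Type) (F : set_system X) (s : seq I)
    (Q : I -> set X) : Filter F -> (forall i, i \in s -> F (Q i)) ->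
  F [set x | forall i, i \in s -> Q i x].
Proof.
move=> FF; elim: s => [|i s IH] H; first by apply: filterE => x j; rewrite in_nil.
have H1 : F (Q i) by apply: H; rewrite inE eqxx.
have H2 : F [set x | forall i, i \in s -> Q i x].
  by apply: IH => j js; apply: H; rewrite inE js orbT.
apply: filterS2 H1 H2 => x h1 h2 j.
by rewrite inE => /orP[/eqP ->|/h2].
Qed.

Lemma eval_near (p : G v * G v) (T : conf) :
  nbhs T [set T' : conf | (T' : G v * G v -> bool) p = (T : G v * G v -> bool) p].
Proof.
apply: (@proj_continuous _ (fun _ : G v * G v => bool) p T
  [set b | b = (T : G v * G v -> bool) p]).
by rewrite nbhs_principalE; apply/principal_filterP.
Qed.

Lemma near_agree K (T : conf) : nbhs T [set T' : conf | agree K T T'].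
Proof.
have : nbhs T [set T' : conf | forall ek, ek \in ball_pairs K ->
    (T' : G v * G v -> bool) (at_edge ek.1 ek.2, at_edge ek.1 ek.2.+1) =
    (T : G v * G v -> bool) (at_edge ek.1 ek.2, at_edge ek.1 ek.2.+1) /\
    (T' : G v * G v -> bool) (at_edge ek.1 ek.2.+1, at_edge ek.1 ek.2) =
    (T : G v * G v -> bool) (at_edge ek.1 ek.2.+1, at_edge ek.1 ek.2)].
  by apply: near_seq => ek _; apply: filterI; exact: eval_near.
apply: filterS => T' A e k ie kl.
by have [-> ->] := A (e, k) (mem_ball_pairs ie kl).
Qed.

Definition exceptional_set L M K : set conf := [set T | exceptional T L M K].

Section Cylinder.
Variables (L M K : nat).
Hypothesis MLK : (M <= L <= K)%N.

Lemma exceptional_open : open (exceptional_set L M K).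
Proof.
rewrite openE => T ex; rewrite /interior; apply: filterS (near_agree K T) => T' A.
exact: agree_exceptional MLK A ex.
Qed.

Lemma exceptional_measurable :
  measurable (exceptional_set L M K : set (configuration_borel (G v))).
Proof. exact: sub_gen_smallest exceptional_open. Qed.

(** The event is decided by the edges of the ball of level [K], so its indicator is locally
    constant. *)
Lemma exceptional_continuous :
  continuous (\1_(exceptional_set L M K) : conf -> R^o).
Proof.
move=> T; apply: cvg_near_cst; apply: filterS (near_agree K T) => T' A.
rewrite /indic; congr (_%:R); congr nat_of_bool; apply/idP/idP; rewrite !inE.
  exact: agree_exceptional MLK (agree_sym A).
exact: agree_exceptional MLK A.
Qed.

Definition exceptional_bound : R := 6 * 2 ^- L + (3 ^ M)%:R * 2^-1 ^+ (3 ^ (L - M)).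

Lemma exceptional_bound_ge0 : 0 <= exceptional_bound.
Proof. by rewrite addr_ge0 // mulr_ge0 // ?invr_ge0 ?exprn_ge0 ?invr_ge0. Qed.

Lemma ust_mean_exceptional (H : finite_subgraph (G v)) :
  (forall e k, in_ball K e -> (k < len e)%N -> edge_in H e k) ->
  ust_mean H (\1_(exceptional_set L M K) : conf -> R) <= exceptional_bound.
Proof.
move=> HK; have /andP[ML LK] := MLK.
have fin := @finite_spanning_trees _ H.
rewrite /ust_mean (fsbig_finite _ _ fin).
(* Without spanning trees the mean is 0, by the convention for division by 0. *)
have [->|n0] := eqVneq (#|` fset_set (spanning_trees H)|) 0%N.
  by rewrite invr0 mulr0 exceptional_bound_ge0.
rewrite ler_pdivrMr ?ltr0n ?lt0n //.
have := @cnt_exceptional R v H L K LK HK M ML.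
rewrite /total /count_trees /trees setIT mulrC; apply: le_trans.
rewrite /cnt -natr_sum ler_nat /indic.
rewrite -big_mkcond /= sum1_count -size_filter.
apply: uniq_leq_size => [|T]; first exact/filter_uniq/fset_uniq.
rewrite mem_filter => /andP[]; rewrite inE => ex.
rewrite in_fset_set //.
rewrite inE => tT; rewrite in_fset_set; last exact: finite_setIl fin.
by apply/mem_set; split.
Qed.

Lemma exhaustion_near (H : nat -> finite_subgraph (G v)) : exhaustion H ->
  \forall n \near \oo,
    forall e k, in_ball K e -> (k < len e)%N -> edge_in (H n) e k.
Proof.
move=> [_ inc _ ex].
have mono n m : (n <= m)%N -> (sub_edges (H n) `<=` sub_edges (H m))%fset.
  move=> /subnKC <-; elim: (m - n)%N => [|i IH]; first by rewrite addn0.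
  by rewrite addnS; apply: fsubset_trans IH _; case: (inc (n + i)%N).
have : \forall n \near \oo, forall ek, ek \in ball_pairs K ->
    (ek.2 < len ek.1)%N -> edge_in (H n) ek.1 ek.2.
  apply: near_seq => -[e k] _ /=.
  have [kl|_] := ltnP k (len e); last by near=> n.
  have [m mP] := ex _ _ (at_edge_adj kl); exists m => // n mn _.
  by apply: (fsubsetP (mono m n mn)).
apply: filterS => n A e k ie kl.
by apply: (A (e, k)) => //; exact: mem_ball_pairs.
Unshelve. all: by end_near.
Qed.

Lemma mu_exceptional (mu : probability (configuration_borel (G v)) R) :
  is_ust mu -> (mu (exceptional_set L M K) <= exceptional_bound%:E)%E.
Proof.
case=> H exH lim.
have := lim _ exceptional_continuous _.
move=> h; feed h.
  exists 1 => T; rewrite /indic; case: (_ \in _).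
    by rewrite normr1.
  by rewrite normr0 ler01.
move: h; rewrite integral_indic //; last exact: exceptional_measurable.
rewrite setIT => h.
apply: (cvge_to_le h); apply: filterS (exhaustion_near exH) => n HK.
by rewrite lee_fin; exact: ust_mean_exceptional.
Qed.

End Cylinder.

(** A line of descent to level [K.+1] passes through level [K]. *)
Lemma exceptional_incr L M K : (M <= L <= K)%N ->
  exceptional_set L M K `<=` exceptional_set L M K.+1.
Proof.
move=> /andP[ML LK] T [nc|[a aM ea]]; [by left|right; exists a => //].
move: ea; rewrite /extinct subSn //=; apply: contra => /hasP[t].
case/allpairsP=> -[s i] /= [sd _ ->] /andP[_ rs].
by apply/hasP; exists s.
Qed.

Lemma bound_cvg0 M (e : R) : 0 < e ->
  exists2 L, (M <= L)%N & exceptional_bound L M <= e.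
Proof.
move=> e0; pose n := Num.truncn ((6 + (3 ^ M)%:R) / e).
exists (M + n)%N; first exact: leq_addr.
have nE : (6 + (3 ^ M)%:R) / e <= (2 ^ n)%:R.
  apply: le_trans (ltW (truncnS_gt _)) _; rewrite ler_nat; exact: ltn_expl.
have h : (6 + (3 ^ M)%:R) * 2 ^- n <= e.
  by rewrite ler_pdivrMr ?exprn_gt0 // mulrC -ler_pdivrMr // -natrX.
apply: le_trans h; rewrite /exceptional_bound.
rewrite [leRHS](_ : _ = 6 * 2 ^- n + (3 ^ M)%:R * 2 ^- n); last by ring.
apply: lerD.
  rewrite ler_pM2l // lef_pV2 ?posrE ?exprn_gt0 // -!natrX ler_nat leq_exp2l //.
  exact: leq_addl.
rewrite ler_wpM2l // addKn exprVn lef_pV2 ?posrE ?exprn_gt0 // -!natrX ler_nat leq_exp2l //.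
exact/ltnW/ltn_expl.
Qed.

(** The bound is uniform in [K], so it holds for the increasing union over [K]; it tends to 0 with
    [L], so the intersection over [L] is null for each [M]. *)
Theorem ust_not_exceptional (mu : probability (configuration_borel (G v)) R) :
  is_ust mu -> {ae mu, forall T, forall M, exists2 L, (M <= L)%N &
    forall K, (L <= K)%N -> ~ exceptional T L M K}.
Proof.
move=> ust.
pose B M L := \bigcup_j exceptional_set L M (L + j).
have mE L M j : (M <= L)%N ->
    measurable (exceptional_set L M (L + j) : set (configuration_borel (G v))).
  by move=> ML; apply: exceptional_measurable; rewrite ML leq_addr.
have mB M L : (M <= L)%N -> measurable (B M L : set (configuration_borel (G v))).
  by move=> ML; apply: bigcupT_measurable => j; exact: mE.
have leB M L : (M <= L)%N -> (mu (B M L) <= (exceptional_bound L M)%:E)%E.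
  move=> ML.
  have cv := @nondecreasing_cvg_mu _ (configuration_borel (G v)) R mu
    (fun j => exceptional_set L M (L + j)) (fun j => mE L M j ML) (mB M L ML).
  feed cv.
    apply/nondecreasing_seqP => j; apply/subsetPset; rewrite addnS.
    by apply: exceptional_incr; rewrite ML leq_addr.
  apply: (cvge_to_le cv); apply: nearW => j /=; apply: mu_exceptional => //.
  by rewrite ML leq_addr.
pose A M := \bigcap_(L in [set L | (M <= L)%N]) B M L.
have mA M : measurable (A M : set (configuration_borel (G v))).
  by apply: bigcap_measurable => [|L ML]; [exists M => /=|exact: mB].
have A0 M : mu (A M) = 0%E.
  apply/eqP; rewrite eq_le measure_ge0 andbT.
  apply/lee_addgt0Pr => e e0; rewrite add0e.
  have [L ML Le] := bound_cvg0 M e0.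
  apply: le_trans (_ : mu (B M L) <= _)%E.
    apply: le_measure; rewrite ?inE //; first exact: mB.
    by move=> T; apply.
  by apply: le_trans (leB M L ML) _; rewrite lee_fin.
have : mu.-negligible (\bigcup_M A M).
  by apply: negligible_bigcup => M; exists (A M); split; [exact: mA|exact: A0|move=> x].
apply: negligibleS => T /= nT; apply: contrapT => nA; apply: nT => M.
apply: contrapT => nL; apply: nA; exists M => // L /= ML.
apply: contrapT => nB; apply: nL; exists L => // K LK ex.
by apply: nB; exists (K - L)%N => //; rewrite /exceptional_set /= subnKC.
Qed.

End WeakLimitBound.

(** * Rays of a configuration without exceptional events *)

Lemma mem_descendants j s t : t \in descendants j s ->
  exists2 u, u \in s & exists2 x, size x = j & t = x ++ u.
Proof.
elim: j t => [|j IH] t /=; first by move=> ts; exists t => //; exists [::].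
case/allpairsP=> -[t' i] /= [/IH[u us [x xj ->]] _ ->].
by exists u => //; exists (i :: x); rewrite /= ?xj.
Qed.

(** The finite step of König's lemma, applied to the families and to the children of a word. *)
Lemma pigeonhole (I : eqType) (s : seq I) (Q : nat -> I -> Prop) :
  (forall j i, Q j.+1 i -> Q j i) -> (forall j, exists2 i, i \in s & Q j i) ->
  exists2 i, i \in s & forall j, Q j i.
Proof.
move=> dec; have decr j k i : (j <= k)%N -> Q k i -> Q j i.
  by move=> /subnKC <-; elim: (k - j)%N => [|n IH]; rewrite ?addn0 // addnS => /dec.
elim: s => [|i s IH] H; first by have [i] := H 0%N.
have [Qi|nQ] := pselect (forall j, Q j i).
  by exists i; rewrite ?inE ?eqxx.
have /existsNP[j0 nQj] := nQ.
have [|i' i's Qi'] := IH; last by exists i'; rewrite // inE i's orbT.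
move=> j; have [i'] := H (maxn j j0); rewrite inE => /orP[/eqP ->|i's] Qm.
  by case: nQj; exact: decr (leq_maxr j j0) Qm.
by exists i' => //; exact: decr (leq_maxl j j0) Qm.
Qed.

Lemma reach_cat c k (y s : ternary) :
  reach c (size y + k) (y ++ s) = reach c (size y) (y ++ s) && reach c k s.
Proof. by elim: y => [//|i y IH] /=; rewrite IH andbA. Qed.

Lemma reach_pred c j i (s : ternary) : reach c j.+1 (i :: s) -> reach c j s.
Proof. by case/andP. Qed.

Definition survives (c : ternary -> bool) (u : ternary) : Prop :=
  forall j, exists2 x, size x = j & reach c j (x ++ u).

Lemma survives_child c u : survives c u ->
  exists i, c (i :: u) /\ survives c (i :: u).
Proof.
move=> su.
have [j i [cu [x xj rx]]||i _ H] := @pigeonhole _ (enum 'I_3)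
    (fun j i => c (i :: u) /\ exists2 x, size x = j & reach c j (x ++ i :: u)).
- split=> //; case: x xj rx => [//|i' x] [xj] /reach_pred rx.
  by exists x.
- move=> j; have [x] := su j.+1; case/lastP: x => [//|y i].
  rewrite size_rcons => -[yj]; rewrite cat_rcons -yj -addn1 reach_cat /=.
  by rewrite andbT => /andP[ry ci]; exists i; rewrite ?mem_enum //; split=> //; exists y.
- exists i; split; first by have [] := H 0%N.
  by move=> j; have [] := H j.
Qed.

Section Rays.
Variable v : bfs_enumeration.

Notation src := branch_src.
Notation tgt := (branch_tgt v).
Notation len := (branch_len v).
Notation at_edge := (edge_vertex v).
Notation br := (branch v).
Notation root := (G_root v).

Definition inside L (x : G v) : bool :=
  match x with
  | inl (inl t) => (size t <= L)%N
  | inl (inr n) => (n < ball_size L)%N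
  | inr u => in_ball L (tag u)
  end.

Lemma inside_edge L e k : in_ball L e -> (k <= len e)%N -> inside L (at_edge e k).
Proof.
move=> ie kl; rewrite /edge_vertex.
case: (path_vertexP src tgt (branch_len_gt0 v) kl) => [_|_|j _] //.
- by case: e ie {kl} => [s i|[|n]|n] //= h; exact: ltnW.
- by case: e ie {kl} => [s i|n|n] //= h; rewrite (bfs_ballE v).
Qed.

Section OneConfiguration.
Variables (T : G v * G v -> bool) (L : nat).
Hypothesis conn : ball_connected T L.

Lemma root_word_linked t : (size t <= L)%N ->
  linked (config_ball_rel T L) root (br (inl t)).
Proof.
elim: t => [|i t IH] tL; first exact: linked_refl.
apply: linked_trans (IH (ltnW tL)) _.
have ie : in_ball L (TreeEdge t i) by [].
have <- : at_edge (TreeEdge t i) (len (TreeEdge t i)) = br (inl (i :: t)).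
  exact: at_edge_len.
suff : forall k, (k <= len (TreeEdge t i))%N ->
    linked (config_ball_rel T L) (at_edge (TreeEdge t i) 0) (at_edge (TreeEdge t i) k).
  by exact.
elim=> [|k IHk] kl; first exact: linked_refl.
exact: linked_trans (IHk (ltnW kl)) (conn ie kl).
Qed.

Lemma inside_path x p : inside L x -> path (config_ball_rel T L) x p ->
  all (inside L) (x :: p).
Proof.
elim: p x => [|y p IH] x ix /=; first by rewrite ix.
case/andP=> /andP[_ /asboolP[e [k [ie kl E]]]] pp.
rewrite ix -[_ && _]/(all (inside L) (y :: p)) IH //.
case: E => [[_ ->]|[-> _]]; first exact: inside_edge.
exact: inside_edge (ltnW kl).
Qed.

Section Branch.
Variables (u : ternary) (g : ternary -> 'I_3).
Hypothesis uL : size u = L.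
Hypothesis gP : forall t, survives (config_coin T) t ->
  config_coin T (g t :: t) /\ survives (config_coin T) (g t :: t).
Hypothesis su : survives (config_coin T) u.

Definition branch_word n : ternary := iter n (fun t => g t :: t) u.

Definition branch_step n : branch_edge := TreeEdge (branch_word n) (g (branch_word n)).

Lemma branch_survives n : survives (config_coin T) (branch_word n).
Proof. by elim: n => [//|n /gP[]]. Qed.

Lemma size_branch_word n : size (branch_word n) = (L + n)%N.
Proof. by elim: n => [|n IH]; rewrite ?addn0 //= IH addnS. Qed.

Lemma branch_present n k : (k < len (branch_step n))%N ->
  T (at_edge (branch_step n) k, at_edge (branch_step n) k.+1).
Proof. by have [/asboolP h _] := gP (branch_survives n); exact: h. Qed.

(** The branch is traversed by pairs (index of the path, position on it); the end of a path is
    represented as position 0 of the next. *)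
Definition position_next (q : nat * nat) : nat * nat :=
  if (q.2.+1 < len (branch_step q.1))%N then (q.1, q.2.+1) else (q.1.+1, 0%N).

Definition position m : nat * nat := iter m position_next (0%N, 0%N).

Definition branch_ray m : G v :=
  at_edge (branch_step (position m).1) (position m).2.

Lemma position_lt m : ((position m).2 < len (branch_step (position m).1))%N.
Proof.
elim: m => [|m IH]; first exact: branch_len_gt0.
rewrite /position iterS -/(position m) /position_next.
by case: ifP => // _; exact: branch_len_gt0.
Qed.

(** The time is the length travelled, so the position determines it; with [locate] this makes the
    branch injective. *)
Lemma position_sum m :
  m = (\sum_(i < (position m).1) len (branch_step i) + (position m).2)%N.
Proof.
elim: m => [|m IH]; first by rewrite big_ord0.
rewrite /position iterS -/(position m) /position_next.
move: IH (position_lt m); case: (position m) => n k.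
rewrite -[(n, k).1]/n -[(n, k).2]/k => IH lt; case: ifP => h.
  suff : m.+1 = (\sum_(i < n) len (branch_step i) + k.+1)%N by [].
  by rewrite addnS -IH.
have {}h : (k.+1 < len (branch_step n))%N = false by exact: h.
suff : m.+1 = (\sum_(i < n.+1) len (branch_step i) + 0)%N by [].
rewrite big_ord_recr [nat_of_ord _]/= addn0 {1}IH -addnS; congr (_ + _)%N.
by apply/eqP; rewrite eqn_leq lt leqNgt h.
Qed.

Lemma branch_ray_step m : T (branch_ray m, branch_ray m.+1).
Proof.
have lt := position_lt m.
rewrite {2}/branch_ray /position iterS -/(position m) /position_next.
have := branch_present lt; rewrite -/(branch_ray m); case: ifP => // h.
suff -> : at_edge (branch_step (position m).1) (position m).2.+1 =
    at_edge (branch_step (position m).1.+1) 0 by [].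
have -> : (position m).2.+1 = len (branch_step (position m).1) by lia.
exact: at_edge_len.
Qed.

Definition locate (x : G v) : nat * nat :=
  match x with
  | inl (inl t) => ((size t - L)%N, 0%N)
  | inr w => if tag w is TreeEdge t i then ((size t - L)%N, (tagged w).+1)
             else (0%N, 0%N)
  | _ => (0%N, 0%N)
  end.

Lemma locate_step n k : (k < len (branch_step n))%N ->
  locate (at_edge (branch_step n) k) = (n, k).
Proof.
move=> kl; rewrite /edge_vertex.
case: (path_vertexP src tgt (branch_len_gt0 v) (ltnW kl)) => [->|kL|j ->].
- by rewrite /= size_branch_word addKn.
- by rewrite kL ltnn in kl.
- by rewrite /=; congr (_, _); rewrite size_branch_word addKn.
Qed.

Lemma branch_ray_inj : injective branch_ray.
Proof.
move=> m m' E; rewrite (position_sum m) (position_sum m').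
have := locate_step (position_lt m); rewrite -/(branch_ray m) E.
rewrite (locate_step (position_lt m')) -surjective_pairing => ->.
by case: (position m).
Qed.

Lemma branch_ray0 : branch_ray 0 = br (inl u).
Proof. by []. Qed.

Lemma branch_ray_outside m : (0 < m)%N -> ~~ inside L (branch_ray m).
Proof.
move=> m0; have lt := position_lt m; have := position_sum m.
rewrite /branch_ray; case: (position m) lt => n k.
rewrite -[(n, k).1]/n -[(n, k).2]/k => lt mE.
rewrite /edge_vertex; move: mE.
case: (path_vertexP src tgt (branch_len_gt0 v) (ltnW lt)) => [->|kL|j _] mE.
- rewrite /= size_branch_word -ltnNge; case: n mE {lt} => [|n] mE; last lia.
  by rewrite mE big_ord0 in m0.
- by rewrite kL ltnn in lt.
- by rewrite /= size_branch_word -ltnNge ltnS leq_addr.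
Qed.

Lemma branch_ray_word m t : branch_ray m = br (inl t) -> exists n, t = branch_word n.
Proof.
have lt := position_lt m.
rewrite /branch_ray; case: (position m) lt => n k.
rewrite -[(n, k).1]/n -[(n, k).2]/k => lt.
rewrite /edge_vertex.
case: (path_vertexP src tgt (branch_len_gt0 v) (ltnW lt)) => [_|kL|j _] //.
  by case=> <-; exists n.
by rewrite kL ltnn in lt.
Qed.

Lemma branch_ray_visits : exists2 m, (0 < m)%N & branch_ray m = br (inl (branch_word 1)).
Proof.
have H k : (k < len (branch_step 0))%N -> position k = (0%N, k).
  elim: k => [//|k IH] kl; rewrite /position iterS -/(position k) IH ?(ltnW kl) //.
  by rewrite /position_next kl.
have l0 := branch_len_gt0 v (branch_step 0).
have l1 : ((len (branch_step 0)).-1 < len (branch_step 0))%N by rewrite prednK.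
exists (len (branch_step 0)) => //.
rewrite /branch_ray -[X in position X](prednK l0) /position iterS.
rewrite -/(position _) H // /position_next /= prednK // ltnn.
by [].
Qed.

(* The simple path in the ball from the root to [u], followed by the branch. *)
Lemma branch_simple_ray : exists r, [/\ simple_rays T root r,
  exists n, r n = br (inl (branch_word 1)) &
  forall n t, (L < size t)%N -> r n = br (inl t) -> exists m, t = branch_word m].
Proof.
have lk : linked (config_ball_rel T L) root (br (inl u)).
  by apply: root_word_linked; rewrite uL.
have [p [pp lp up]] := linked_uniq lk.
have ins := inside_path (isT : inside L root) pp.
pose r n : G v := if (n <= size p)%N then nth root (root :: p) n
                  else branch_ray (n - size p).
have rp : r (size p) = branch_ray 0.
  by rewrite /r leqnn branch_ray0 -lp (last_nth root).
have rS n : (size p <= n)%N -> r n = branch_ray (n - size p).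
  rewrite leq_eqVlt => /orP[/eqP <-|pn]; first by rewrite subnn rp.
  by rewrite /r leqNgt pn.
have rin n : (n <= size p)%N -> inside L (r n).
  by move=> np; rewrite /r np; apply: (allP ins); rewrite mem_nth.
exists r; split.
- split.
  + by rewrite /r.
  + have W n n' : (n < n')%N -> r n <> r n'.
      move=> nn' E; have [n'p|pn'] := leqP n' (size p).
        have np := leq_trans (ltnW nn') n'p.
        move: E; rewrite /r n'p np => /eqP; rewrite nth_uniq //=.
        by move=> /eqP E; rewrite E ltnn in nn'.
      have [np|pn] := leqP n (size p).
        have := rin n np; rewrite E rS ?(ltnW pn') //.
        by apply/negP/branch_ray_outside; rewrite subn_gt0.
      move: E; rewrite !rS ?(ltnW pn) ?(ltnW pn') // => /branch_ray_inj E.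
      lia.
    move=> n n' E; case: (ltngtP n n') => // h; first by case: (W _ _ h).
    by case: (W _ _ h).
  + move=> n; have [np|pn] := ltnP n (size p).
      rewrite /r np (ltnW np) /=.
      have := pathP root pp n np => /andP[h _]; exact: h.
    rewrite !rS ?(leqW pn) // subSn //; exact: branch_ray_step.
- have [m m0 mE] := branch_ray_visits; exists (size p + m)%N.
  by rewrite rS ?leq_addr // addKn.
- move=> n t Lt E; have [np|pn] := leqP n (size p).
    by have := rin n np; rewrite E /= leqNgt Lt.
  by move: E; rewrite rS ?(ltnW pn) //; exact: branch_ray_word.
Qed.

End Branch.

End OneConfiguration.

Lemma branch_word_suffix u g n : exists x, branch_word u g n = x ++ u.
Proof.
elim: n => [|n [x IH]]; first by exists [::].
by exists (g (branch_word u g n) :: x); rewrite /= -IH.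
Qed.

(** König's lemma picks a word of the family whose descent never dies, then a child at each step.
    Beyond level [L] the ray meets only descendants of [a], which distinguishes the rays of
    different words. *)
Lemma family_ray T L M a : (M <= L)%N -> a \in words M ->
  (forall K, (L <= K)%N -> ~ exceptional T L M K) ->
  exists r, [/\ simple_rays T root r,
    exists n t, [/\ r n = br (inl t), (L < size t)%N & exists x, t = x ++ a] &
    forall n t, (L < size t)%N -> r n = br (inl t) -> exists x, t = x ++ a].
Proof.
move=> ML aM nex.
have conn : ball_connected T L.
  by have /not_orP[/contrapT] := nex L (leqnn L).
have alive j : exists2 u, u \in family L M a &
    exists2 x, size x = j & reach (config_coin T) j (x ++ u).
  have /not_orP[_ ne] := nex (L + j)%N (leq_addr _ _).
  have : has (reach (config_coin T) j) (descendants j (family L M a)).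
    apply: contrapT => /negP nh; apply: ne; exists a => //.
    by rewrite /extinct addKn.
  by case/hasP=> t /mem_descendants[u uf [x xj ->]] rt; exists u => //; exists x.
pose Q j u := exists2 x, size x = j & reach (config_coin T) j (x ++ u).
have [|u uf su] := @pigeonhole _ (family L M a) Q _ alive.
  by move=> j u' [[//|i x] [xj] /reach_pred rx]; exists x.
have uL := size_in_family ML aM uf.
have [x0 x0a] : exists x, u = x ++ a by case/mapP: uf => x _ ->; exists x.
have /choice[g gP] : forall t, exists i, survives (config_coin T) t ->
    config_coin T (i :: t) /\ survives (config_coin T) (i :: t).
  move=> t; have [st|ns] := pselect (survives (config_coin T) t).
    by have [i iP] := survives_child st; exists i.
  by exists ord0.
have [r [sr [n rn] rw]] := branch_simple_ray conn uL gP su.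
have sfx m : exists x, branch_word u g m = x ++ a.
  by have [x ->] := branch_word_suffix u g m; exists (x ++ x0); rewrite x0a catA.
exists r; split=> //.
- exists n, (branch_word u g 1); split; first exact: rn.
    by rewrite (size_branch_word g uL) addn1.
  exact: (sfx 1%N).
- move=> k t Lt E; have [m ->] := rw k t Lt E; exact: sfx.
Qed.

Lemma cat_suffix_inj (x y a b : ternary) : size a = size b -> x ++ a = y ++ b ->
  a = b.
Proof.
move=> ab E; have : rev (x ++ a) = rev (y ++ b) by rewrite E.
rewrite !rev_cat => /eqP; rewrite eqseq_cat ?size_rev // => /andP[/eqP + _].
exact: (can_inj revK).
Qed.

Theorem infinitely_many_rays T :
  (forall M, exists2 L, (M <= L)%N &
     forall K, (L <= K)%N -> ~ exceptional T L M K) ->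
  infinite_set (simple_rays (T : configuration (G v)) root).
Proof.
move=> nex /finite_seqP[s sE].
(* Level [size s] has [3 ^ size s > size s] words, and their rays are distinct, which contradicts
   the finite list [s]. *)
have [L ML nL] := nex (size s).
have rays a := family_ray ML (a := a) ^~ nL.
have /choice[rho rhoP] : forall a, exists r, a \in words (size s) ->
    [/\ simple_rays T root r,
      exists n t, [/\ r n = br (inl t), (L < size t)%N & exists x, t = x ++ a] &
      forall n t, (L < size t)%N -> r n = br (inl t) -> exists x, t = x ++ a].
  move=> a; have [aM|_] := boolP (a \in words (size s)).
    by have [r rP] := rays a aM; exists r.
  by exists (fun=> root).
have : (size [seq rho a | a <- words (size s)] <= size s)%N.
  apply: uniq_leq_size.
    rewrite map_inj_in_uniq ?words_uniq // => a b aM bM E.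
    have [_ [n [t [rn Lt [x tx]]]] _] := rhoP a aM.
    have [_ _ H] := rhoP b bM; rewrite -E in H.
    have [y ty] := H n t Lt rn.
    move: aM bM; rewrite !mem_words => /eqP sa /eqP sb.
    by apply: (@cat_suffix_inj x y); rewrite ?sa ?sb // -tx -ty.
  move=> r /mapP[a aM ->]; have [h _ _] := rhoP a aM.
  have : [set` s] (rho a) by rewrite -sE.
  by [].
by rewrite size_map size_words leqNgt ltn_expl.
Qed.

End Rays.

Theorem proposition6p7 (R : realType) (v : bfs_enumeration) :
  [/\ recurrent R (G v),
      exists! h : G v -> R, potential (G_root v) h,
      forall h : G v -> R, potential (G_root v) h ->
        forall (d : measure_display) (Omega : measurableType d)
          (P : probability Omega R) (X Y : nat -> Omega -> h_state h),
          h_process (G_root v) P X -> h_process (G_root v) P Y ->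
          independent_processes P X Y ->
          {ae P, forall w, infinite_set (visited X w `&` visited Y w)} &
      forall mu : probability (configuration_borel (G v)) R,
        is_ust mu ->
        {ae mu, forall T, infinitely_many_ends (G_root v) T}].
Proof.
split.
- exact: cutoffs_recurrent (@G_cutoffs R v).
- have [h ph] := @potential_exists R (G v) (G_root v).
  by exists h; split => // h' ph'; exact: potential_unique.
- by move=> h ph d Omega P X Y hX hY _; exact: h_processes_intersect.
- move=> mu ust; have := ust_not_exceptional ust.
  by apply: negligibleS => T /= nT H; apply: nT; exact: infinitely_many_rays.
Qed.
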